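(* Let $G_{\mathrm{puz}}$ be the two-dimensional discrete torus with vertex set $V=\mathbb{Z}_n^2$ and nearest-neighbor edges (periodic boundary), and consider the AE dynamics ($\sigma=\tau=1$, $\theta=\infty$). For all large enough $n$, $$\frac{0.0388}{\log n}<p_c<\frac{0.303}{\log n}.$$
   Context: Setting. $G_{\mathrm{puz}}=(V,E_{\mathrm{puz}})$ (the puzzle graph) is a finite connected deterministic graph. $G_{\mathrm{ppl}}=(V,E_{\mathrm{ppl}})$ (the people graph) is the Erdős–Rényi random graph on the same vertex set: each unordered pair of distinct vertices is an edge independently with probability $p$ (which may depend on $n$); $\mathbb{P}_p$ denotes its law. Two vertices $v_1,v_2$ are doubly connected if $\{v_1,v_2\}\in E_{\mathrm{ppl}}\cap E_{\mathrm{puz}}$. For $v\in V$, $S\subset V$, let $\mathrm{coll}(v,S)$ (resp. $\mathrm{link}(v,S)$) be the number of $G_{\mathrm{ppl}}$-neighbors (resp. $G_{\mathrm{puz}}$-neighbors) of $v$ in $S$, not including $v$. Jigsaw percolation with parameters $\sigma\ge1$, $\tau\ge1$, $\theta\ge\tau$ ($\theta=\infty$ allowed) is the following discrete-time dynamics on partitions $\mathcal{P}^t=\{W_i^t\}$ of $V$. Given $\mathcal{P}^t$, let $\mathcal{G}_t$ be the graph with vertex set $\mathcal{P}^t$ and unoriented edges between distinct $W_i^t$ and $W_j^t$ such that, for some ordering of the two, at least one of the following holds: (J1) there are doubly connected $v_1\in W_i^t$, $v_2\in W_j^t$; (J2) there is $v_1\in W_i^t$ with $\mathrm{link}(v_1,W_j^t)\ge\theta$;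 (J3) there is $v_1\in W_i^t$ with $\mathrm{coll}(v_1,W_j^t)\ge\sigma$ and $\mathrm{link}(v_1,W_j^t)\ge\tau$. Then $\mathcal{P}^{t+1}$ is obtained by merging all sets of $\mathcal{P}^t$ that lie in the same connected component of $\mathcal{G}_t$. $\mathrm{Solve}$ is the event that, starting from $\mathcal{P}^0$ consisting of all singletons, $\mathcal{P}^t=\{V\}$ for some $t$. The critical probability $p_c$ is defined by $\mathbb{P}_{p_c}(\mathrm{Solve})=\tfrac12$. AE (adjacent-edge) dynamics is the case $\sigma=\tau=1$, $\theta=\infty$. *)

(* Defs.v *)
From HB Require Import structures.
From mathcomp Require Import all_boot all_order all_algebra.
From mathcomp Require Import boolp reals exp.

Set Implicit Arguments.
Unset Strict Implicit.
Unset Printing Implicit Defensive.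

Import Order.TTheory GRing.Theory Num.Theory.
Local Open Scope ring_scope.

(* A simple graph on a finite vertex type T is given by its edge set
   E : {set {set T}}, consisting of two-element subsets of T. *)
Definition vertex_pairs (T : finType) : {set {set T}} :=
  [set e : {set T} | #|e| == 2%N].

Definition nbr_count (T : finType) (E : {set {set T}}) (v : T) (S : {set T})
  : nat := #|[set u in S | (u != v) && ([set v; u] \in E)]|.

Section Jigsaw.
Variables (T : finType) (Epuz Eppl : {set {set T}}).
(* theta = None stands for an infinite threshold *)
Variables (sigma tau : nat) (theta : option nat).

Definition link : T -> {set T} -> nat := nbr_count Epuz.
Definition coll : T -> {set T} -> nat := nbr_count Eppl.

Definition doubly_connected (v1 v2 : T) : bool :=
  [set v1; v2] \in Eppl :&: Epuz.

Definition J1 (W W' : {set T}) : bool :=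
  [exists v1 in W, exists v2 in W', doubly_connected v1 v2].

Definition J2 (W W' : {set T}) : bool :=
  if theta is Some th then [exists v1 in W, (th <= link v1 W')%N] else false.

Definition J3 (W W' : {set T}) : bool :=
  [exists v1 in W, (sigma <= coll v1 W')%N && (tau <= link v1 W')%N].

Definition joined (W W' : {set T}) : bool :=
  [|| J1 W W', J2 W W' | J3 W W'].

Definition merge_graph (P : {set {set T}}) : rel {set T} :=
  fun W W' => [&& W \in P, W' \in P, W != W' & joined W W' || joined W' W].

Definition jigsaw_step (P : {set {set T}}) : {set {set T}} :=
  [set cover [set W' in P | connect (merge_graph P) W W'] | W in P].

Definition jigsaw (t : nat) : {set {set T}} :=
  iter t jigsaw_step [set [set v] | v : T].

Definition Solve : Prop := exists t : nat, jigsaw t = [set [set: T]].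

End Jigsaw.

Section ErdosRenyi.
Variables (R : realType) (T : finType).

Definition er_mass (p : R) (E : {set {set T}}) : R :=
  \prod_(e in vertex_pairs T) (if e \in E then p else 1 - p).

Definition er_prob (p : R) (A : {set {set T}} -> Prop) : R :=
  \sum_(E : {set {set T}} | (E \subset vertex_pairs T) && `[< A E >])
    er_mass p E.

End ErdosRenyi.

Definition is_critical (R : realType) (T : finType) (Epuz : {set {set T}})
    (sigma tau : nat) (theta : option nat) (p : R) : Prop :=
  0 <= p <= 1 /\
  er_prob p (fun Eppl => Solve Epuz Eppl sigma tau theta) = 2^-1.

(* ordS is the cyclic successor i |-> i + 1 mod n on 'I_n *)
Definition torus_edges (n : nat) : {set {set 'I_n * 'I_n}} :=
  [set e in vertex_pairs _ | [exists u : 'I_n * 'I_n,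
     (e == [set u; (ordS u.1, u.2)]) || (e == [set u; (u.1, ordS u.2)])]].

(* Main.v *)
Require Import Defs.
From HB Require Import structures.
From mathcomp Require Import all_boot all_order all_algebra.
From mathcomp Require Import boolp reals sequences exp derive realfun.
From mathcomp Require classical_sets functions normedtype.
From mathcomp Require Import ring lra zify.

(* P_p(Solve) is a polynomial in p, monotone on [0, 1] with values 0 and 1 at
   the ends, so the critical p exists and is unique, and it is enough to bound
   P_p(Solve) on either side of 1/2 at p = c / log n.

   Lower bound. If clusters are merged two at a time, the first one to exceed
   K = 2.14 log n vertices is the union of two disjoint sets of size at most K
   that are connected in both graphs. A torus animal of size m at a given site
   is one of O(m 4.83^m), by the twig code of Klarner and Rivest, and it is
   connected in the people graph with probability at most
   (1 - (1 - p)^(m-1))^(m-1), independently for two disjoint sets. For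
   p = 0.0388 / log n the resulting first moment tends to 0.

   Upper bound. From the corner of a box, a cluster grows to size K by oriented
   exploration: run to the right until a test fails, then scan the sites above
   the current row from left to right and restart from the first one that joins.
   If s = (1 - p)^k is the probability that a test against k vertices fails,
   the k-th vertex costs a factor rate(s), and the product over k is at least
   exp(- 0.6058 / p - 2), because the integral of - log rate(s) / s over [0, 1]
   is less than 0.6058. For p = 0.303 / log n this exceeds n^(-2) by a power of
   n, so that one of the n^(2 - o(1)) disjoint boxes of side K succeeds. With
   K = 6 log n / p the cluster has people edges to all vertices outside its box,
   which it absorbs, and these have people edges to all vertices of the box. *)

(** Independence is always read off from disjoint families of coordinates. To this end the people
    graph is replaced by a random set of arbitrary subsets of the vertex set, and members that are
    not pairs are discarded only where [er_prob] is compared with [Pr]. In the lower bound the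
    families are the sets inside [A1] and those inside [A2]. In the upper bound the sets inside a
    box decide on the nucleus, and those that leave the box decide whether it spreads, so that no
    second sprinkling of edges is needed.

    The numbers are two balances against the n^2 positions, with L = log n. Below, 2.14 nearly
    maximizes c log(1 / (4.83 (1 - exp(- 0.0388 c)))) over c, and this value has to exceed 2; the
    proof keeps 2.14 * 0.936 = 2.00304. Above, 0.6058 / 0.303 = 1.9993 has to stay below 2. Such
    thin margins explain the fine rational constants. *)

Set Implicit Arguments.
Unset Strict Implicit.
Unset Printing Implicit Defensive.

Import Order.TTheory GRing.Theory Num.Theory.
Local Open Scope ring_scope.

(** * Random subsets *)

Section RandomSubset.
Variables (R : realFieldType) (X : finType).
Implicit Types (p : R) (D E S : {set X}) (A B : pred {set X}).

Definition wt p E : R := \prod_(e : X) (if e \in E then p else 1 - p).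

Definition Pr p A : R := \sum_(E : {set X} | A E) wt p E.

(** Measurability with respect to the coordinates in [D]. Two events are independent when one is
    [dep D] and the other [dep (~: D)]. *)
Definition dep D A := forall E E', E :&: D = E' :&: D -> A E = A E'.

Lemma wt_ge0 p E : 0 <= p <= 1 -> 0 <= wt p E.
Proof.
move=> /andP[p0 p1]; apply: prodr_ge0 => e _.
by case: ifP => _ //; rewrite subr_ge0.
Qed.

Lemma sum_wt_prod p (phi : X -> bool -> R) :
  \sum_(E : {set X}) wt p E * \prod_e phi e (e \in E) =
  \prod_e (p * phi e true + (1 - p) * phi e false).
Proof.
rewrite bigA_distr; apply: eq_bigr => E _.
rewrite -big_split; apply: eq_bigr => e _ /=.
by case: ifP.
Qed.

Lemma Pr_ge0 p A : 0 <= p <= 1 -> 0 <= Pr p A.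
Proof. by move=> hp; apply: sumr_ge0 => E _; apply: wt_ge0. Qed.

Lemma Pr_prod p A (phi : X -> bool -> R) :
  (forall E, (A E)%:R = \prod_e phi e (e \in E)) ->
  Pr p A = \prod_e (p * phi e true + (1 - p) * phi e false).
Proof.
move=> h; rewrite -sum_wt_prod /Pr big_mkcond; apply: eq_bigr => E _.
by rewrite -h; case: (A E); rewrite ?mulr1 ?mulr0.
Qed.

Lemma PrT p : Pr p predT = 1.
Proof.
rewrite (@Pr_prod _ _ (fun _ _ => 1)); last by move=> E; rewrite big1.
by rewrite big1 // => e _; ring.
Qed.

Lemma Pr_le p A B : 0 <= p <= 1 -> (forall E, A E -> B E) -> Pr p A <= Pr p B.
Proof.
move=> hp AB; rewrite /Pr [leRHS](bigID A) /=.
rewrite (eq_bigl A); last by move=> E; case hA: (A E); rewrite ?andbF ?AB.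
by rewrite lerDl; apply: sumr_ge0 => E _; apply: wt_ge0.
Qed.

Lemma eq_Pr p A B : A =1 B -> Pr p A = Pr p B.
Proof. by move=> AB; apply: eq_bigl. Qed.

Lemma Pr_le1 p A : 0 <= p <= 1 -> Pr p A <= 1.
Proof. by move=> hp; rewrite -(PrT p); apply: Pr_le. Qed.

Lemma PrC p A : Pr p (predC A) = 1 - Pr p A.
Proof.
rewrite -(PrT p) /Pr [in RHS](bigID A) /= addrC addrK.
by apply: eq_bigl.
Qed.

Lemma PrID p B A :
  Pr p A = Pr p (fun E => B E && A E) + Pr p (fun E => ~~ B E && A E).
Proof.
rewrite /Pr (bigID B) /=.
by congr (_ + _); apply: eq_bigl => E; rewrite andbC.
Qed.

Lemma Pr_exists_le p (I : finType) (Q : pred I) (A : I -> pred {set X}) :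
  0 <= p <= 1 ->
  Pr p (fun E => [exists i, Q i && A i E]) <= \sum_(i | Q i) Pr p (A i).
Proof.
move=> hp; rewrite /Pr (exchange_big_dep predT) //= big_mkcond.
apply: ler_sum => E _; have w0 := wt_ge0 E hp.
case: existsP => [[i /andP[Qi Ai]]|_]; last by apply: sumr_ge0.
by rewrite (bigD1 i) /= ?Qi // lerDl; apply: sumr_ge0.
Qed.

Definition cyl D S : pred {set X} := fun E => E :&: D == S.

Definition cylwt D S p : R := \prod_(e in D) (if e \in S then p else 1 - p).

Let cylphi D S e (b : bool) : R := if e \in D then (b == (e \in S))%:R else 1.

Lemma cyl_prod D S E : S \subset D ->
  (cyl D S E)%:R = \prod_e cylphi D S e (e \in E).
Proof.
move=> SD; rewrite /cylphi -big_mkcond /=.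
have -> : cyl D S E = [forall e in D, (e \in E) == (e \in S)].
  apply/eqP/forall_inP => [ES e eD|h].
    by rewrite -ES inE eD andbT.
  apply/setP => e; rewrite inE; case eD: (e \in D).
    by rewrite andbT; apply/eqP/h.
  by rewrite andbF; apply/esym/negP => /(subsetP SD); rewrite eD.
case: forall_inP => h.
  by rewrite big1 // => e eD; rewrite (h e eD).
have [e eD hne] : exists2 e, e \in D & (e \in E) != (e \in S).
  apply/exists_inP; rewrite -[X in is_true X]negbK negb_exists_in.
  by apply/negP => /forall_inP h'; apply: h => e eD; move: (h' e eD); rewrite negbK.
by rewrite (bigD1 e) //= (negbTE hne) mul0r.
Qed.

Lemma Pr_cyl p D S : S \subset D -> Pr p (cyl D S) = cylwt D S p.
Proof.
move=> SD; rewrite (@Pr_prod p _ (cylphi D S)) => [|E]; last exact: cyl_prod.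
rewrite /cylphi /cylwt [RHS]big_mkcond /=.
apply: eq_bigr => e _; case: (e \in D); last by ring.
by case: (e \in S); rewrite /=; ring.
Qed.

Lemma Pr_cylI p D S S' : S \subset D -> S' \subset ~: D ->
  Pr p (fun E => cyl D S E && cyl (~: D) S' E) =
  Pr p (cyl D S) * Pr p (cyl (~: D) S').
Proof.
move=> SD S'D; rewrite (@Pr_prod p (cyl D S) (cylphi D S)) => [|E]; last exact: cyl_prod.
rewrite (@Pr_prod p (cyl (~: D) S') (cylphi (~: D) S')) => [|E]; last exact: cyl_prod.
rewrite -big_split /=.
rewrite (@Pr_prod p _ (fun e b => cylphi D S e b * cylphi (~: D) S' e b)); last first.
  by move=> E; rewrite big_split /= -!cyl_prod // -natrM mulnb.
apply: eq_bigr => e _; rewrite /cylphi inE; case: (e \in D) => /=.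
  by case: (e \in S); rewrite /=; ring.
by case: (e \in S'); rewrite /=; ring.
Qed.

Lemma Pr_partition p D A :
  Pr p A = \sum_(S : {set X} | S \subset D) Pr p (fun E => cyl D S E && A E).
Proof.
rewrite /Pr (partition_big (fun E => E :&: D) (fun S => S \subset D)) /=; last first.
  by move=> E _; apply: subsetIr.
by apply: eq_bigr => S _; apply: eq_bigl => E; rewrite andbC.
Qed.

(** [A] is a disjoint union of cylinders over [~: D], and for two cylinders over complementary sets
    the product formula is exact. *)
Lemma Pr_cyl_dep p D S A : S \subset D -> dep (~: D) A ->
  Pr p (fun E => cyl D S E && A E) = cylwt D S p * Pr p A.
Proof.
move=> SD dA; rewrite (Pr_partition p (~: D)) (Pr_partition p (~: D) A).
rewrite mulr_sumr; apply: eq_bigr => S' S'D.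
have AS' E : cyl (~: D) S' E -> A E = A S'.
  move=> /eqP h; apply: dA; rewrite h.
  by apply/esym/setIidPl.
case AS: (A S').
  rewrite -(Pr_cyl p SD).
  rewrite (@eq_Pr _ _ (fun E => cyl D S E && cyl (~: D) S' E)); last first.
    move=> E; case hc: (cyl (~: D) S' E); rewrite /= ?andbF //.
    by rewrite (AS' E hc) AS !andbT.
  rewrite Pr_cylI //; congr (_ * _); apply: eq_Pr => E.
  by case hc: (cyl (~: D) S' E); rewrite //= (AS' E hc) AS.
rewrite /Pr !big_pred0 ?mulr0 // => E.
  by case hc: (cyl (~: D) S' E); rewrite //= (AS' E hc) AS.
by case hc: (cyl (~: D) S' E); rewrite ?andbF //= (AS' E hc) AS andbF.
Qed.

(** Conditioning on the configuration [S] inside [D]. The event examined afterwards may itself be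
    chosen from [S], which is what exploration arguments need. *)
Lemma Pr_cond p D (B : {set X} -> pred {set X}) :
  (forall S, S \subset D -> dep (~: D) (B S)) ->
  Pr p (fun E => B (E :&: D) E) =
  \sum_(S : {set X} | S \subset D) cylwt D S p * Pr p (B S).
Proof.
move=> dB; rewrite (Pr_partition p D); apply: eq_bigr => S SD.
rewrite -(Pr_cyl_dep _ SD (dB S SD)); apply: eq_Pr => E.
by case hc: (cyl D S E) => //=; move/eqP: hc => ->.
Qed.

Lemma Pr_indep p D A B : dep D A -> dep (~: D) B ->
  Pr p (fun E => A E && B E) = Pr p A * Pr p B.
Proof.
move=> dA dB.
have AE E : A E = A (E :&: D) by apply: dA; rewrite -setIA setIid.
rewrite (@eq_Pr _ _ (fun E => A (E :&: D) && B E)); last by move=> E; rewrite -AE.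
rewrite (@Pr_cond p D (fun S E => A S && B E)); last first.
  by move=> S SD E E' EE'; rewrite (dB _ _ EE').
rewrite (@eq_Pr p A (fun E => A (E :&: D) && true)); last first.
  by move=> E; rewrite -AE andbT.
rewrite (@Pr_cond p D (fun S E => A S && true)) // mulr_suml.
apply: eq_bigr => S SD; rewrite -mulrA; congr (_ * _).
case: (A S) => /=; first by rewrite PrT mul1r.
by rewrite {1 2}/Pr !big_pred0_eq mul0r.
Qed.

Lemma dep_sub D D' A : D \subset D' -> dep D A -> dep D' A.
Proof.
move=> sD dA E E' h; apply: dA.
by rewrite -(setIidPr sD) !setIA h.
Qed.

Lemma Pr_cond_le p D A (B : {set X} -> pred {set X}) (c : R) :
  0 <= p <= 1 -> dep D A ->
  (forall S, S \subset D -> dep (~: D) (B S)) ->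
  (forall S, S \subset D -> A S -> Pr p (B S) <= c) ->
  Pr p (fun E => A E && B (E :&: D) E) <= c * Pr p A.
Proof.
move=> hp dA dB hB.
have AE E : A E = A (E :&: D) by apply: dA; rewrite -setIA setIid.
rewrite (@eq_Pr _ _ (fun E => A (E :&: D) && B (E :&: D) E)); last first.
  by move=> E; rewrite -AE.
rewrite (@Pr_cond p D (fun S E => A S && B S E)); last first.
  by move=> S SD E E' EE'; rewrite (dB _ SD _ _ EE').
rewrite (@eq_Pr p A (fun E => A (E :&: D) && true)); last first.
  by move=> E; rewrite -AE andbT.
rewrite (@Pr_cond p D (fun S E => A S && true)) // mulr_sumr.
apply: ler_sum => S SD; rewrite mulrCA.
have cw0 : 0 <= cylwt D S p by rewrite -Pr_cyl //; apply: Pr_ge0.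
apply: ler_wpM2l => //.
case AS: (A S) => /=; first by rewrite PrT mulr1 hB.
by rewrite {1 2}/Pr !big_pred0_eq mulr0.
Qed.

Lemma Pr_avoid p D : Pr p (fun E => [disjoint D & E]) = (1 - p) ^+ #|D|.
Proof.
rewrite (@eq_Pr _ _ (cyl D set0)); last first.
  by move=> E; rewrite -setI_eq0 /cyl setIC.
rewrite Pr_cyl ?sub0set // /cylwt -prodr_const; apply: eq_bigr => e _.
by rewrite inE.
Qed.

(** Thinning: a coordinate lies in both of two independent random sets with probability [p * q].
    This is the coupling behind [Pr_monotone]. *)
Lemma Pr_thin p q A :
  Pr (p * q) A =
  \sum_(E : {set X}) wt p E * Pr q (fun F => A (E :&: F)).
Proof.
pose phi (G : {set X}) e (b c : bool) : R := ((b && c) == (e \in G))%:R.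
have phiE E F G : (E :&: F == G)%:R = \prod_e phi G e (e \in E) (e \in F).
  have [<-|ne] := eqVneq (E :&: F) G.
    by rewrite big1 // => e _; rewrite /phi inE eqxx.
  have [e he] : exists e, (e \in E :&: F) != (e \in G).
    apply/existsP; rewrite -[X in is_true X]negbK negb_exists.
    apply: contra ne => /forallP h; apply/eqP/setP => e.
    by apply/eqP; rewrite -[_ == _]negbK.
  by rewrite (bigD1 e) //= /phi -in_setI (negbTE he) mul0r.
have E1 E : Pr q (fun F => A (E :&: F)) =
    \sum_(G | A G) \prod_e (q * phi G e (e \in E) true
                            + (1 - q) * phi G e (e \in E) false).
  rewrite /Pr (partition_big (fun F => E :&: F) A) //=.
  apply: eq_bigr => G AG.
  transitivity (Pr q (fun F => E :&: F == G)); last first.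
    by apply: (@Pr_prod q _ (fun e => phi G e (e \in E))) => F; apply: phiE.
  apply: eq_bigl => F.
  by have [->|] := eqVneq (E :&: F) G; rewrite ?AG ?andbF.
under [RHS]eq_bigr => E _ do rewrite E1 mulr_sumr.
rewrite exchange_big /=; apply: eq_bigr => G AG.
rewrite (sum_wt_prod p (fun e b => q * phi G e b true + (1 - q) * phi G e b false)).
apply: eq_bigr => e _; rewrite /phi /=.
by case: (e \in G) => /=; ring.
Qed.

Lemma Pr_monotone p p' A : 0 <= p <= p' -> p' <= 1 ->
  (forall E E', E \subset E' -> A E -> A E') -> Pr p A <= Pr p' A.
Proof.
move=> /andP[p0 pp'] p'1 mA.
have [p'0|p'0] := eqVneq p' 0.
  suff -> : p = p' by [].
  by apply/eqP; rewrite eq_le pp' p'0 p0.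
have p'_gt0 : 0 < p' by rewrite lt_def p'0 (le_trans p0).
have -> : p = p' * (p / p') by field.
have hq : 0 <= p / p' <= 1.
  by rewrite divr_ge0 ?(ltW p'_gt0) //= ler_pdivrMr // mul1r.
rewrite Pr_thin [leRHS]/Pr [leRHS]big_mkcond; apply: ler_sum => E _.
have hw : 0 <= wt p' E by apply: wt_ge0; rewrite (ltW p'_gt0).
case AE: (A E).
  by rewrite -[leRHS]mulr1; apply: ler_wpM2l => //; apply: Pr_le1.
rewrite /Pr big_pred0 ?mulr0 // => F.
by apply/negbTE/negP => h; move: (mA _ _ (subsetIl E F) h); rewrite AE.
Qed.

End RandomSubset.

(** * Existence and uniqueness of the critical probability *)

Section Critical.
Variables (R : rcfType) (X : finType) (A : pred {set X}).
Hypothesis A_mono : forall E E' : {set X}, E \subset E' -> A E -> A E'.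
Hypothesis A0 : ~~ A set0.
Hypothesis AT : A setT.

(** The probability is kept as a polynomial, so that existence is the intermediate value theorem for
    polynomials and uniqueness a count of roots. *)
Let P : {poly R} :=
  \sum_(E : {set X} | A E) \prod_(e : X) (if e \in E then 'X else 1 - 'X).

Let PE p : P.[p] = Pr p A.
Proof.
rewrite horner_sum; apply: eq_bigr => E _; rewrite horner_prod.
by apply: eq_bigr => e _; case: ifP => _; rewrite !hornerE.
Qed.

Let Pr_0 : Pr (0 : R) A = 0.
Proof.
rewrite /Pr big1 // => E AE.
have [e eE] : exists e, e \in E.
  by apply/set0Pn; apply: contraNneq A0 => <-.
by rewrite /wt (bigD1 e) //= eE mul0r.
Qed.

Let Pr_1 : Pr (1 : R) A = 1.
Proof.
rewrite -[RHS](PrT X (1 : R)) /Pr [RHS](bigID A) /= [X in _ + X]big1 ?addr0 // => E AE.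
have [e eE] : exists e, e \notin E.
  apply/existsP; rewrite -negb_forall; apply: contra AE => /forallP h.
  by suff -> : E = setT by []; apply/setP => e; rewrite inE h.
by rewrite /wt (bigD1 e) //= (negbTE eE) subrr mul0r.
Qed.

Lemma exists_critical :
  exists2 pc : R, 0 <= pc <= 1 & Pr pc A = 2^-1.
Proof.
have [x hx /rootP] : exists2 x : R, 0 <= x <= 1 & root (P - (2^-1)%:P) x.
  apply: poly_ivt => //.
  by rewrite !hornerE !PE Pr_0 Pr_1; apply/andP; split; lra.
rewrite !hornerE PE => /eqP; rewrite subr_eq0 => /eqP h.
by exists x.
Qed.

(* A polynomial taking the same value at two points of a monotone stretch is
   constant there, hence everywhere. *)
Lemma critical_inj (p p' : R) : 0 <= p <= 1 -> 0 <= p' <= 1 ->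
  Pr p A = Pr p' A -> p = p'.
Proof.
wlog lt_pp' : p p' / p < p' => [hw hp hp' e|].
  case: (ltgtP p p') => // h; first exact: hw.
  by apply/esym/hw.
move=> /andP[p0 p1] /andP[p'0 p'1] e; exfalso.
pose Q := P - (Pr p A)%:P.
have Q0 : Q != 0.
  apply/eqP => Q0; have := congr1 (horner^~ 0) Q0; have := congr1 (horner^~ 1) Q0.
  rewrite !hornerE !PE Pr_0 Pr_1 => /eqP; rewrite subr_eq0 => /eqP <- /eqP.
  by rewrite sub0r oppr_eq0 oner_eq0.
(* By monotonicity [Q] vanishes at these [size Q] distinct points between [p] and [p'], one more
   than its degree allows. *)
pose x (i : nat) : R := p + (p' - p) * (i%:R / (size Q).+1%:R).
have xr (i : nat) : (i < size Q)%N -> p <= x i <= p'.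
  move=> hi; have h0 : 0 <= i%:R / (size Q).+1%:R :> R by rewrite divr_ge0.
  have h1 : i%:R / (size Q).+1%:R <= 1 :> R.
    by rewrite ler_pdivrMr ?ltr0Sn // mul1r ler_nat ltnW // ltnW.
  rewrite /x; move: (_ / _) h0 h1 => t h0 h1; apply/andP; split; nra.
have rx : all (root Q) (mkseq x (size Q)).
  apply/allP => y /mapP[i]; rewrite mem_iota add0n => /andP[_ hi] {y}->.
  have /andP[h1 h2] := xr i hi.
  rewrite /root !hornerE PE subr_eq0 eq_le.
  rewrite {1}e !Pr_monotone ?h1 ?h2 ?p0 ?(le_trans h2) ?(le_trans p0 h1) //.
have ux : uniq (mkseq x (size Q)).
  apply/mkseq_uniq => i j /addrI /mulfI; rewrite subr_eq0 (gt_eqF lt_pp').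
  move=> /(_ isT) /divIf; rewrite pnatr_eq0 => /(_ isT) /eqP.
  by rewrite eqr_nat => /eqP.
by have := max_poly_roots Q0 rx ux; rewrite size_mkseq ltnn.
Qed.

End Critical.

(** Condition on the coordinates that are pairs: the remaining ones are free, and their weights sum
    to 1. *)
Lemma er_probE (R : realType) (T : finType) (p : R) (A : {set {set T}} -> Prop) :
  er_prob p A = Pr p (fun E => `[< A (E :&: vertex_pairs T) >]).
Proof.
rewrite (@Pr_cond _ _ p (vertex_pairs T) (fun S E => `[< A S >])) //.
rewrite /er_prob big_mkcondr; apply: eq_bigr => S SD.
case: asboolP => h; first by rewrite PrT mulr1.
by rewrite /Pr big_pred0_eq mulr0.
Qed.

(** * Connected vertex sets *)

Section Connectedness.
Variable T : finType.
Implicit Types (E : {set {set T}}) (A B : {set T}).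

(** Connectedness of the induced subgraph by cuts instead of paths: the exploration of the people
    graph and the coding of animals both ask only for an edge leaving a proper part. The empty set
    counts as connected. *)
Definition conn E A : bool :=
  [forall B : {set T}, [&& B \subset A, B != set0 & B != A] ==>
     [exists u in B, exists v in A :\: B, [set u; v] \in E]].

Lemma connP E A :
  reflect (forall B, B \subset A -> B != set0 -> B != A ->
             exists u v, [/\ u \in B, v \in A, v \notin B & [set u; v] \in E])
          (conn E A).
Proof.
apply: (iffP forallP) => [h B BA B0 BnA|h B].
  have := h B; rewrite BA B0 BnA /= => /exists_inP[u uB /exists_inP[v]].
  by rewrite inE => /andP[vB vA] uv; exists u, v.
apply/implyP => /and3P[BA B0 BnA]; have [u [v [uB vA vB uv]]] := h B BA B0 BnA.
by apply/exists_inP; exists u => //; apply/exists_inP; exists v; rewrite // inE vB.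
Qed.

Lemma conn1 E (x : T) : conn E [set x].
Proof.
by apply/connP => B; rewrite subset1 => /orP[/eqP->|/eqP->]; rewrite eqxx.
Qed.

Lemma connU E A A' (u v : T) : conn E A -> conn E A' ->
  u \in A -> v \in A' -> [set u; v] \in E -> conn E (A :|: A').
Proof.
move=> /connP cA /connP cA' uA vA' uv; apply/connP => B BAA' B0 BnAA'.
have BE : B = (B :&: A) :|: (B :&: A') by rewrite -setIUr (setIidPl BAA').
have sub (C : {set T}) : conn E C -> C \subset A :|: A' -> B :&: C != set0 ->
    B :&: C != C -> exists x y, [/\ x \in B, y \in A :|: A', y \notin B & [set x; y] \in E].
  move=> /connP cC CAA' h0 h1; have [x [y []]] := cC _ (subsetIr B C) h0 h1.
  rewrite !inE => /andP[xB xC] yC; rewrite yC andbT => yB xy; exists x, y; split=> //.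
  exact: (subsetP CAA').
have [BA0|BA0] := eqVneq (B :&: A) set0; last first.
  have [BAA|BAA] := eqVneq (B :&: A) A; last first.
    by apply: (sub A) => //; [apply/connP | apply: subsetUl].
  have [BA'0|BA'0] := eqVneq (B :&: A') set0; last first.
    have [BAA''|BAA''] := eqVneq (B :&: A') A'; last first.
      by apply: (sub A') => //; [apply/connP | apply: subsetUr].
    by move: BnAA'; rewrite BE BAA BAA'' eqxx.
  exists u, v; rewrite !inE vA' orbT; split=> //.
    by move: uA; rewrite -{1}BAA inE => /andP[].
  by apply/negP => vB; have /setP/(_ v) := BA'0; rewrite !inE vB vA'.
have [BA'0|BA'0] := eqVneq (B :&: A') set0.
  by move: B0; rewrite BE BA0 BA'0 setU0 eqxx.
have [BAA''|BAA''] := eqVneq (B :&: A') A'; last first.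
  by apply: (sub A') => //; [apply/connP | apply: subsetUr].
exists v, u; rewrite !inE uA setUC; split=> //.
  by move: vA'; rewrite -{1}BAA'' inE => /andP[].
by apply/negP => uB; have /setP/(_ u) := BA0; rewrite !inE uB uA.
Qed.

End Connectedness.

(** * Jigsaw dynamics *)

Section AdjacentEdge.
Variables (T : finType) (Epuz Eppl : {set {set T}}).
Implicit Types (P S : {set {set T}}) (W A B : {set T}).

Local Notation joinedAE := (joined Epuz Eppl 1 1 None).
Local Notation graphAE := (merge_graph Epuz Eppl 1 1 None).
Local Notation stepAE := (jigsaw_step Epuz Eppl 1 1 None).
Local Notation jigsawAE := (jigsaw Epuz Eppl 1 1 None).

Lemma nbr_count_ge1 (E : {set {set T}}) v W :
  reflect (exists2 u, u \in W & (u != v) && ([set v; u] \in E))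
          (1 <= nbr_count E v W)%N.
Proof.
apply: (iffP card_gt0P) => [[u]|[u uW h]].
  by rewrite inE => /andP[uW h]; exists u.
by exists u; rewrite inE uW.
Qed.

Lemma joined_edges W W' : joinedAE W W' ->
  (exists u v, [/\ u \in W, v \in W' & [set u; v] \in Epuz]) /\
  (exists u v, [/\ u \in W, v \in W' & [set u; v] \in Eppl]).
Proof.
rewrite /joined /J1 /J2 /J3 /= => /orP[|].
  move=> /exists_inP[u uW /exists_inP[v vW']]; rewrite /doubly_connected inE.
  by move=> /andP[h1 h2]; split; exists u, v.
move=> /exists_inP[u uW /andP[/nbr_count_ge1[v vW /andP[_ uv]]]].
by move=> /nbr_count_ge1[v' vW' /andP[_ uv']]; split; exists u; [exists v'|exists v].
Qed.

Lemma graphAE_sym P : symmetric (graphAE P).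
Proof.
move=> W W'; rewrite /merge_graph eq_sym [X in [&& _, _, _ & X]]orbC.
by case: (W \in P); case: (W' \in P).
Qed.

Lemma graphAE_edges P W W' : graphAE P W W' ->
  (exists u v, [/\ u \in W, v \in W' & [set u; v] \in Epuz]) /\
  (exists u v, [/\ u \in W, v \in W' & [set u; v] \in Eppl]).
Proof.
move=> /and4P[_ _ _ /orP[/joined_edges//|/joined_edges[[u [v [uW vW uv]]] [u' [v' [uW' vW' uv']]]]]].
by split; [exists v, u; rewrite setUC|exists v', u'; rewrite setUC].
Qed.

Lemma partition_step P : partition P setT -> partition (stepAE P) setT.
Proof.
move=> /and3P[/eqP cP tP P0].
have comp_sub W : W \in P -> W \subset cover [set W' in P | connect (graphAE P) W W'].
  by move=> WP; apply: (@bigcup_sup _ _ W); rewrite inE WP connect0.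
have step_sym : connect_sym (graphAE P) by apply/sym_connect_sym/graphAE_sym.
apply/and3P; split.
- apply/eqP/setP => x; rewrite inE.
  have : x \in cover P by rewrite cP inE.
  move=> /bigcupP[W WP xW]; apply/bigcupP.
  exists (cover [set W' in P | connect (graphAE P) W W']); first by apply/imsetP; exists W.
  exact: (subsetP (comp_sub W WP)).
- apply/trivIsetP => _ _ /imsetP[W1 W1P ->] /imsetP[W2 W2P ->] ne.
  apply/pred0P => x /=; apply/negP => /andP[/bigcupP[W1']].
  rewrite inE => /andP[W1'P c1] x1 /bigcupP[W2']; rewrite inE => /andP[W2'P c2] x2.
  have e : W1' = W2'.
    apply/eqP; apply: contraT => ne'; have := trivIsetP tP _ _ W1'P W2'P ne'.
    by move=> /pred0P/(_ x) /=; rewrite x1 x2.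
  case/eqP: ne; congr cover; apply/setP => W; rewrite !inE.
  by rewrite (same_connect step_sym c1) e (same_connect step_sym c2).
- apply/negP => /imsetP[W WP e]; move: (comp_sub W WP); rewrite -e subset0.
  by move=> /eqP W0; move: P0; rewrite -W0 WP.
Qed.

Lemma partition_jigsaw t : partition (jigsawAE t) setT.
Proof.
elim: t => [|t IH]; last exact: partition_step.
apply/and3P; split.
- apply/eqP/setP => x; rewrite inE; apply/bigcupP; exists [set x]; rewrite ?inE //.
  exact: imset_f.
- apply/trivIsetP => _ _ /imsetP[x _ ->] /imsetP[y _ ->] ne.
  by rewrite disjoints1 inE; apply: contraNneq ne => ->.
- by apply/negP => /imsetP[x _ /setP/(_ x)]; rewrite !inE eqxx.
Qed.

Definition biconn A := conn Epuz A && conn Eppl A.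

(* The first merger exceeding size K, when clusters are merged one pair at a
   time. *)
Definition critical_pair (K : nat) (A1 A2 : {set T}) : bool :=
  [&& biconn A1, biconn A2, [disjoint A1 & A2], (#|A1| <= K)%N, (#|A2| <= K)%N,
      (K < #|A1| + #|A2|)%N &
      [exists u in A1, exists v in A2, [set u; v] \in Epuz]].

(** One step merges a whole component and may jump far beyond size [2 K]. The component is therefore
    rebuilt one cluster at a time along the merge graph, [S] being the part joined so far; the first
    union larger than [K] exhibits the pair. *)
Lemma step_critical K P C : partition P setT ->
  (forall W, W \in P -> biconn W && (#|W| <= K)%N) -> C \in stepAE P ->
  (biconn C && (#|C| <= K)%N) \/ exists A1 A2, critical_pair K A1 A2.
Proof.
move=> /and3P[/eqP cP tP P0] hP /imsetP[W WP ->{C}].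
set comp := [set W' in P | _].
have step_sym : connect_sym (graphAE P) by apply/sym_connect_sym/graphAE_sym.
have Wc : W \in comp by rewrite inE WP connect0.
suff main : forall k S, (#|comp| - #|S| <= k)%N -> S \subset comp -> W \in S ->
    biconn (cover S) -> (#|cover S| <= K)%N ->
    biconn (cover comp) && (#|cover comp| <= K)%N \/ exists A1 A2, critical_pair K A1 A2.
  have /andP[bW sW] := hP W WP.
  have c1 : cover [set W] = W by rewrite /cover big_set1.
  by apply: (main #|comp| [set W]); rewrite ?leq_subr ?sub1set ?set11 ?c1.
elim=> [|k IH] S hk Sc WS bS sS.
  suff <- : S = comp by left; rewrite bS.
  by apply/eqP; rewrite eqEcard Sc -subn_eq0 -leqn0.
have [<-|neS] := eqVneq S comp; first by left; rewrite bS.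
have [W1 [W2 [W1S W2S g12]]] : exists W1 W2, [/\ W1 \in S, W2 \notin S & graphAE P W1 W2].
  apply: contrapT => h; case/eqP: neS; apply/eqP; rewrite eqEsubset Sc /=.
  apply/subsetP => W'; rewrite inE => /andP[_ cWW'].
  have cl : closed (graphAE P) (mem S).
    move=> X Y gXY; case XS: (X \in S); case YS: (Y \in S) => //; exfalso; apply: h.
      by exists X, Y; rewrite XS YS.
    by exists Y, X; rewrite XS YS graphAE_sym.
  by have := closed_connect cl cWW'; rewrite /in_mem /= => <-.
have W2P : W2 \in P by case/and4P: g12.
have W1P : W1 \in P by case/and4P: g12.
have W2c : W2 \in comp.
  rewrite inE W2P /=; have := subsetP Sc _ W1S; rewrite inE => /andP[_ c].
  by apply: connect_trans c (connect1 g12).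
have /andP[bW2 sW2] := hP _ W2P.
have sub1 : W1 \subset cover S by apply: (@bigcup_sup _ _ W1).
have [[u [v [uW1 vW2 uv]]] [u' [v' [uW1' vW2' uv']]]] := graphAE_edges g12.
have covE : cover (W2 |: S) = cover S :|: W2.
  by rewrite /cover bigcup_setU big_set1 setUC.
have bU : biconn (cover S :|: W2).
  move: bS bW2 => /andP[b1 b2] /andP[b3 b4]; apply/andP; split.
    by apply: (connU b1 b3 _ vW2 uv); apply: (subsetP sub1).
  by apply: (connU b2 b4 _ vW2' uv'); apply: (subsetP sub1).
have dis : [disjoint cover S & W2].
  apply/pred0P => x /=; apply/negP => /andP[/bigcupP[X XS xX] xW2].
  have XP : X \in P by have := subsetP Sc _ XS; rewrite inE => /andP[].
  have ne : X != W2 by apply: contraNneq W2S => <-.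
  by have /pred0P/(_ x) /= := trivIsetP tP _ _ XP W2P ne; rewrite xX xW2.
have [small|big] := leqP #|cover S :|: W2| K.
  apply: (IH (W2 |: S)); rewrite ?covE ?inE ?WS ?orbT //.
    by rewrite cardsU1 W2S /= addnC subnDA leq_subLR add1n.
  by rewrite subUset sub1set W2c.
right; exists (cover S), W2; rewrite /critical_pair bS bW2 dis sS sW2 /=.
rewrite -cardsUI (disjoint_setI0 dis) cards0 addn0 big /=.
by apply/exists_inP; exists u; [apply: (subsetP sub1)|apply/exists_inP; exists v].
Qed.

(** Without a critical pair, [step_critical] would keep all clusters at size at most [K < #|T|]
    forever. *)
Lemma solve_critical_pair K : (0 < K)%N -> (K < #|T|)%N ->
  Solve Epuz Eppl 1 1 None -> exists A1 A2, critical_pair K A1 A2.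
Proof.
move=> K0 KT [t0 ht0]; apply: contrapT => nex.
have all_small t W : W \in jigsawAE t -> biconn W && (#|W| <= K)%N.
  elim: t W => [|t IH] W.
    by move=> /imsetP[x _ ->]; rewrite /biconn !conn1 cards1.
  by move=> /(step_critical (partition_jigsaw t) IH)[].
have /all_small/andP[_] : setT \in jigsawAE t0 by rewrite ht0 inE.
by rewrite cardsT leqNgt KT.
Qed.

(** The upper bound uses only the addition of single vertices to one cluster. Each addition costs at
    most one time step of the true dynamics, so such a set ends up inside one cluster
    ([grown_jigsaw]). *)
Inductive grown : {set T} -> Prop :=
| grown1 x : grown [set x]
| grownU v W : grown W -> v \notin W ->
    (exists2 u, u \in W & [set v; u] \in Epuz) ->
    (exists2 u, u \in W & [set v; u] \in Eppl) -> grown (v |: W).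

Lemma grown_jigsaw W : grown W -> exists t, exists2 B, B \in jigsawAE t & W \subset B.
Proof.
elim=> {W} [x|v W _ [t [B Bt WB]] vW [u uW vu] [u' uW' vu']].
  by exists 0, [set x] => //; apply: imset_f.
have [B' B't vB'] : exists2 B', B' \in jigsawAE t & v \in B'.
  have /and3P[/eqP cP _ _] := partition_jigsaw t.
  have : v \in cover (jigsawAE t) by rewrite cP inE.
  by move=> /bigcupP[B' h1 h2]; exists B'.
exists t.+1; exists (cover [set W' in jigsawAE t | connect (graphAE (jigsawAE t)) B W']).
  by apply/imsetP; exists B.
rewrite subUset sub1set; apply/andP; split; last first.
  apply: (subset_trans WB).
  by apply: (@bigcup_sup _ _ B); rewrite inE Bt connect0.
apply/bigcupP; exists B' => //; rewrite inE B't /=.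
have [<-|ne] := eqVneq B B'; first exact: connect0.
have vB : v \notin B.
  apply/negP => vB; have /and3P[_ /trivIsetP tP _] := partition_jigsaw t.
  by have /pred0P/(_ v) /= := tP _ _ Bt B't ne; rewrite vB vB'.
have neu w : w \in W -> w != v.
  by move=> wW; apply: contraNneq vB => <-; apply: (subsetP WB).
apply: connect1; rewrite /merge_graph Bt B't ne /=; apply/orP; right.
apply/or3P/Or33/exists_inP; exists v => //; apply/andP; split; apply/nbr_count_ge1.
  by exists u'; rewrite ?(subsetP WB) // neu.
by exists u; rewrite ?(subsetP WB) // neu.
Qed.

Lemma jigsaw_setT_solve t B : B \in jigsawAE t -> B = setT -> Solve Epuz Eppl 1 1 None.
Proof.
move=> Bt BT; exists t; subst B.
have /and3P[_ /trivIsetP tP P0] := partition_jigsaw t.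
apply/setP => W; rewrite inE; apply/idP/eqP => [Wt|->//].
apply/eqP; apply: contraT => ne; have := tP _ _ Wt Bt ne.
rewrite disjoint_sym disjoints_subset subTset => /eqP h.
suff W0 : W = set0 by rewrite -W0 Wt in P0.
by rewrite -[W]setCK h setCT.
Qed.

Lemma grown_solve : grown setT -> Solve Epuz Eppl 1 1 None.
Proof.
move=> /grown_jigsaw[t [B Bt]]; rewrite subTset => /eqP BT.
exact: jigsaw_setT_solve Bt BT.
Qed.

End AdjacentEdge.

(** * Monotonicity of [Solve] in the people graph *)

Section Monotonicity.
Variables (T : finType) (Epuz E E' : {set {set T}}).
Hypothesis EE' : E \subset E'.
Implicit Types (P : {set {set T}}) (W A B : {set T}).

Lemma nbr_count_mono (F F' : {set {set T}}) v A B : F \subset F' -> A \subset B ->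
  (nbr_count F v A <= nbr_count F' v B)%N.
Proof.
move=> FF' AB; apply/subset_leq_card/subsetP => u; rewrite !inE.
by move=> /and3P[uA -> uF]; rewrite (subsetP AB) // (subsetP FF').
Qed.

Lemma joined_mono A A' B B' : A \subset A' -> B \subset B' ->
  joined Epuz E 1 1 None A B -> joined Epuz E' 1 1 None A' B'.
Proof.
move=> AA' BB' /or3P[/exists_inP[u uA /exists_inP[v vB]]|//|/exists_inP[u uA /andP[h1 h2]]].
  rewrite /doubly_connected inE => /andP[uvE uvG]; apply/or3P/Or31/exists_inP; exists u.
    exact: (subsetP AA').
  apply/exists_inP; exists v; first exact: (subsetP BB').
  by rewrite /doubly_connected inE uvG (subsetP EE').
apply/or3P/Or33/exists_inP; exists u; first exact: (subsetP AA').
apply/andP; split; first exact: leq_trans h1 (nbr_count_mono _ EE' BB').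
exact: leq_trans h2 (nbr_count_mono _ (subxx _) BB').
Qed.

Lemma jigsaw_refine t W : W \in jigsaw Epuz E 1 1 None t ->
  exists2 W', W' \in jigsaw Epuz E' 1 1 None t & W \subset W'.
Proof.
elim: t W => [|t IH] W; first by move=> WP; exists W.
set P := jigsaw Epuz E 1 1 None t in IH *; set P' := jigsaw Epuz E' 1 1 None t in IH *.
move=> /imsetP[W0 W0P ->]; have [W0' W0'P W00'] := IH W0 W0P.
exists (cover [set X in P' | connect (merge_graph Epuz E' 1 1 None P') W0' X]).
  by apply/imsetP; exists W0'.
(* The sets covered by some cluster in the component of [W0'] in the larger dynamics. This family is
   closed under the merge graph of the smaller dynamics, hence contains the whole component of
   [W0]. *)
pose a := [pred X : {set T} | [exists X' in P', (X \subset X') &&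
  connect (merge_graph Epuz E' 1 1 None P') W0' X']].
have step X Y : merge_graph Epuz E 1 1 None P X Y -> X \in a -> Y \in a.
  move=> /and4P[XP YP XY j] /exists_inP[X' X'P /andP[XX' cX']].
  have [Y' Y'P YY'] := IH Y YP; apply/exists_inP; exists Y' => //; rewrite YY' /=.
  have [<-//|ne] := eqVneq X' Y'; apply: connect_trans cX' (connect1 _).
  rewrite /merge_graph X'P Y'P ne /=; case/orP: j => j; apply/orP; [left|right].
    exact: joined_mono j.
  exact: joined_mono j.
have cl : closed (merge_graph Epuz E 1 1 None P) a.
  move=> X Y g; apply/idP/idP; apply: step => //.
  by rewrite graphAE_sym.
apply/subsetP => x /bigcupP[X]; rewrite inE => /andP[XP cX] xX.
have : W0 \in a by apply/exists_inP; exists W0'; rewrite // W00' connect0.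
rewrite (closed_connect cl cX) => /exists_inP[X' X'P /andP[XX' cX']].
by apply/bigcupP; exists X'; rewrite ?inE ?X'P // (subsetP XX').
Qed.

Lemma Solve_mono : Solve Epuz E 1 1 None -> Solve Epuz E' 1 1 None.
Proof.
move=> [t ht]; have [|W Wt TW] := @jigsaw_refine t setT; first by rewrite ht inE.
by apply: jigsaw_setT_solve Wt _; apply/eqP; rewrite -subTset.
Qed.

End Monotonicity.

(** * Connectivity of the people graph *)

Section ConnectivityProbability.
Variables (R : realFieldType) (T : finType) (p : R).
Hypothesis p01 : 0 <= p <= 1.
Implicit Types (E S : {set {set T}}) (A B Q U J : {set T}).

Lemma sum_cylwt (X : finType) (D : {set X}) (x y : R) :
  \sum_(S : {set X} | S \subset D) \prod_(e in D) (if e \in S then x else y) =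
  (x + y) ^+ #|D|.
Proof.
transitivity (\prod_(e : X) ((if e \in D then x else 0) + (if e \in D then y else 1))).
  rewrite bigA_distr big_mkcond; apply: eq_bigr => S _.
  case: ifPn => SD.
    rewrite big_mkcond; apply: eq_bigr => e _.
    by case: ifP => eD; rewrite ?eD //; case: ifP => // /(subsetP SD); rewrite eD.
  have [e eS eD] : exists2 e, e \in S & e \notin D by apply/subsetPn.
  by rewrite (bigD1 e) //= eS (negbTE eD) mul0r.
rewrite -prodr_const [RHS]big_mkcond; apply: eq_bigr => e _.
by case: ifP => // _; rewrite add0r.
Qed.

(* Every vertex of U is joined to Q by a path inside Q :|: U, in cut form. *)
Definition reached Q U E : bool :=
  [forall B : {set T}, (B \subset U) && (B != set0) ==>
     [exists u in B, exists v in U :\: B :|: Q, [set u; v] \in E]].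

Lemma reachedP Q U E :
  reflect (forall B, B \subset U -> B != set0 ->
             exists u v, [/\ u \in B, (v \in U) && (v \notin B) || (v \in Q) & [set u; v] \in E])
          (reached Q U E).
Proof.
apply: (iffP forallP) => [h B BU B0|h B].
  have := h B; rewrite BU B0 /= => /exists_inP[u uB /exists_inP[v]].
  by rewrite !inE => vB uv; exists u, v; rewrite andbC.
apply/implyP => /andP[BU B0]; have [u [v [uB vB uv]]] := h B BU B0.
by apply/exists_inP; exists u => //; apply/exists_inP; exists v; rewrite // !inE andbC.
Qed.

Definition star a U : {set {set T}} := [set [set a; u] | u in U].

Lemma pair_inj (a u v : T) : [set a; u] = [set a; v] -> u = v.
Proof.
move=> /setP e; have := e u; have := e v; rewrite !inE !eqxx !orbT.
by move=> /orP[/eqP->|/eqP->//]; rewrite orbb => /esym/eqP.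
Qed.

Lemma card_star a U : #|star a U| = #|U|.
Proof. by apply: card_imset => u v; apply: pair_inj. Qed.

(** Once [a] has been explored and removed, the edges at [a] are never consulted again. *)
Lemma reached_dep a Q U : a \notin Q -> a \notin U ->
  dep (~: star a (setT : {set T})) (reached Q U).
Proof.
move=> aQ aU E E' EE'.
suff imp (F F' : {set {set T}}) : F :&: ~: star a setT = F' :&: ~: star a setT ->
    reached Q U F -> reached Q U F'.
  by apply/idP/idP; apply: imp.
move=> FF' /reachedP h; apply/reachedP => B BU B0.
have [u [v [uB vB uv]]] := h B BU B0; exists u, v; split=> //.
have : [set u; v] \in F :&: ~: star a setT.
  rewrite inE uv inE; apply/imsetP => -[w _ /setP/(_ a)].
  rewrite !inE eqxx /= => /orP[] /eqP e.
    by move: aU; rewrite e (subsetP BU).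
  by move: vB; rewrite -e (negbTE aU) (negbTE aQ).
by rewrite FF' inE => /andP[].
Qed.

Lemma reached_explore a Q U E : a \in Q ->
  reached Q U E ->
  reached (Q :\ a :|: [set u in U | [set a; u] \in E])
    (U :\: [set u in U | [set a; u] \in E]) E.
Proof.
move=> aQ /reachedP h; set J := finset _; apply/reachedP => B BUJ B0.
have BU : B \subset U by apply: subset_trans BUJ (subsetDl _ _).
have [u [v [uB vB uv]]] := h B BU B0; exists u, v; split=> //.
have va : v != a.
  apply/eqP => e; have := subsetP BUJ _ uB; rewrite !inE (subsetP BU) //= andbT.
  by rewrite setUC -e uv.
rewrite !inE va /=; case/orP: vB => [/andP[-> ->]|->]; last by rewrite orbT.
by case: (_ \in E); rewrite ?orbT.
Qed.

(** Explore one vertex [a] of [Q]: its neighbors [J] in [U] move to the active set and [a] leaves,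
    so the total N = |Q| + |U| drops by one. By induction each vertex of [U] contributes [p] if it
    lies in [J] and [(1 - p) * z] if not, where z = 1 - (1 - p)^(N - 2). The sum over [J] is (p + (1
    - p) z)^|U|, and p + (1 - p) z = 1 - (1 - p)^(N - 1) closes the induction. *)
Lemma Pr_reached Q U : [disjoint Q & U] ->
  Pr p (reached Q U) <= (1 - (1 - p) ^+ (#|Q| + #|U|).-1) ^+ #|U|.
Proof.
have [p0 p1] := andP p01.
have r01 n : 0 <= 1 - (1 - p) ^+ n <= 1.
  have h0 : 0 <= 1 - p by rewrite subr_ge0.
  have h1 : 1 - p <= 1 by rewrite lerBlDr lerDl.
  by rewrite subr_ge0 exprn_ile1 // lerBlDr lerDl exprn_ge0.
move: {2}(#|Q| + #|U|)%N (leqnn (#|Q| + #|U|)) => n.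
elim: n Q U => [|n IH] Q U hn dQU.
  move: hn; rewrite leqn0 addn_eq0 => /andP[_ /eqP->].
  by rewrite expr0 Pr_le1.
have [U0|[b bU]] := set_0Vmem U; first by rewrite U0 cards0 expr0 Pr_le1.
have [Q0|[a aQ]] := set_0Vmem Q.
  rewrite /Pr big_pred0 => [|E].
    by apply: exprn_ge0; have /andP[] := r01 (#|Q| + #|U|).-1.
  apply/negP => /reachedP/(_ U (subxx _)) [|u [v []]].
    by apply/set0Pn; exists b.
  by move=> _; rewrite Q0 inE orbF andbN.
have aU : a \notin U by rewrite (disjointFr dQU aQ).
pose J S := [set u in U | [set a; u] \in S].
pose D := star a U.
have JD E : J (E :&: D) = J E.
  apply/setP => u; rewrite !inE; case uU: (u \in U) => //=.
  by rewrite [X in _ && X](_ : _ = true) ?andbT //; apply: imset_f.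
have U1 : (0 < #|U|)%N by apply/card_gt0P; exists b.
have Q1 : (0 < #|Q|)%N by apply/card_gt0P; exists a.
set z := 1 - (1 - p) ^+ (#|Q| + #|U|).-2.
have zE : p + (1 - p) * z = 1 - (1 - p) ^+ (#|Q| + #|U|).-1.
  rewrite -[(#|Q| + #|U|).-1]prednK; last by move: U1 Q1; clear; lia.
  by rewrite exprS /z; ring.
apply: (@le_trans _ _ (Pr p (fun E => reached (Q :\ a :|: J (E :&: D)) (U :\: J (E :&: D)) E))).
  by apply: Pr_le => // E /(reached_explore aQ); rewrite JD.
rewrite (@Pr_cond _ _ p D (fun S => reached (Q :\ a :|: J S) (U :\: J S))); last first.
  move=> S SD; apply: (@dep_sub _ (~: star a setT)).
    by rewrite setCS; apply: imsetS; apply: subsetT.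
  by apply: reached_dep; rewrite !inE ?eqxx ?(negbTE aU) ?andbF.
rewrite -zE -(card_star a U) -sum_cylwt; apply: ler_sum => S SD.
have cJ : #|J S| = #|S|.
  rewrite -(card_star a (J S)); apply: eq_card => e.
  apply/imsetP/idP => [[u]|eS]; first by rewrite inE => /andP[_ h] ->.
  have /imsetP[u uU ue] := subsetP SD _ eS.
  by exists u; rewrite // inE uU -ue.
have JU : J S \subset U by apply/subsetP => u; rewrite inE => /andP[].
have cUJ : #|U :\: J S| = (#|U| - #|J S|)%N by rewrite cardsD (setIidPr JU).
have dQ : #|Q :\ a :|: J S| = (#|Q|.-1 + #|J S|)%N.
  rewrite cardsU [X in (_ - X)%N](_ : _ = 0%N) ?subn0; last first.
    apply/eqP; rewrite cards_eq0 setI_eq0; apply: disjointWl (subsetDl _ _) _.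
    exact: disjointWr JU dQU.
  by congr (_ + _)%N; rewrite (cardsD1 a Q) aQ.
have JUc := subset_leq_card JU.
have cQU : (#|Q :\ a :|: J S| + #|U :\: J S| = (#|Q| + #|U|).-1)%N.
  rewrite dQ cUJ; move: JUc U1 Q1; clear; lia.
apply: (@le_trans _ _ (cylwt D S p * z ^+ #|U :\: J S|)).
  apply: ler_wpM2l.
    by rewrite -Pr_cyl //; apply: Pr_ge0.
  rewrite /z; have -> : (#|Q| + #|U|).-2 = (#|Q :\ a :|: J S| + #|U :\: J S|).-1 by rewrite cQU.
  apply: IH; first by rewrite cQU; move: hn; clear; lia.
  rewrite disjoint_sym disjoints_subset; apply/subsetP => u; rewrite !inE.
  move=> /andP[uJ uU]; rewrite negb_or uJ andbT negb_and.
  by rewrite (disjointFl dQU uU) orbT.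
have -> : #|U :\: J S| = #|D :\: S|.
  by rewrite cUJ cJ -(card_star a U) cardsD (setIidPr SD).
rewrite -prodr_const.
rewrite /cylwt big_mkcond [X in _ * X]big_mkcond -big_split /= [leRHS]big_mkcond.
apply: ler_prod => e _; rewrite inE; case eS: (e \in S) => /=.
  by rewrite (subsetP SD) // mulr1 p0 lexx.
have /andP[z0 z1] := r01 (#|Q| + #|U|).-2.
case: (e \in D); last by rewrite mulr1 ler01 lexx.
by rewrite lexx andbT mulr_ge0 // subr_ge0.
Qed.

Lemma Pr_conn A : A != set0 ->
  Pr p (fun E => conn E A) <= (1 - (1 - p) ^+ #|A|.-1) ^+ #|A|.-1.
Proof.
move=> /set0Pn[a aA].
have cA : #|A :\ a| = #|A|.-1 by rewrite (cardsD1 a A) aA.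
have dA : [disjoint [set a] & A :\ a] by rewrite disjoints1 !inE eqxx.
have := Pr_reached dA; rewrite cards1 cA add1n /=; apply: le_trans.
apply: Pr_le => // E /connP h; apply/reachedP => B BA B0.
have [||u [v [uB vA vB uv]]] := h B _ B0.
- by apply: subset_trans BA (subsetDl _ _).
- by apply: contraTneq BA => ->; apply/subsetPn; exists a; rewrite // !inE eqxx.
exists u, v; split=> //; rewrite !inE vA vB !andbT.
by case: (_ == _).
Qed.

(** The empty set is left out of the coordinates so that disjoint vertex sets have disjoint
    families, as [Pr_conn2] requires. *)
Lemma conn_dep A : dep [set e : {set T} | (e != set0) && (e \subset A)] (fun E => conn E A).
Proof.
move=> E E' EE'.
suff imp (F F' : {set {set T}}) :
    F :&: [set e : {set T} | (e != set0) && (e \subset A)] =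
    F' :&: [set e : {set T} | (e != set0) && (e \subset A)] -> conn F A -> conn F' A.
  by apply/idP/idP; apply: imp.
move=> FF' /connP h; apply/connP => B BA B0 BnA.
have [u [v [uB vA vB uv]]] := h B BA B0 BnA; exists u, v; split=> //.
have : [set u; v] \in F :&: [set e : {set T} | (e != set0) && (e \subset A)].
  rewrite !inE uv subUset !sub1set vA (subsetP BA) //= andbT.
  by apply/set0Pn; exists u; rewrite !inE eqxx.
by rewrite FF' inE => /andP[].
Qed.

Lemma Pr_conn2 A1 A2 : [disjoint A1 & A2] ->
  Pr p (fun E => conn E A1 && conn E A2) =
  Pr p (fun E => conn E A1) * Pr p (fun E => conn E A2).
Proof.
move=> dA; apply: Pr_indep; first exact: conn_dep.
apply: dep_sub (@conn_dep A2); apply/subsetP => e; rewrite !inE => /andP[e0 eA2].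
rewrite e0 /=; apply: contra e0 => eA1.
rewrite -subset0; apply/subsetP => x xe; rewrite inE.
have := disjointFr dA (subsetP eA1 _ xe); rewrite (subsetP eA2) //.
Qed.

End ConnectivityProbability.

(** * Counting lattice animals *)

Section Twigs.
Variables (V : finZmodType) (G : {set {set V}}).
Implicit Types (c z u d : V) (A D : {set V}).

(* An entry (c, u, d) is a cell c of the explored set whose neighbors other
   than c + u and c + d, as well as the cell c + u - d, are already settled. *)
Definition entry : Type := V * V * V.

Definition cell (x : entry) : V := x.1.1.

Definition ctx (x : entry) : seq V :=
  let: (c, u, d) := x in [:: c - u; c - d; c + u - d].

Definition nb (x : entry) : seq V :=
  let: (c, u, d) := x in [:: c + u; c - u; c + d; c - d].

(** A choice of axes. Twigs hand exchanged or reflected axes to the cells they open, so stability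
    under [frame_sym] and [frame_opp] is what matters. *)
Definition frame u d : Prop :=
  [&& u != 0, d != 0, u != d & u != - d] /\
  forall c z, [set c; z] \in G -> z \in nb (c, u, d).

Lemma frame_sym u d : frame u d -> frame d u.
Proof.
move=> [/and4P[u0 d0 ud uNd] h]; split.
  by rewrite u0 d0 eq_sym ud /=; apply: contra uNd => /eqP->; rewrite opprK.
move=> c z /h; rewrite !inE.
by case/or4P => ->; rewrite ?orbT.
Qed.

Lemma frame_opp u d : frame u d -> frame (- u) d.
Proof.
move=> [/and4P[u0 d0 ud uNd] h]; split.
  rewrite oppr_eq0 u0 d0 eqr_oppLR uNd /=.
  by rewrite eqr_opp.
move=> c z /h; rewrite !inE opprK.
by case/or4P => ->; rewrite ?orbT.
Qed.

(* The five twigs of Klarner and Rivest. *)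
Definition push (tw : 'I_5) (x : entry) : seq entry :=
  let: (c, u, d) := x in
  match val tw with
  | 0 => [::]
  | 1 => [:: (c + u, d, u)]
  | 2 => [:: (c + d, - u, d)]
  | 3 => [:: (c + d, - u, d); (c + u + d, d, u)]
  | _ => [:: (c + u, d, u); (c + d, - u, d)]
  end.

Definition opens (tw : 'I_5) : nat := nth 0%N [:: 0; 1; 1; 2; 2]%N tw.

Lemma size_push tw x : size (push tw x) = opens tw.
Proof. by case: x => [[c u] d]; case: tw => [[|[|[|[|[|]]]]]]. Qed.

Fixpoint decode (code : seq 'I_5) D (st : seq entry) : {set V} :=
  match code, st with
  | tw :: code', x :: st' =>
      decode code' (D :|: [set y in map cell (push tw x)]) (push tw x ++ st')
  | _, _ => D
  end.

Section Encode.
Variable A : {set V}.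
Hypothesis connA : conn G A.

Definition settled D z : Prop := z \in A -> z \in D.

(* K collects the cells that will be settled before st is processed. *)
Fixpoint stack_ok D (K : seq V) (st : seq entry) : Prop :=
  if st is x :: st' then
    [/\ cell x \in D, frame x.1.2 x.2,
        (forall z, z \in ctx x -> settled D z \/ z \in K) &
        stack_ok D (nb x ++ K) st']
  else True.

Lemma stack_ok_mono D D' K K' st : D \subset D' ->
  (forall z, settled D z \/ z \in K -> settled D' z \/ z \in K') ->
  stack_ok D K st -> stack_ok D' K' st.
Proof.
move=> DD'; elim: st K K' => //= x st IH K K' KK' [h1 h2 h3 h4]; split=> //.
- exact: (subsetP DD').
- by move=> z /h3; apply: KK'.
apply: IH h4 => z [h|]; first by have [|h0] := KK' z (or_introl h); [left|right; rewrite mem_cat h0 orbT].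
rewrite mem_cat => /orP[h|h]; first by right; rewrite mem_cat h.
by have [|h0] := KK' z (or_intror h); [left|right; rewrite mem_cat h0 orbT].
Qed.

Definition closed_off D st : Prop := forall c, c \in D ->
  c \in map cell st \/ forall z, [set c; z] \in G -> settled D z.

Lemma settled_mono D D' z : D \subset D' -> settled D z -> settled D' z.
Proof. by move=> /subsetP DD' h /h /DD'. Qed.

(** The twig depends on which of [c + u] and [c + d] are new cells of [A]. If only [c + d] is new,
    then [c + u + d], which belongs to the context of the child [(c + d, - u, d)], must be settled
    as well: the twig 3 opens it when it is new. In the twigs with two children, the one context
    cell of the second child that is still open is a neighbor of the first child, which is processed
    earlier; hence the list [K] in [stack_ok]. *)
Lemma twig_exists D x st : D \subset A -> stack_ok D [::] (x :: st) ->
  closed_off D (x :: st) ->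
  exists tw, let N := [set y in map cell (push tw x)] in
    [/\ N \subset A :\: D, #|N| = opens tw,
        stack_ok (D :|: N) [::] (push tw x ++ st) &
        closed_off (D :|: N) (push tw x ++ st)].
Proof.
case: x => [[c u] d] DA [/= cD fr hctx hst] hcl.
have [/and4P[u0 d0 ud uNd] hnb] := fr.
have notnew z : (z \in A) && (z \notin D) = false -> settled D z.
  by move=> + zA; rewrite zA /= => /negbFE.
have sctx z : z \in ctx (c, u, d) -> settled D z by move=> /hctx[].
have s1 : settled D (c - u) by apply: sctx; rewrite inE eqxx.
have s2 : settled D (c - d) by apply: sctx; rewrite !inE eqxx ?orbT.
have s3 : settled D (c + u - d) by apply: sctx; rewrite !inE eqxx ?orbT.
pose P tw := [set y in map cell (push tw (c, u, d))].
have step tw : P tw \subset A :\: D -> uniq (map cell (push tw (c, u, d))) ->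
    settled (D :|: P tw) (c + u) -> settled (D :|: P tw) (c + d) ->
    stack_ok (D :|: P tw) [::] (push tw (c, u, d)) ->
    exists tw, let N := [set y in map cell (push tw (c, u, d))] in
    [/\ N \subset A :\: D, #|N| = opens tw,
        stack_ok (D :|: N) [::] (push tw (c, u, d) ++ st) &
        closed_off (D :|: N) (push tw (c, u, d) ++ st)].
  move=> hN un hU hR hok; have DD' : D \subset D :|: P tw by apply: subsetUl.
  have nbs z : z \in nb (c, u, d) -> settled (D :|: P tw) z.
    by rewrite !inE => /or4P[] /eqP-> //; exact: (settled_mono DD').
  exists tw; split=> //.
  - by rewrite cardsE (card_uniqP un) size_map size_push.
  - have hst' K : stack_ok (D :|: P tw) K st.
      apply: (stack_ok_mono DD' _ hst) => z [h|].
        by left; exact: (settled_mono DD' h).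
      by move=> /nbs; left.
    rewrite -/(P tw); move: (D :|: P tw) hok hst' => D' hok hst'.
    elim: (push tw (c, u, d)) [::] hok => [|y ps IH] K //= [h1 h2 h3 h4].
    by split=> //; apply: IH.
  - move=> c'; rewrite inE => /orP[/hcl[]|].
    + rewrite inE => /orP[/eqP->|h]; last by left; rewrite map_cat mem_cat h orbT.
      by right => z /hnb /nbs.
    + by move=> h; right => z /h; apply: settled_mono.
    + by rewrite inE => h; left; rewrite map_cat mem_cat h.
have fr1 := frame_sym fr; have fr2 := frame_opp fr.
have e1 : c + u + d - u = c + d by rewrite addrAC addrK.
have new1 (z : V) D' : z \in D' -> settled D' z by move=> h _.
have DP tw : D \subset D :|: P tw by apply: subsetUl.
have inP tw y : y \in map cell (push tw (c, u, d)) -> settled (D :|: P tw) y.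
  by move=> h _; rewrite !inE h orbT.
have cDP tw : c \in D :|: P tw by rewrite inE cD.
have old tw z : settled D z -> settled (D :|: P tw) z by apply: settled_mono.
case hU: ((c + u \in A) && (c + u \notin D)); case hR: ((c + d \in A) && (c + d \notin D)).
- pose tw : 'I_5 := @Ordinal 5 4 isT; apply: (step tw).
  + apply/subsetP => y; rewrite !inE => /orP[] /eqP->; rewrite andbC.
      by rewrite hU.
    by rewrite hR.
  + by rewrite /= inE andbT (inj_eq (addrI _)).
  + by apply: inP; rewrite inE eqxx.
  + by apply: inP; rewrite !inE eqxx orbT.
  have UD : settled (D :|: P tw) (c + u) by apply: inP; rewrite inE eqxx.
  have RD : settled (D :|: P tw) (c + d) by apply: inP; rewrite !inE eqxx orbT.
  split=> //=.
  + by rewrite !inE eqxx ?orbT.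
  + move=> z; rewrite !inE addrK => /or3P[] /eqP->; left => //; first exact: old.
    by rewrite e1.
  + split=> //; first by rewrite !inE eqxx ?orbT.
    move=> z; rewrite !inE opprK addrK => /or3P[] /eqP->.
    * by right; rewrite [c + d + u]addrAC eqxx ?orbT.
    * by left; apply: new1.
    * by left; rewrite addrAC addrK; apply: old.
- pose tw : 'I_5 := @Ordinal 5 1 isT; apply: (step tw).
  + by apply/subsetP => y; rewrite !inE => /eqP->; rewrite andbC hU.
  + by [].
  + by apply: inP; rewrite inE eqxx.
  + exact/old/notnew.
  split=> //=.
  + by rewrite !inE eqxx ?orbT.
  + move=> z; rewrite !inE addrK => /or3P[] /eqP->; left; first exact: old.
      exact: new1.
    by rewrite e1; apply/old/notnew.
- case hD: ((c + u + d \in A) && (c + u + d \notin D)).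
    pose tw : 'I_5 := @Ordinal 5 3 isT; apply: (step tw).
    + apply/subsetP => y; rewrite !inE => /orP[] /eqP->; rewrite andbC.
        by rewrite hR.
      by rewrite hD.
    + by rewrite /= inE andbT addrAC -{1}[c + d]addr0 (inj_eq (addrI _)) eq_sym.
    + exact/old/notnew.
    + by apply: inP; rewrite inE eqxx.
    have RD : settled (D :|: P tw) (c + d) by apply: inP; rewrite inE eqxx.
    have DD : settled (D :|: P tw) (c + u + d) by apply: inP; rewrite !inE eqxx orbT.
    split=> //=.
    + by rewrite !inE eqxx ?orbT.
    + move=> z; rewrite !inE opprK addrK => /or3P[] /eqP->; left.
      * by rewrite addrAC.
      * exact: new1.
      * by rewrite addrAC addrK; apply: old.
    + split=> //; first by rewrite !inE eqxx ?orbT.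
      move=> z; rewrite !inE addrK e1 => /or3P[] /eqP->.
      * by left; apply/old/notnew.
      * by left.
      * right; rewrite addrAC e1.
        by rewrite eqxx ?orbT.
  pose tw : 'I_5 := @Ordinal 5 2 isT; apply: (step tw).
  + by apply/subsetP => y; rewrite !inE => /eqP->; rewrite andbC hR.
  + by [].
  + exact/old/notnew.
  + by apply: inP; rewrite inE eqxx.
  split=> //=.
  + by rewrite !inE eqxx ?orbT.
  + move=> z; rewrite !inE opprK addrK => /or3P[] /eqP->; left.
    * by rewrite addrAC; apply/old/notnew.
    * exact: new1.
    * by rewrite addrAC addrK; apply: old.
- pose tw : 'I_5 := @Ordinal 5 0 isT; apply: (step tw) => //.
  + by apply/subsetP => y; rewrite inE.
  + exact/old/notnew.
  + exact/old/notnew.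
Qed.

(** Each cell is popped once and each cell outside [D] is opened once, which gives the length and
    the sum of the code. The stack cannot run empty early: [closed_off] would then contradict
    connectedness. *)
Lemma encode_exists D st : D \subset A -> D != set0 -> stack_ok D [::] st ->
  closed_off D st ->
  exists code, [/\ size code = (#|A :\: D| + size st)%N,
    sumn (map opens code) = #|A :\: D| & decode code D st = A].
Proof.
(* A step that opens k cells lowers this measure by k + 1. *)
move: {2}(#|A :\: D| + #|A :\: D| + size st)%N
  (leqnn (#|A :\: D| + #|A :\: D| + size st)) => n.
elim: n D st => [|n IH] D st hn DA D0 hok hcl.
  move: hn; rewrite leqn0 !addn_eq0 -andbA => /and3P[/eqP h _ /eqP/size0nil st0].
  exists [::]; rewrite h st0 /=; split=> //; apply/eqP.
  by rewrite eqEsubset DA -setD_eq0 -cards_eq0 h.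
case: st hn hok hcl => [|x st] hn hok hcl.
  suff -> : A :\: D = set0.
    exists [::]; rewrite cards0; split=> //.
    move/connP: connA => /(_ D DA D0) h; apply/eqP; apply: contraT => /h.
    move=> [u [v [uD vA vD uv]]]; have [//|] := hcl u uD.
    by move=> /(_ v uv vA); rewrite (negbTE vD).
  apply/eqP; rewrite setD_eq0; apply: contraT => h.
  have /connP/(_ D DA D0) [|u [v [uD vA vD uv]]] := connA.
    by apply: contra h => /eqP->.
  by have [//|/(_ v uv vA)] := hcl u uD; rewrite (negbTE vD).
have [tw [NA cN hok' hcl']] := twig_exists DA hok hcl.
set N := [set y in map cell (push tw x)] in NA cN hok' hcl'.
have cAN : (#|A :\: D| = #|A :\: (D :|: N)| + opens tw)%N.
  rewrite -cN setDUr setIDA -[LHS](cardsID N) addnC.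
  congr (_ + _)%N; last by rewrite (setIidPr NA).
  apply: eq_card => y; rewrite !inE.
  by case: (y \in A); case: (y \in D); case: (_ \in N); rewrite ?andbF ?andbT.
have [|||code [h1 h2 h3]] := IH (D :|: N) (push tw x ++ st) _ _ _ hok' hcl'.
- rewrite size_cat size_push; move: hn; rewrite cAN /=; clear; lia.
- rewrite subUset DA /=; exact: subset_trans NA (subsetDl _ _).
- by have /set0Pn[y yD] := D0; apply/set0Pn; exists y; rewrite inE yD.
exists (tw :: code); split=> //=.
- by rewrite h1 size_cat size_push cAN; clear; lia.
- by rewrite h2 cAN addnC.
Qed.

End Encode.

Lemma animal_code A c u d : conn G A -> frame u d -> c \in A ->
  c - u \notin A -> c - d \notin A -> c + u - d \notin A ->
  exists code, [/\ size code = #|A|, sumn (map opens code) = #|A|.-1 &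
    decode code [set c] [:: (c, u, d)] = A].
Proof.
move=> cA fr cin n1 n2 n3.
have [||||code [h1 h2 h3]] := @encode_exists A cA [set c] [:: (c, u, d)].
- by rewrite sub1set.
- by apply/set0Pn; exists c; rewrite inE.
- split=> //=; first by rewrite inE.
  move=> z; rewrite !inE => /or3P[] /eqP->; left => h.
  + by rewrite h in n1.
  + by rewrite h in n2.
  + by rewrite h in n3.
- by move=> c'; rewrite inE => /eqP->; left; rewrite inE.
exists code; move: h1 h2; rewrite (cardsD1 c A) cin /= addn1 => -> ->.
by [].
Qed.

End Twigs.

(** * Generating function bound for animals *)

Section CountAnimals.
Variables (R : realFieldType) (V : finZmodType) (G : {set {set V}}) (u d : V) (m : nat).
Hypothesis fr : frame G u d.

Definition corner (A : {set V}) (c : V) : bool :=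
  [&& c \in A, c - u \notin A, c - d \notin A & c + u - d \notin A].

(** Codes are words of length [m] over five letters whose [opens] sum to [m - 1]. One letter has
    generating polynomial 1 + 2 t + 2 t^2, so a single coefficient of its [m]-th power is bounded by
    the value at [t]. *)
Lemma card_animals (t : R) : 0 < t ->
  (forall A, conn G A -> #|A| = m -> exists c, corner A c) ->
  #|[set A | conn G A & #|A| == m]|%:R * t ^+ m.-1 <= #|V|%:R * (1 + 2 * t + 2 * t ^+ 2) ^+ m.
Proof.
move=> t0 root.
pose code (f : {ffun 'I_m -> 'I_5}) := [seq f i | i <- enum 'I_m].
pose F := [set f : {ffun 'I_m -> 'I_5} | sumn (map opens (code f)) == m.-1].
have sub : [set A | conn G A & #|A| == m] \subset
    [set decode (code x.2) [set x.1] [:: (x.1, u, d)] | x in setX setT F].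
  apply/subsetP => A; rewrite inE => /andP[cA /eqP mA].
  have [c /and4P[cin n1 n2 n3]] := root A cA mA.
  have [s [h1 h2 h3]] := animal_code cA fr cin n1 n2 n3.
  pose f : {ffun 'I_m -> 'I_5} := [ffun i : 'I_m => nth ord0 s i].
  have cf : code f = s.
    have -> : code f = map (nth ord0 s) (map val (enum 'I_m)).
      by rewrite -map_comp; apply: eq_map => i; rewrite /= ffunE.
    by rewrite val_enum_ord -mA -h1 -/(mkseq _ _) mkseq_nth.
  apply/imsetP; exists (c, f); last by rewrite /= cf h3.
  by rewrite !inE /= cf h2 mA.
have cF : #|[set A | conn G A & #|A| == m]|%:R <= (#|V| * #|F|)%:R :> R.
  rewrite ler_nat; apply: leq_trans (subset_leq_card sub) _.
  by apply: leq_trans (leq_imset_card _ _) _; rewrite cardsX cardsT.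
apply: (@le_trans _ _ ((#|V| * #|F|)%:R * t ^+ m.-1)).
  by apply: ler_wpM2r => //; apply/exprn_ge0/ltW.
rewrite natrM -mulrA; apply: ler_wpM2l => //.
have prodE (f : {ffun 'I_m -> 'I_5}) :
    \prod_(i < m) t ^+ opens (f i) = t ^+ sumn (map opens (code f)).
  rewrite -expr_sum sumnE; congr (_ ^+ _).
  by rewrite /code !big_map.
have five : \sum_(j < 5) t ^+ opens j = 1 + 2 * t + 2 * t ^+ 2.
  by rewrite !big_ord_recr big_ord0 /= /opens /=; ring.
have -> : (1 + 2 * t + 2 * t ^+ 2) ^+ m =
    \sum_(f : {ffun 'I_m -> 'I_5}) \prod_(i < m) t ^+ opens (f i).
  by rewrite -(bigA_distr_bigA (fun (_ : 'I_m) (j : 'I_5) => t ^+ opens j)) prodr_const card_ord five.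
rewrite -sum1_card natr_sum mulr_suml big_mkcond /=; apply: ler_sum => f _.
rewrite inE prodE; case: ifP => [/eqP->|_]; first by rewrite mul1r.
by apply/exprn_ge0/ltW.
Qed.

End CountAnimals.

Section Translation.
Variables (R : realFieldType) (V : finZmodType) (G : {set {set V}}) (m : nat).
Hypothesis G_transl : forall c z w : V, [set c; z] \in G -> [set c + w; z + w] \in G.

Lemma conn_transl (A : {set V}) w : conn G A -> conn G [set a + w | a in A].
Proof.
move=> /connP h; apply/connP => B BA B0 BnA.
pose B' := [set a - w | a in B].
have inB' a : (a \in B') = (a + w \in B).
  apply/imsetP/idP => [[b bB ->]|h']; first by rewrite subrK.
  by exists (a + w); rewrite ?addrK.
have inA a : (a + w \in [set a + w | a in A]) = (a \in A).
  by apply: mem_imset; apply: addIr.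
have [|||a [b [aB bA bB ab]]] := h B'.
- by apply/subsetP => a; rewrite inB' => /(subsetP BA); rewrite inA.
- by have /set0Pn[b bB] := B0; apply/set0Pn; exists (b - w); rewrite inB' subrK.
- apply: contra BnA => /eqP e; apply/eqP/setP => b.
  by rewrite -[b](subrK w) inA -e inB'.
by exists (a + w), (b + w); rewrite -!inB' inA aB bA bB G_transl.
Qed.

Definition animals_at (v : V) := [set A : {set V} | [&& conn G A, #|A| == m & v \in A]].

(** Double counting of pairs of a vertex and an animal containing it; by translation every vertex
    lies in equally many animals. *)
Lemma card_animals_at v :
  (#|V| * #|animals_at v| = m * #|[set A | conn G A & #|A| == m]|)%N.
Proof.
have le v1 v2 : (#|animals_at v1| <= #|animals_at v2|)%N.
  pose tau (A : {set V}) := [set a + (v2 - v1) | a in A].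
  have tau_inj : injective tau by apply/imset_inj/addIr.
  rewrite -(card_imset _ tau_inj); apply/subset_leq_card/subsetP => B /imsetP[A].
  rewrite !inE => /and3P[cA mA vA] {B}->; rewrite conn_transl // card_imset ?mA; last exact: addIr.
  by apply/imsetP; exists v1; rewrite // addrC subrK.
have e v1 : #|animals_at v1| = #|animals_at v| by apply/eqP; rewrite eqn_leq !le.
transitivity (\sum_(w : V) #|animals_at w|)%N.
  by under eq_bigr => w _ do rewrite e; rewrite sum_nat_const.
transitivity (\sum_(w : V) \sum_(A in [set A | conn G A & #|A| == m]) (w \in A))%N.
  apply: eq_bigr => w _; rewrite -sum1_card big_mkcond [RHS]big_mkcond /=.
  apply: eq_bigr => A _; rewrite !inE andbA.
  by case: (conn G A && _); case: (w \in A).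
rewrite exchange_big /= (eq_bigr (fun=> m)) ?sum_nat_const 1?mulnC // => A.
by rewrite inE => /andP[_ /eqP <-]; rewrite -sum1_card [RHS]big_mkcond.
Qed.

End Translation.

HB.instance Definition _ (U V : finZmodType) := GRing.Zmodule.on (U * V)%type.

(** * The torus: edges, axes and corners of animals *)

Section Torus.
Variable n : nat.
Local Notation V := ('I_n.+2 * 'I_n.+2)%type.
Local Notation G := (torus_edges n.+2).

Definition e1 : V := (1, 0).
Definition e2 : V := (0, 1).

Lemma ordSE (i : 'I_n.+2) : ordS i = i + 1.
Proof. by apply: val_inj; rewrite /= modnDmr addn1. Qed.

Lemma set2_eq (T : finType) (a b c d : T) :
  [set a; b] = [set c; d] -> (a = c /\ b = d) \/ (a = d /\ b = c).
Proof.
move=> e; have : a \in [set c; d] by rewrite -e !inE eqxx.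
rewrite !inE => /orP[] /eqP ac; [left|right]; split=> //; subst a.
  exact: pair_inj e.
by apply: (@pair_inj _ d); rewrite e setUC.
Qed.

Lemma e1_neq0 : e1 != 0. Proof. by []. Qed.
Lemma e2_neq0 : e2 != 0. Proof. by []. Qed.

Lemma torus_edgeP (c z : V) :
  ([set c; z] \in G) = (z \in [:: c + e1; c - e1; c + e2; c - e2]).
Proof.
have S1 (w : V) : (ordS w.1, w.2) = w + e1.
  by rewrite ordSE; case: w => w1 w2 /=; congr (_, _); rewrite /= addr0.
have S2 (w : V) : (w.1, ordS w.2) = w + e2.
  by rewrite ordSE; case: w => w1 w2 /=; congr (_, _); rewrite /= addr0.
rewrite !inE; apply/andP/idP => [[_ /existsP[w]]|h].
  rewrite S1 S2 => /orP[] /eqP/set2_eq[] [h1 h2]; rewrite h1 h2 ?addrK ?eqxx ?orbT //.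
split.
  rewrite cards2; suff -> : c != z by [].
  have neq x : x != 0 -> (c == c + x) = false.
    by move=> x0; rewrite -[X in X == _]addr0 (inj_eq (addrI c)) eq_sym (negbTE x0).
  apply/eqP => cz; move: h; rewrite -cz.
  by rewrite !neq ?oppr_eq0 ?e1_neq0 ?e2_neq0.
apply/existsP; case/or4P: h => /eqP->.
- by exists c; rewrite S1 eqxx.
- by exists (c - e1); rewrite S1 subrK setUC eqxx.
- by exists c; rewrite S2 eqxx orbT.
- by exists (c - e2); rewrite S2 subrK setUC eqxx orbT.
Qed.

Lemma frame_torus : frame G e1 e2.
Proof.
split=> [|c z].
  apply/and4P; split=> //.
  by apply/eqP => /(congr1 fst) /eqP; rewrite /= oppr0 oner_eq0.
by rewrite torus_edgeP.
Qed.

Lemma torus_transl (c z w : V) : [set c; z] \in G -> [set c + w; z + w] \in G.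
Proof.
rewrite !torus_edgeP !inE => /or4P[] /eqP->.
all: by rewrite addrAC eqxx ?orbT.
Qed.

Lemma pred_closed (X : {set 'I_n.+2}) :
  X != set0 -> (forall y, y \in X -> y - 1 \in X) -> X = setT.
Proof.
move=> /set0Pn[y0 y0X] h; apply/setP => z; rewrite [RHS]inE.
have sub k : y0 - k%:R \in X.
  elim: k => [|k IH]; first by rewrite subr0.
  by rewrite mulrSr opprD addrA h.
have := sub (val (y0 - z)).
by rewrite natr_Zp opprB addrC subrK.
Qed.

(** A torus has no lowest row, but a set with fewer cells than the side cannot meet all rows. Some
    occupied row thus has an empty predecessor, and by the same argument some cell of that row has
    no predecessor in the row. *)
Lemma torus_corner (A : {set V}) : conn G A -> A != set0 -> (#|A| < n.+2)%N ->
  exists c, corner e1 e2 A c.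
Proof.
move=> cA A0 An.
have small (X : {set 'I_n.+2}) : (#|X| <= #|A|)%N -> X != set0 ->
    exists2 y, y \in X & y - 1 \notin X.
  move=> XA X0; apply/exists_inP; apply: contraLR An => /exists_inPn h.
  rewrite -leqNgt; apply: leq_trans XA; rewrite (pred_closed X0) ?cardsT ?card_ord //.
  by move=> y /h; rewrite negbK.
have [a aA] := set0Pn _ A0.
have [||y] := small [set c.2 | c in A]; first exact: leq_imset_card.
  by apply/set0Pn; exists a.2; apply: imset_f.
move=> /imsetP[b bA yb] yN.
have [||x] := small [set c.1 | c in A & c.2 == y].
- apply: leq_trans (leq_imset_card _ _) _; apply: subset_leq_card.
  by apply/subsetP => c; rewrite inE => /andP[].
- by apply/set0Pn; exists b.1; apply: imset_f; rewrite inE bA yb eqxx.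
move=> /imsetP[c]; rewrite inE => /andP[cA' /eqP cy] xc xN.
have low (w : V) : w.2 = y - 1 -> w \notin A.
  by move=> wy; apply: contra yN => wA; rewrite -wy; apply: imset_f.
exists c; rewrite /corner cA' /=; apply/and3P; split.
- apply: contra xN => h; apply/imsetP; exists (c - e1).
    by rewrite inE h /= subr0 cy.
  by rewrite xc.
- by apply: low; rewrite /= cy.
- by apply: low; rewrite /= cy addr0.
Qed.

Lemma card_torus_animals_at (R : realFieldType) (v : V) (m : nat) (t : R) : 0 < t ->
  (0 < m)%N -> (m < n.+2)%N ->
  #|animals_at G m v|%:R * t ^+ m.-1 <= m%:R * (1 + 2 * t + 2 * t ^+ 2) ^+ m.
Proof.
move=> t0 m0 mn; have V0 : 0 < #|{: V}|%:R :> R.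
  by rewrite ltr0n; apply/card_gt0P; exists 0.
rewrite -(ler_pM2l V0) mulrA -natrM card_animals_at; last exact: torus_transl.
rewrite natrM -mulrA [leRHS]mulrCA; apply: ler_wpM2l => //.
apply: (card_animals frame_torus) => // A cA Am; apply: torus_corner; rewrite ?Am //.
by rewrite -card_gt0 Am.
Qed.

End Torus.

(** * Lower bound *)

Section LowerBound.
Variables (R : realType) (n : nat) (p : R) (K : nat).
Local Notation V := ('I_n.+2 * 'I_n.+2)%type.
Local Notation G := (torus_edges n.+2).
Hypothesis p01 : 0 <= p <= 1.
Hypothesis Kn : (K < n.+2)%N.

(* 338/70 = (1 + 2t + 2t^2)/t at t = 7/10, close to the minimum 2 + 2 sqrt 2. *)
Let la : R := 338 / 70.
Let theta : R := la * (1 - (1 - p) ^+ K).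
Hypothesis theta1 : theta <= 1.

Let la_gt0 : 0 < la. Proof. by rewrite /la; lra. Qed.

Let small (v : V) := [set A : {set V} | [&& conn G A, (#|A| <= K)%N & v \in A]].

(** The weights cancel the exponential growth of the number of animals: each size contributes at
    most 3.38 [K], rounded up to [4 K], and size 0 nothing because [v] belongs to the animal. *)
Let sum_small v : \sum_(A in small v) (la ^+ #|A|.-1)^-1 <= K%:R ^+ 2 * 4.
Proof.
pose c (A : {set V}) : 'I_K.+1 := inord #|A|.
rewrite (partition_big c predT) //=.
have bnd (m : 'I_K.+1) : \sum_(A in small v | c A == m) (la ^+ #|A|.-1)^-1
    <= (if val m == 0%N then 0 else K%:R * 4).
  have cm (A : {set V}) : (A \in small v) && (c A == m) -> A \in animals_at G m v.
    rewrite !inE => /andP[/and3P[-> AK ->] /eqP <-]; rewrite andbT /=.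
    by rewrite inordK.
  have [m0|m0] := eqVneq (val m) 0%N.
    rewrite big1 // => A /cm; rewrite inE m0 cards_eq0 => /and3P[_ /eqP-> ].
    by rewrite inE.
  have mn : (m < n.+2)%N by apply: leq_ltn_trans Kn; rewrite -ltnS.
  apply: (@le_trans _ _ (\sum_(A in animals_at G m v) (la ^+ m.-1)^-1)).
    rewrite big_mkcond [leRHS]big_mkcond; apply: ler_sum => A _.
    case: ifP => [h|_]; last by case: ifP => // _; rewrite invr_ge0 exprn_ge0 // ltW.
    have := cm A h; move: h; case: ifP => // _ /andP[]; rewrite inE => /and3P[_ AK _] /eqP <- _.
    by rewrite inordK.
  rewrite sumr_const -[_ *+ _]mulr_natr mulrC -ler_pdivlMr ?invr_gt0 ?exprn_gt0 // invrK.
  have t0 : 0 < 7 / 10 :> R by lra.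
  have := card_torus_animals_at v t0 _ mn; rewrite lt0n => /(_ m0).
  rewrite -ler_pdivlMr ?exprn_gt0 //; move=> /le_trans; apply.
  have mS : nat_of_ord m = m.-1.+1 by rewrite prednK // lt0n.
  have -> : m%:R * (1 + 2 * (7 / 10) + 2 * (7 / 10) ^+ 2) ^+ m / (7 / 10) ^+ m.-1
     = m%:R * (338 / 100) * la ^+ m.-1 :> R.
    have -> : 1 + 2 * (7 / 10) + 2 * (7 / 10) ^+ 2 = 338 / 100 :> R by field.
    have -> : la = 338 / 100 / (7 / 10) by rewrite /la; field.
    move: (338 / 100) (7 / 10) t0 => x y y0; rewrite {2}mS exprS expr_div_n.
    have h : y ^+ m.-1 != 0 :> R by rewrite expf_neq0 // gt_eqF.
    by field.
  apply: ler_wpM2r; first by rewrite exprn_ge0 // ltW.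
  apply: ler_pM => //; [by lra | by rewrite ler_nat -ltnS | by lra].
apply: le_trans (ler_sum _ (fun m _ => bnd m)) _.
rewrite big_ord_recl /= add0r sumr_const card_ord -[_ *+ _]mulr_natr.
by rewrite le_eqVlt; apply/orP; left; apply/eqP; ring.
Qed.

(** Union bound over [a], its at most four neighbors [b], and animals at [a] and at [b]. The
    exponents |A1| - 1 and |A2| - 1 of [theta] add up to at least [K - 1], and each sum of weights
    is at most [4 K^2]; hence 64 = 4 * 4 * 4. *)
Lemma Pr_critical_pair :
  Pr p (fun E => `[< exists A1 A2, critical_pair G E K A1 A2 >]) <=
  64 * #|{: V}|%:R * K%:R ^+ 4 * theta ^+ K.-1.
Proof.
have [p0 p1] := andP p01.
have r1 : 0 <= 1 - p <= 1 by apply/andP; split; lra.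
have [r0 r1'] := andP r1.
have z0 k : 0 <= 1 - (1 - p) ^+ k by rewrite subr_ge0 exprn_ile1.
have theta0 : 0 <= theta by rewrite mulr_ge0 // ltW.
pose Q (x : V * V * {set V} * {set V}) :=
  let: (a, b, A1, A2) := x in
  [&& [set a; b] \in G, A1 \in small a, A2 \in small b,
      [disjoint A1 & A2] & (K < #|A1| + #|A2|)%N].
pose F (x : V * V * {set V} * {set V}) (E : {set {set V}}) := conn E x.1.2 && conn E x.2.
apply: (@le_trans _ _ (Pr p (fun E => [exists x, Q x && F x E]))).
  apply: Pr_le => // E /asboolP[A1 [A2]] /and5P[b1 b2 d12 A1K /and3P[A2K K12]].
  move=> /exists_inP[a aA /exists_inP[b bA ab]].
  apply/existsP; exists (a, b, A1, A2).
  move: b1 b2 => /andP[g1 c1] /andP[g2 c2].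
  by rewrite /Q /F /= ab d12 K12 !inE g1 g2 A1K A2K aA bA c1 c2.
apply: le_trans (Pr_exists_le _ _ p01) _.
pose f (A : {set V}) : R := (la ^+ #|A|.-1)^-1.
have f0 A : 0 <= f A by rewrite invr_ge0 exprn_ge0 // ltW.
pose H (x : V * V * {set V} * {set V}) : R :=
  let: (a, b, A1, A2) := x in
  ([set a; b] \in G)%:R * ((A1 \in small a)%:R * f A1) * ((A2 \in small b)%:R * f A2)
    * theta ^+ K.-1.
apply: (@le_trans _ _ (\sum_x H x)).
  rewrite big_mkcond; apply: ler_sum => -[[[a b] A1] A2] _.
  case: ifP => [|_]; last by rewrite /H !mulr_ge0 // exprn_ge0.
  rewrite /Q /F /H => /and5P[-> sA1 sA2 d12 K12] /=; rewrite sA1 sA2 !mul1r.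
  rewrite Pr_conn2 //.
  move: sA1 sA2; rewrite !inE => /and3P[_ A1K aA1] /and3P[_ A2K bA2].
  have n1 : (0 < #|A1|)%N by apply/card_gt0P; exists a.
  have n2 : (0 < #|A2|)%N by apply/card_gt0P; exists b.
  have one (A : {set V}) : (#|A| <= K)%N -> (0 < #|A|)%N ->
      Pr p (fun E => conn E A) <= f A * theta ^+ #|A|.-1.
    move=> AK A0; apply: le_trans (Pr_conn p01 _) _; first by rewrite -card_gt0.
    have -> : f A * theta ^+ #|A|.-1 = (1 - (1 - p) ^+ K) ^+ #|A|.-1.
      have -> : theta ^+ #|A|.-1 = la ^+ #|A|.-1 * (1 - (1 - p) ^+ K) ^+ #|A|.-1.
        by rewrite -exprMn.
      rewrite /f mulrA mulVf ?mul1r //.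
      by rewrite expf_neq0 // gt_eqF.
    apply: lerXn2r; rewrite ?nnegrE //.
    rewrite lerD2l lerN2; apply: ler_wiXn2l => //.
    by apply: leq_trans AK; apply: leq_pred.
  apply: (@le_trans _ _ ((f A1 * theta ^+ #|A1|.-1) * (f A2 * theta ^+ #|A2|.-1))).
    by apply: ler_pM; rewrite ?one // Pr_ge0.
  rewrite mulrACA -exprD; apply: ler_wpM2l; first exact: mulr_ge0.
  apply: ler_wiXn2l => //; move: n1 n2 K12; clear; lia.
have deg (a : V) : \sum_(b : V) ([set a; b] \in G)%:R <= 4 :> R.
  set L := [:: a + e1 n; a - e1 n; a + e2 n; a - e2 n].
  have -> : \sum_(b : V) ([set a; b] \in G)%:R = #|L|%:R :> R.
    rewrite -sum1_card natr_sum [RHS]big_mkcond; apply: eq_bigr => b _.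
    by rewrite torus_edgeP -/L; case: (b \in L).
  by rewrite -[4]/((size L)%:R) ler_nat card_size.
have sumf (a : V) : \sum_(A : {set V}) (A \in small a)%:R * f A <= K%:R ^+ 2 * 4.
  apply: le_trans (sum_small a); rewrite [leRHS]big_mkcond; apply: ler_sum => A _.
  by case: ifP => _; rewrite ?mul1r ?mul0r.
have sumf0 (a : V) : 0 <= \sum_(A : {set V}) (A \in small a)%:R * f A.
  by apply: sumr_ge0 => A _; apply: mulr_ge0.
have -> : \sum_x H x = \sum_(a : V) \sum_(b : V) ([set a; b] \in G)%:R *
    (\sum_(A : {set V}) (A \in small a)%:R * f A) *
    (\sum_(A : {set V}) (A \in small b)%:R * f A) * theta ^+ K.-1.
  transitivity (\sum_(a : V) \sum_(b : V) \sum_(A1 : {set V}) \sum_(A2 : {set V})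
     H (a, b, A1, A2)).
    by rewrite !pair_bigA; apply: eq_bigr => -[[[a b] A1] A2].
  apply: eq_bigr => a _; apply: eq_bigr => b _.
  rewrite [X in _ = X * _ * _]mulr_sumr !mulr_suml; apply: eq_bigr => A1 _.
  by rewrite [X in _ = X * _]mulr_sumr mulr_suml; apply: eq_bigr => A2 _; rewrite /H.
apply: (@le_trans _ _ (\sum_(a : V) 64 * K%:R ^+ 4 * theta ^+ K.-1)); last first.
  rewrite sumr_const -[_ *+ _]mulr_natr -mulrA mulrC !mulrA.
  by rewrite le_eqVlt; apply/orP; left; apply/eqP; ring.
apply: ler_sum => a _.
apply: (@le_trans _ _ (\sum_(b : V) ([set a; b] \in G)%:R * (16 * K%:R ^+ 4 * theta ^+ K.-1))).
  apply: ler_sum => b _; rewrite -!mulrA; apply: ler_wpM2l => //.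
  rewrite !mulrA; apply: ler_wpM2r; first exact: exprn_ge0.
  have -> : 16 * K%:R * K%:R * K%:R * K%:R = (K%:R ^+ 2 * 4) * (K%:R ^+ 2 * 4) :> R by ring.
  exact: ler_pM.
rewrite -mulr_suml.
have -> : 64 * K%:R ^+ 4 * theta ^+ K.-1 = 4 * (16 * K%:R ^+ 4 * theta ^+ K.-1) by ring.
by apply: ler_wpM2r => //; rewrite !mulr_ge0 ?exprn_ge0.
Qed.

Lemma er_prob_solve_le : (0 < K)%N ->
  er_prob p (fun Eppl => Solve G Eppl 1 1 None) <=
  64 * #|{: V}|%:R * K%:R ^+ 4 * theta ^+ K.-1.
Proof.
move=> K0; apply: le_trans Pr_critical_pair; rewrite er_probE.
apply: Pr_le => // E /asboolP h; apply/asboolP.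
have KV : (K < #|{: V}|)%N.
  apply: (leq_trans Kn); rewrite card_prod !card_ord; exact: leq_pmulr.
have [A1 [A2 h12]] := solve_critical_pair K0 KV h; exists A1, A2.
have mono (A : {set V}) : conn (E :&: vertex_pairs V) A -> conn E A.
  move=> /connP hA; apply/connP => B BA B0 BnA.
  have [u [v [uB vA vB]]] := hA B BA B0 BnA.
  by rewrite inE => /andP[uv _]; exists u, v.
move: h12 => /and5P[/andP[g1 /mono c1] /andP[g2 /mono c2] d12 k1 k2].
by apply/and5P; split=> //; apply/andP.
Qed.

End LowerBound.

(** * Numerical estimates for the lower bound *)

Section Asymptotics.
Variable R : realType.
Implicit Types (C a L e x : R).

Lemma powexp_small C a e (k : nat) : 0 < a -> 0 < e ->
  exists2 L0 : R, 0 < L0 & forall L, L0 <= L -> C * L ^+ k * expR (- (a * L)) < e.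
Proof.
move=> a0 e0.
have [c c0 hc] : exists2 c, 0 < c & forall L, 0 <= L -> c * L ^+ k.+1 < expR (a * L).
  exists (a ^+ k.+1 / k.+1`!%:R) => [|L L0].
    by rewrite divr_gt0 ?exprn_gt0 // ltr0n fact_gt0.
  apply: lt_le_trans (@expR_ge1Dxn _ _ k _); last by rewrite mulr_ge0 // ltW.
  by rewrite exprMn mulrAC ltrDr.
have C0 : 0 <= `|C| / (e * c) by rewrite divr_ge0 // mulr_ge0 // ltW.
exists (1 + `|C| / (e * c)) => [|L hL]; first by lra.
have L0 : 0 < L by lra.
rewrite expRN ltr_pdivrMr ?expR_gt0 //.
apply: le_lt_trans (_ : e * (c * L ^+ k.+1) < _); last by rewrite ltr_pM2l // hc // ltW.
apply: (@le_trans _ _ (`|C| * L ^+ k)).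
  by apply: ler_wpM2r; rewrite ?exprn_ge0 ?ler_norm // ltW.
rewrite exprS !mulrA; apply: ler_wpM2r; first by rewrite exprn_ge0 // ltW.
by rewrite mulrC -ler_pdivrMr ?mulr_gt0 //; lra.
Qed.

Lemma ln_nat_large L : exists N : nat, forall n : nat, (N <= n)%N -> L <= ln (n%:R : R).
Proof.
exists (Num.truncn (expR L)).+1 => n hn.
have h : expR L <= n%:R.
  by apply: le_trans (_ : (Num.truncn (expR L)).+1%:R <= _); rewrite ?ler_nat // ltW // truncnS_gt.
rewrite -[L]expRK ler_ln ?posrE ?expR_gt0 //.
exact: lt_le_trans (expR_gt0 _) h.
Qed.

Lemma onem_ge_expR (p : R) : p < 1 -> expR (- (p / (1 - p))) <= 1 - p.
Proof.
move=> p1; have h : 0 < 1 - p by lra.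
rewrite expRN -[leRHS]invrK lef_pV2 ?posrE ?invr_gt0 ?expR_gt0 //.
apply: le_trans (expR_ge1Dx _); rewrite le_eqVlt; apply/orP; left; apply/eqP.
by field; rewrite gt_eqF.
Qed.

(** The first-order bound at one 64th of the exponent, then six squarings with rounding down. The
    target 0.38822 is (338 / 70) * (201 / 2500) rounded up, the bound for [theta]. *)
Lemma expR_117_125_ge : 388 / 1000 + 22 / 100 / 1000 <= expR (- (117 / 125)) :> R.
Proof.
have -> : - (117 / 125) = 64%:R * - (117 / 125 / 64) :> R by field.
rewrite expRM_natl.
have a1 : (98 + 537 / 1000) / 100 <= expR (- (117 / 125 / 64)) :> R.
  by apply: le_trans (expR_ge1Dx _); lra.
move: (expR _) a1 => y a1.
have sq (c c' x : R) : 0 <= c -> c <= x -> c' <= c * c -> c' <= x * x.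
  by move=> c0 cx /le_trans; apply; apply: ler_pM.
have a2 : (97 + 95 / 1000) / 100 <= y ^+ 2 by apply: sq a1 _; lra.
have a4 : (94 + 274 / 1000) / 100 <= y ^+ 4 by rewrite (exprM y 2 2); apply: sq a2 _; lra.
have a8 : (88 + 875 / 1000) / 100 <= y ^+ 8 by rewrite (exprM y 4 2); apply: sq a4 _; lra.
have a16 : (78 + 987 / 1000) / 100 <= y ^+ 16 by rewrite (exprM y 8 2); apply: sq a8 _; lra.
have a32 : (62 + 389 / 1000) / 100 <= y ^+ 32 by rewrite (exprM y 16 2); apply: sq a16 _; lra.
by rewrite (exprM y 32 2); apply: sq a32 _; lra.
Qed.

(** 0.0832 slightly exceeds 0.0388 * 2.14 = 0.083032, to absorb the passage from [p] to
    [p / (1 - p)]. *)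
Lemma expR_52_625_ge : 1 - 201 / 50 / 50 <= expR (- (52 / 625)) :> R.
Proof.
have -> : - (52 / 625) = 8%:R * - (13 / 25 / 50) :> R by field.
apply: (@le_trans _ _ ((1 - 13 / 25 / 50) ^+ 8)); first by lra.
rewrite expRM_natl; apply: lerXn2r; rewrite ?nnegrE ?expR_ge0 //; first lra.
exact: expR_ge1Dx.
Qed.

Lemma er_prob_solve_lt n (L p : R) : 100 <= L -> expR L = n.+2%:R ->
  p * L = 97 / 50 / 50 ->
  64 * (107 / 50) ^+ 4 * expR 2 * L ^+ 4 * expR (- (1 / 1000 * L)) < 2^-1 ->
  er_prob p (fun Eppl => Solve (torus_edges n.+2) Eppl 1 1 None) < 2^-1.
Proof.
move=> L100 /esym nE pL hL.
have L_gt0 : 0 < L by lra.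
have p0 : 0 < p by rewrite -(pmulr_lgt0 _ L_gt0) pL; lra.
have pb : p <= 1 / 50 / 40 by rewrite -(ler_pM2r L_gt0) pL; lra.
have p01 : 0 <= p <= 1 by apply/andP; split; lra.
pose K := Num.truncn (107 / 50 * L).
have KL0 : 0 <= 107 / 50 * L by lra.
have /andP[K1 K2] : K%:R <= 107 / 50 * L < K.+1%:R by apply: truncn_itv.
have K0 : (0 < K)%N.
  by rewrite lt0n; apply/eqP => K0; move: K2; rewrite K0; lra.
have Kn : (K < n.+2)%N.
  rewrite -(ltr_nat R) nE; apply: le_lt_trans K1 _.
  have := @expR_ge1Dxn R L 1 (ltW L_gt0).
  have -> : 2`!%:R = 2 :> R by [].
  by move=> h; nra.
have z_le : 1 - (1 - p) ^+ K <= 201 / 50 / 50.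
  have h1 : expR (- (52 / 625)) <= (1 - p) ^+ K.
    apply: (@le_trans _ _ (expR (- (p / (1 - p))) ^+ K)); last first.
      by apply: lerXn2r; rewrite ?nnegrE ?expR_ge0 ?onem_ge_expR //; clear -pb; lra.
    rewrite -expRM_natr ler_expR mulNr lerN2 mulrAC ler_pdivrMr; last by clear -pb; lra.
    have : p * K%:R <= p * (107 / 50 * L) by apply: ler_wpM2l => //; apply: ltW.
    by rewrite [p * (_ * L)]mulrCA pL; clear -pb; lra.
  by clear -h1; have := expR_52_625_ge; lra.
have z0 : 0 <= 1 - (1 - p) ^+ K by rewrite subr_ge0 exprn_ile1 //; clear -p0 pb; lra.
have tz0 : 0 <= 338 / 70 * (1 - (1 - p) ^+ K) by apply: mulr_ge0 => //; clear; lra.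
have := er_prob_solve_le p01 Kn _ K0.
move: (1 - (1 - p) ^+ K) z_le z0 tz0 => z z_le z0 tz0 bound.
pose kappa : R := 117 / 125.
have th_le : 338 / 70 * z <= expR (- kappa).
  apply: (@le_trans _ _ (388 / 1000 + 22 / 100 / 1000)); first by clear -z_le; lra.
  exact: expR_117_125_ge.
have th1 : 338 / 70 * z <= 1.
  by apply: le_trans th_le _; rewrite expR_le1 /kappa; clear; lra.
apply: le_lt_trans (bound th1) _.
apply: le_lt_trans hL.
rewrite card_prod card_ord natrM nE.
have hth : (338 / 70 * z) ^+ K.-1 <= expR (- (kappa * (107 / 50 * L - 2))).
  apply: (@le_trans _ _ (expR (- kappa) ^+ K.-1)).
    by apply: lerXn2r; rewrite ?nnegrE ?expR_ge0.
  rewrite -expRM_natr ler_expR mulNr lerN2; apply: ler_wpM2l; first by rewrite /kappa; clear; lra.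
  have : K%:R = K.-1%:R + 1 :> R by rewrite natr1 prednK.
  by move: K2; rewrite -natr1; clear; lra.
have hK : K%:R ^+ 4 <= (107 / 50) ^+ 4 * L ^+ 4.
  by rewrite -exprMn; apply: lerXn2r; rewrite ?nnegrE.
(* Since 0.936 * 2.14 = 2.00304, the factor n^2 is beaten with more than [L / 1000] to spare. The
   shift by 2, which comes from rounding [K] and from the exponent [K.-1], costs only the factor
   [expR 2]. *)
have hexp : expR L * expR L * expR (- (kappa * (107 / 50 * L - 2))) <=
    expR 2 * expR (- (1 / 1000 * L)).
  by rewrite -!expRD ler_expR /kappa; clear -L_gt0; lra.
apply: (@le_trans _ _ (64 * (expR L * expR L) * ((107 / 50) ^+ 4 * L ^+ 4) *
    expR (- (kappa * (107 / 50 * L - 2))))).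
  apply: ler_pM hth; [|exact: exprn_ge0|].
    by rewrite !mulr_ge0 ?exprn_ge0 ?expR_ge0.
  by apply: ler_wpM2l hK; rewrite !mulr_ge0 ?expR_ge0.
have alg' (a b c d e : R) : a * b * (c * d) * e = (a * (c * d)) * (b * e) by ring.
have alg'' (a b c d e : R) : a * b * c * d * e = (a * (b * d)) * (c * e) by ring.
rewrite alg' alg''; apply: ler_wpM2l hexp.
by apply: mulr_ge0 => //; apply: mulr_ge0; apply: exprn_ge0; [clear; lra | exact: ltW].
Qed.

Lemma lower_bound : exists N : nat, forall n : nat, (N <= n)%N ->
  let p : R := 388 / 10000 / ln n%:R in
  0 <= p <= 1 /\ er_prob p (fun Eppl => Solve (torus_edges n) Eppl 1 1 None) < 2^-1.
Proof.
have hh : 0 < 2^-1 :> R by rewrite invr_gt0.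
have h1 : 0 < 1 / 1000 :> R by lra.
have [L0 L0_gt0 hL0] := powexp_small (64 * (107 / 50) ^+ 4 * expR 2) 4 h1 hh.
have [N hN] := ln_nat_large (Num.max L0 100).
exists (maxn N 2) => -[|[|n]]; rewrite geq_max ?andbF // => /andP[Nn _] p.
have := hN n.+2 Nn; rewrite ge_max => /andP[LL0 L100].
have pE : p = 97 / 50 / 50 / ln n.+2%:R by rewrite /p; congr (_ / _); lra.
have nE : expR (ln n.+2%:R) = n.+2%:R :> R by rewrite lnK // posrE ltr0n.
have L_gt0 : 0 < ln n.+2%:R :> R by apply: lt_le_trans L0_gt0 LL0.
rewrite pE; split.
  apply/andP; split; first by rewrite divr_ge0 // ?ltW //; lra.
  by rewrite ler_pdivrMr // mul1r; apply: le_trans L100; lra.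
apply: er_prob_solve_lt nE _ _; rewrite ?divfK ?gt_eqF //.
exact: hL0.
Qed.

End Asymptotics.

(** * Growth of a nucleus *)

Section Exploration.
Variables (R : realFieldType) (T : finType) (Epuz : {set {set T}}).
Implicit Types (p : R) (E : {set {set T}}) (W S Bx : {set T}) (v : T).

Definition hit E v W : bool := [exists w in W, [set v; w] \in E].

Lemma hit_star E v W : hit E v W = ~~ [disjoint star v W & E].
Proof.
apply/exists_inP/pred0Pn => [[w wW h]|[e /= /andP[/imsetP[w wW ->] h]]].
  by exists [set v; w]; rewrite /= h andbT; apply: imset_f.
by exists w.
Qed.

Lemma hit_dep v W : dep (star v W) (fun E => hit E v W).
Proof.
move=> E E' EE'; rewrite !hit_star -!setI_eq0.
by rewrite ![star v W :&: _]setIC EE'.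
Qed.

Lemma Pr_no_hit p v W : Pr p (fun E => ~~ hit E v W) = (1 - p) ^+ #|W|.
Proof.
rewrite -(card_star v W) -Pr_avoid; apply: eq_Pr => E.
by rewrite hit_star negbK.
Qed.

(* An adaptive strategy: Test v y n looks for a people edge from v to the
   current cluster, and goes on with y, after adding v, or with n. *)
Inductive tree := Done | Fail | Test of T & tree & tree.

Fixpoint success E W (t : tree) : bool :=
  match t with
  | Done => true
  | Fail => false
  | Test v y n => if hit E v W then success E (v |: W) y else success E W n
  end.

(* W is the current cluster, S the set of all vertices met so far, and K the
   target size. Since no vertex is tested twice, the tests are independent. *)
Fixpoint wf (K : nat) Bx W S (t : tree) : bool :=
  match t with
  | Done => (K <= #|W|)%N
  | Fail => true
  | Test v y n => [&& v \in Bx, v \notin S, [exists w in W, [set v; w] \in Epuz],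
                      wf K Bx (v |: W) (v |: S) y & wf K Bx W (v |: S) n]
  end.

Fixpoint tree_prob p (k : nat) (t : tree) : R :=
  match t with
  | Done => 1
  | Fail => 0
  | Test v y n => (1 - (1 - p) ^+ k) * tree_prob p k.+1 y + (1 - p) ^+ k * tree_prob p k n
  end.

Definition inner Bx : {set {set T}} := [set e : {set T} | (e != set0) && (e \subset Bx)].

Lemma star_inner v W Bx : v \in Bx -> W \subset Bx -> star v W \subset inner Bx.
Proof.
move=> vB WB; apply/subsetP => _ /imsetP[w wW ->]; rewrite inE subUset !sub1set vB.
rewrite (subsetP WB) //= andbT; apply/set0Pn; exists v.
by rewrite !inE eqxx.
Qed.

(** Each test consults pairs that join a vertex outside [S] to the cluster, so a subtree is
    independent of all tests made before it. *)
Lemma success_dep K Bx W S t : wf K Bx W S t -> W \subset S -> S \subset Bx ->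
  dep (inner Bx :\: inner S) (fun E => success E W t).
Proof.
elim: t W S => //= v y IHy n IHn W S /and5P[vB vS _ wy wn] WS SB E E' EE'.
have vSB : v |: S \subset Bx by rewrite subUset sub1set vB.
have WvS : v |: W \subset v |: S by apply: setUS.
have sub : inner Bx :\: inner (v |: S) \subset inner Bx :\: inner S.
  apply: setDS; apply/subsetP => e; rewrite !inE => /andP[-> /=] eS.
  exact: subset_trans eS (subsetUr _ _).
have hE : hit E v W = hit E' v W.
  apply: (dep_sub _ (@hit_dep v W)) EE'; apply/subsetP => e eW.
  rewrite inE (subsetP (star_inner vB (subset_trans WS SB))) // andbT.
  move: eW => /imsetP[w wW ->]; rewrite inE negb_and; apply/orP; right.
  by apply/subsetPn; exists v => //; rewrite !inE eqxx.
rewrite hE; case: ifP => _.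
  exact: (dep_sub sub (IHy _ _ wy WvS vSB)).
by apply: (dep_sub sub (IHn _ _ wn _ vSB)) => //; apply: subset_trans WS (subsetUr _ _).
Qed.

Lemma Pr_success p K Bx W S t : wf K Bx W S t -> W \subset S -> S \subset Bx ->
  Pr p (fun E => success E W t) = tree_prob p #|W| t.
Proof.
elim: t W S => [|| v y IHy n IHn] W S /=.
- by move=> _ _ _; apply: PrT.
- by move=> _ _ _; rewrite /Pr big_pred0_eq.
move=> /and5P[vB vS _ wy wn] WS SB.
have vSB : v |: S \subset Bx by rewrite subUset sub1set vB.
have WvS : v |: W \subset v |: S by apply: setUS.
have WvS' : W \subset v |: S by apply: subset_trans WS (subsetUr _ _).
have vW : v \notin W by apply: contra vS; apply: subsetP.
have sub : inner Bx :\: inner (v |: S) \subset ~: star v W.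
  apply/subsetP => e; rewrite !inE => /andP[h /andP[e0 _]]; move: h; rewrite e0 /=.
  apply: contra => /imsetP[w wW ->].
  by rewrite subUset !sub1set !inE eqxx (subsetP WS w wW) orbT.
rewrite (PrID _ (fun E => hit E v W)); congr (_ + _).
  transitivity (Pr p (fun E => hit E v W && success E (v |: W) y)).
    by apply: eq_Pr => E; case: (hit E v W).
  rewrite (@Pr_indep _ _ _ (star v W)); first last.
  - exact: (dep_sub sub (success_dep wy WvS vSB)).
  - exact: hit_dep.
  rewrite (IHy _ _ wy WvS vSB) cardsU1 vW; congr (_ * _).
  by rewrite -(Pr_no_hit p v W) -PrC; apply: eq_Pr => E /=; rewrite negbK.
transitivity (Pr p (fun E => ~~ hit E v W && success E W n)).
  by apply: eq_Pr => E; case: (hit E v W).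
rewrite (@Pr_indep _ _ _ (star v W)); first last.
- exact: (dep_sub sub (success_dep wn WvS' vSB)).
- by move=> E E' EE'; rewrite (hit_dep EE').
by rewrite (IHn _ _ wn WvS' vSB) Pr_no_hit.
Qed.

Lemma success_grown K Bx W S t E : wf K Bx W S t -> W \subset S -> S \subset Bx ->
  success E W t -> grown Epuz E W ->
  exists W' : {set T}, [/\ W \subset W', W' \subset Bx, grown Epuz E W' & (K <= #|W'|)%N].
Proof.
elim: t W S => //= [|v y IHy n IHn] W S; first by move=> KW WS SB _ gW; exists W; split=> //; apply: subset_trans WS SB.
move=> /and5P[vB vS /exists_inP[w wW vw] wy wn] WS SB.
have vSB : v |: S \subset Bx by rewrite subUset sub1set vB.
have vW : v \notin W by apply: contra vS; apply: subsetP.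
case: ifP => [/exists_inP[u uW vu] h gW|_ h gW].
  have [||W' [h1 h2 h3 h4]] := IHy (v |: W) (v |: S) wy _ vSB h; first exact: setUS.
    by apply: grownU => //; [exists w|exists u].
  by exists W'; split=> //; apply: subset_trans h1; apply: subsetUr.
by apply: (IHn W (v |: S)) => //; apply: subset_trans WS (subsetUr _ _).
Qed.

(** Passing to a maximal grown set spares the spreading argument any explicit order of
    absorption. *)
Lemma grown_max E W : grown Epuz E W -> exists Z : {set T}, [/\ W \subset Z, grown Epuz E Z &
  forall v, v \notin Z -> (exists2 u, u \in Z & [set v; u] \in Epuz) ->
    forall u, u \in Z -> [set v; u] \notin E].
Proof.
move: {2}(#|~: W|) (leqnn #|~: W|) => k; elim: k W => [|k IH] W hk gW.
  exists W; split=> // v; move: hk; rewrite leqn0 cards_eq0 => /eqP/setP/(_ v).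
  by rewrite !inE => ->.
have [[v [vW vp [u uW vu]]]|h] := pselect (exists v, [/\ v \notin W,
    (exists2 u, u \in W & [set v; u] \in Epuz) & exists2 u, u \in W & [set v; u] \in E]).
  have [||Z [h1 h2 h3]] := IH (v |: W).
  - rewrite -ltnS; apply: leq_trans hk; apply: proper_card.
    rewrite properEneq setCS subsetUr andbT; apply: contra vW => /eqP/setP/(_ v).
    by rewrite !inE eqxx /= => /esym/negbFE.
  - by apply: grownU => //; exists u.
  by exists Z; split=> //; apply: subset_trans h1; apply: subsetUr.
exists W; split=> // v vW vp u uW; apply/negP => vu; apply: h; exists v; split=> //.
by exists u.
Qed.

Lemma grown_pairs E W : grown Epuz E W -> grown Epuz (E :&: vertex_pairs T) W.
Proof.
elim=> {W} [x|v W _ IH vW hp [u uW vu]]; first exact: grown1.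
apply: grownU => //; exists u => //; rewrite inE vu inE cards2.
by rewrite (_ : v != u) //; apply: contraNneq vW => ->.
Qed.

End Exploration.

(** * Independent nucleation attempts in disjoint boxes *)

Lemma dep_bigcup (X : finType) (I : eqType) (s : seq I) (D : I -> {set X})
    (A : I -> pred {set X}) :
  (forall i, dep (D i) (A i)) ->
  dep (\bigcup_(i <- s) D i) (fun E => all (fun i => A i E) s).
Proof.
move=> dA; elim: s => [|i s IH] E E' EE' //=.
rewrite big_cons in EE'; congr (_ && _).
  by apply: (dep_sub _ (dA i)) EE'; apply: subsetUl.
by apply: (dep_sub _ IH) EE'; apply: subsetUr.
Qed.

Lemma Pr_indep_all (R : realFieldType) (X : finType) (p : R) (I : eqType) (s : seq I)
    (D : I -> {set X}) (A : I -> pred {set X}) :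
  uniq s -> (forall i j, i != j -> [disjoint D i & D j]) ->
  (forall i, dep (D i) (A i)) ->
  Pr p (fun E => all (fun i => A i E) s) = \prod_(i <- s) Pr p (A i).
Proof.
move=> + dD dA; elim: s => [|i s IH] /=; first by rewrite big_nil PrT.
move=> /andP[is_ us]; rewrite big_cons -IH //; apply: Pr_indep => //.
apply: (@dep_sub _ (\bigcup_(j <- s) D j)); last by apply: dep_bigcup dA.
elim: s is_ {us IH} => [|j s IH]; first by rewrite big_nil sub0set.
rewrite inE negb_or => /andP[ij is_]; rewrite big_cons subUset IH // andbT.
by rewrite -disjoints_subset disjoint_sym dD.
Qed.

Section Nucleation.
Variables (R : realFieldType) (T : finType) (Epuz : {set {set T}}) (p : R) (K : nat).
Variables (I : finType) (Bx : I -> {set T}) (s : I -> T) (t : I -> tree T) (q : R).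
Hypothesis p01 : 0 <= p <= 1.
Hypothesis Bx_disj : forall i j, i != j -> [disjoint Bx i & Bx j].
Hypothesis s_Bx : forall i, s i \in Bx i.
Hypothesis t_wf : forall i, wf Epuz K (Bx i) [set s i] [set s i] (t i).
Hypothesis t_prob : forall i, q <= tree_prob p 1 (t i).
Hypothesis Bx_small : forall i, (K <= #|~: Bx i|)%N.
Hypothesis spread : forall i W E, grown Epuz E W -> s i \in W -> W \subset Bx i ->
  (forall v, v \notin Bx i -> hit E v W) -> (forall v, v \in Bx i -> hit E v (~: Bx i)) ->
  grown Epuz E setT.

Let D i := inner (Bx i).
Let G i E := success E [set s i] (t i).

Let G_dep i : dep (D i) (G i).
Proof.
apply: dep_sub (success_dep (t_wf i) (subxx _) _); first exact: subsetDl.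
by rewrite sub1set.
Qed.

(** The nucleus is selected from the configuration inside the box alone, so the pairs leaving the
    box stay fresh. The default [set0] is not met when [G i] holds. *)
Let nucleus i (S : {set {set T}}) : {set T} := odflt set0
  [pick W : {set T} | [&& s i \in W, W \subset Bx i, (K <= #|W|)%N & `[< grown Epuz S W >]]].

Let nucleusP i E : G i E ->
  [/\ s i \in nucleus i (E :&: D i), nucleus i (E :&: D i) \subset Bx i,
      (K <= #|nucleus i (E :&: D i)|)%N & grown Epuz (E :&: D i) (nucleus i (E :&: D i))].
Proof.
move=> GE; rewrite /nucleus; case: pickP => [W /and4P[h1 h2 h3 /asboolP h4] //|h].
have GE' : G i (E :&: D i).
  by rewrite -(@G_dep i E) // -setIA setIid.
have [||W [sW WB gW KW]] := success_grown (t_wf i) (subxx _) _ GE'.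
- by rewrite sub1set.
- exact: grown1.
by move: (h W); rewrite -sub1set sW WB KW /=; move/asboolPn; case.
Qed.

Let bad i (S E : {set {set T}}) : bool :=
  [exists v, ~~ hit E v (if v \in Bx i then ~: Bx i else nucleus i S)].

Let nucleus_sub i S : nucleus i S \subset Bx i.
Proof. by rewrite /nucleus; case: pickP => [W /and4P[]|] //= _; apply: sub0set. Qed.

(** The pairs tested by [bad] have exactly one end in the box. *)
Let bad_dep i S : dep (~: D i) (bad i S).
Proof.
move=> E E' EE'; apply: eq_existsb => v; congr (~~ _).
apply: (dep_sub _ (@hit_dep _ _ _)) EE'.
apply/subsetP => _ /imsetP[w + ->]; rewrite !inE subUset !sub1set.
case: ifP => [vB|vB].
  by rewrite inE => /negbTE ->; rewrite !andbF.
by rewrite andbF.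
Qed.

Let Pr_bad i S : (K <= #|nucleus i S|)%N -> Pr p (bad i S) <= #|T|%:R * (1 - p) ^+ K.
Proof.
move=> hK; have [p0 p1] := andP p01.
have := @Pr_exists_le R _ p _ predT
  (fun v E => ~~ hit E v (if v \in Bx i then ~: Bx i else nucleus i S)) p01.
rewrite /= => /le_trans; apply.
rewrite mulr_natl -sumr_const; apply: ler_sum => v _; rewrite Pr_no_hit.
apply: ler_wiXn2l; [by rewrite subr_ge0|by rewrite lerBlDr lerDl|].
by case: ifP.
Qed.

(** [Solve] can fail only if no box nucleates, where independence gives the power of [1 - q], or if
    some nucleus misses a vertex, where a union bound over boxes and vertices applies. *)
Lemma Pr_solve_ge :
  1 - (1 - q) ^+ #|I| - #|I|%:R * (#|T|%:R * (1 - p) ^+ K) <=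
  Pr p (fun E => `[< Solve Epuz (E :&: vertex_pairs T) 1 1 None >]).
Proof.
have [p0 p1] := andP p01.
pose NG E := all (fun i => ~~ G i E) (enum I).
pose Bd E := [exists i, G i E && bad i (E :&: D i) E].
have step : Pr p (fun E => ~~ `[< Solve Epuz (E :&: vertex_pairs T) 1 1 None >]) <=
    Pr p NG + Pr p Bd.
  rewrite (PrID _ NG); apply: lerD.
    by apply: Pr_le => // E /andP[].
  apply: Pr_le => // E /andP[/allPn[i _ /negPn Gi] nS].
  apply/existsP; exists i; rewrite Gi /=; apply: contraR nS => nbad.
  apply/asboolP/grown_solve/grown_pairs.
  have [h1 h2 h3 h4] := nucleusP Gi.
  have gE : grown Epuz E (nucleus i (E :&: D i)).
    elim: h4 => [x|v W _ IH vW hp [u uW]]; first exact: grown1.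
    by rewrite inE => /andP[vu _]; apply: grownU => //; exists u.
  move: nbad; rewrite negb_exists => /forallP hv.
  apply: (spread gE h1 h2) => v vB; have := hv v; rewrite negbK ?vB //.
  by rewrite (negbTE vB).
have hNG : Pr p NG <= (1 - q) ^+ #|I|.
  rewrite (@Pr_indep_all _ _ _ _ _ D (fun i E => ~~ G i E)); first last.
  - by move=> i E E' EE'; rewrite (G_dep EE').
  - move=> i j ij; apply/pred0P => e /=; rewrite !inE.
    apply/negP => /andP[/andP[/set0Pn[x xe] eB] /andP[_ eB']].
    have /pred0P/(_ x) /= := Bx_disj ij.
    by rewrite (subsetP eB) // (subsetP eB').
  - exact: enum_uniq.
  rewrite big_enum /= -prodr_const; apply: ler_prod => i _.
  rewrite Pr_ge0 //=.
  have -> : Pr p (fun E => ~~ G i E) = 1 - Pr p (G i) by rewrite -PrC.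
  rewrite lerD2l lerN2; apply: le_trans (t_prob i) _.
  have sB : [set s i] \subset Bx i by rewrite sub1set.
  by have := Pr_success p (t_wf i) (subxx _) sB; rewrite cards1 => <-.
have hBd : Pr p Bd <= #|I|%:R * (#|T|%:R * (1 - p) ^+ K).
  have := @Pr_exists_le R _ p _ predT (fun i E => G i E && bad i (E :&: D i) E) p01.
  rewrite /= => /le_trans; apply.
  rewrite mulr_natl -sumr_const; apply: ler_sum => i _.
  have c0 : 0 <= #|T|%:R * (1 - p) ^+ K by rewrite mulr_ge0 // exprn_ge0 // subr_ge0.
  apply: (@le_trans _ _ (#|T|%:R * (1 - p) ^+ K * Pr p (G i))); last first.
    by rewrite -[leRHS]mulr1; apply: ler_wpM2l => //; apply: Pr_le1.
  apply: Pr_cond_le => // S SD GS; apply: Pr_bad.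
  by have [_ _] := nucleusP GS; rewrite (setIidPl SD).
have := PrC p (fun E => `[< Solve Epuz (E :&: vertex_pairs T) 1 1 None >]).
rewrite -[Pr p (predC _)]/(Pr p (fun E => ~~ `[< Solve Epuz (E :&: vertex_pairs T) 1 1 None >])).
by move: step hNG hBd; lra.
Qed.

End Nucleation.

(** * Boxes, spreading and exploration trees on the torus *)

Section TorusGrowth.
Variables (n K : nat).
Local Notation V := ('I_n.+2 * 'I_n.+2)%type.
Local Notation G := (torus_edges n.+2).
Implicit Types (E : {set {set V}}) (W Z : {set V}).

Definition at_ (x y : nat) : V := (inord x, inord y).

Definition box (a b : nat) : {set V} :=
  [set c : V | (a <= c.1 <= a + K)%N && (b <= c.2 <= b + K)%N].

Lemma at_box a b x y : (a + K < n.+2)%N -> (b + K < n.+2)%N -> (x <= K)%N -> (y <= K)%N ->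
  at_ (a + x) (b + y) \in box a b.
Proof.
move=> aK bK xK yK; rewrite inE /at_ /= !inordK; first by rewrite !leq_addr !leq_add2l xK yK.
  by apply: leq_ltn_trans bK; rewrite leq_add2l.
by apply: leq_ltn_trans aK; rewrite leq_add2l.
Qed.

Lemma at_inj x y x' y' : (x < n.+2)%N -> (y < n.+2)%N -> (x' < n.+2)%N -> (y' < n.+2)%N ->
  at_ x y = at_ x' y' -> x = x' /\ y = y'.
Proof.
by move=> hx hy hx' hy' [] /(congr1 val) + /(congr1 val); rewrite /= !inordK.
Qed.

Lemma inordS k : (k.+1 < n.+2)%N -> inord k.+1 = inord k + 1 :> 'I_n.+2.
Proof.
move=> h; rewrite -ordSE; apply: val_inj; rewrite /= inordK // inordK; last exact: ltnW.
by rewrite modn_small.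
Qed.

Lemma at_S1 x y : (x.+1 < n.+2)%N -> [set at_ x.+1 y; at_ x y] \in G.
Proof.
move=> h; rewrite torus_edgeP !inE /at_ inordS //; apply/or4P/Or42/eqP.
by congr (_, _); rewrite /= ?addrK ?subr0.
Qed.

Lemma at_S2 x y : (y.+1 < n.+2)%N -> [set at_ x y.+1; at_ x y] \in G.
Proof.
move=> h; rewrite torus_edgeP !inE /at_ inordS //; apply/or4P/Or44/eqP.
by congr (_, _); rewrite /= ?addrK ?subr0.
Qed.

Lemma torus_row Z (y : 'I_n.+2) (Y : pred V) : (forall x, Y (x, y)) ->
  (forall v u, Y v -> u \in Z -> [set v; u] \in G -> v \in Z) ->
  forall x x', (x, y) \in Z -> (x', y) \in Z.
Proof.
move=> Yy clos x x' xZ.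
have -> : ((x', y) \in Z) = (x' \in [set x | (x, y) \in Z]) by rewrite inE.
rewrite (_ : [set x | (x, y) \in Z] = setT) ?inE //; apply: pred_closed.
  by apply/set0Pn; exists x; rewrite inE.
move=> z; rewrite !inE => zZ; apply: (clos _ (z, y)) => //.
rewrite torus_edgeP !inE; apply/or4P/Or41/eqP.
by congr (_, _); rewrite /= ?subrK ?addr0.
Qed.

Lemma torus_col Z (x : 'I_n.+2) (Y : pred V) : (forall y, Y (x, y)) ->
  (forall v u, Y v -> u \in Z -> [set v; u] \in G -> v \in Z) ->
  forall y y', (x, y) \in Z -> (x, y') \in Z.
Proof.
move=> Yy clos y y' yZ.
have -> : ((x, y') \in Z) = (y' \in [set y | (x, y) \in Z]) by rewrite inE.
rewrite (_ : [set y | (x, y) \in Z] = setT) ?inE //; apply: pred_closed.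
  by apply/set0Pn; exists y; rewrite inE.
move=> z; rewrite !inE => zZ; apply: (clos _ (x, z)) => //.
rewrite torus_edgeP !inE; apply/or4P/Or43/eqP.
by congr (_, _); rewrite /= ?subrK ?addr0.
Qed.

(** The row just below the box touches the corner [at_ a b] and is absorbed first. Columns and rows
    that avoid the box then cover its complement, row [b.-1] and column 0 lying outside because [a]
    and [b] are positive. Finally the box vertices, now with people edges to absorbed vertices, are
    taken column by column. *)
Lemma torus_spread a b W E : (0 < a)%N -> (0 < b)%N -> (a + K < n.+2)%N -> (b + K < n.+2)%N ->
  grown G E W -> at_ a b \in W -> W \subset box a b ->
  (forall v, v \notin box a b -> hit E v W) ->
  (forall v, v \in box a b -> hit E v (~: box a b)) ->
  grown G E setT.
Proof.
move=> a0 b0 aK bK gW sW WB hout hin.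
have an : (a < n.+2)%N by apply: leq_ltn_trans aK; apply: leq_addr.
have bn : (b < n.+2)%N by apply: leq_ltn_trans bK; apply: leq_addr.
have [Z [WZ gZ maxZ]] := grown_max gW.
have clos1 v u : v \notin box a b -> u \in Z -> [set v; u] \in G -> v \in Z.
  move=> vB uZ vu; apply: contraT => vZ.
  have /exists_inP[w wW vw] := hout v vB.
  by have := maxZ v vZ (ex_intro2 _ _ u uZ vu) w (subsetP WZ _ wW); rewrite vw.
pose y0 : 'I_n.+2 := inord b.-1.
have y0B x : (x, y0) \notin box a b.
  rewrite inE /= /y0 inordK; last by apply: leq_ltn_trans bn; apply: leq_pred.
  by rewrite [(b <= b.-1)%N]leqNgt prednK // leqnn !andbF.
have x0B y : (ord0, y) \notin box a b.
  by rewrite inE /= leqNgt a0.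
have row0 x : (x, y0) \in Z.
  apply: (torus_row y0B clos1) (_ : (inord a, y0) \in Z).
  apply: (clos1 _ (at_ a b)) => //; first exact: (subsetP WZ).
  by rewrite setUC -[in at_ a b](prednK b0) at_S2 // prednK.
have outZ v : v \notin box a b -> v \in Z.
  case: v => x y; rewrite inE negb_and => /orP[h|h].
    have colB y' : (x, y') \notin box a b by rewrite inE negb_and h.
    exact: (torus_col colB clos1 _ (row0 x)).
  have rowB x' : (x', y) \notin box a b by rewrite inE negb_and h orbT.
  apply: (torus_row rowB clos1) (_ : (ord0, y) \in Z).
  exact: (torus_col x0B clos1 _ (row0 _)).
have clos2 v u : predT v -> u \in Z -> [set v; u] \in G -> v \in Z.
  move=> _ uZ vu; have [vB|vB] := boolP (v \in box a b); last exact: clos1 vu.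
  apply: contraT => vZ; have /exists_inP[w] := hin v vB.
  rewrite inE => /outZ wZ vw.
  by have := maxZ v vZ (ex_intro2 _ _ u uZ vu) w wZ; rewrite vw.
suff <- : Z = setT by [].
apply/setP => -[x y]; rewrite inE.
exact: (torus_col (fun=> isT) clos2 _ (row0 x)).
Qed.

Section Trees.
Variables (a b : nat).
Hypotheses (aK : (a + K < n.+2)%N) (bK : (b + K < n.+2)%N).
Local Notation pt x y := (at_ (a + x) (b + y)).

(* j further sites are wanted and the current row is [x, x + m) at height y:
   extend it to the right until the first failure, then scan the sites above it
   from left to right and start a new row at the first one that joins. *)
Fixpoint scan_up (f : nat -> tree V) (x m y : nat) : tree V :=
  if m is m'.+1 then Test (pt x y.+1) (f x) (scan_up f x.+1 m' y) else Fail V.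

Fixpoint run_right (j x m y : nat) : tree V :=
  if j is j'.+1 then
    Test (pt (x + m) y) (run_right j' x m.+1 y)
      (scan_up (fun x' => run_right j' x' 1 y.+1) x m y)
  else Done V.

Let pt_neq x y x' y' : (x <= K)%N -> (y <= K)%N -> (x' <= K)%N -> (y' <= K)%N ->
  (x != x') || (y != y') -> pt x y != pt x' y'.
Proof.
move=> xK yK x'K y'K; apply: contraTneq => e.
have ha z : (z <= K)%N -> (a + z < n.+2)%N by move=> h; apply: leq_ltn_trans aK; rewrite leq_add2l.
have hb z : (z <= K)%N -> (b + z < n.+2)%N by move=> h; apply: leq_ltn_trans bK; rewrite leq_add2l.
have [/addnI -> /addnI ->] := at_inj (ha _ xK) (hb _ yK) (ha _ x'K) (hb _ y'K) e.
by rewrite !eqxx.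
Qed.

Definition fresh_above (S : {set V}) x y := forall x' y', (x' <= K)%N -> (y' <= K)%N ->
  (x <= x')%N -> (y < y')%N -> pt x' y' \notin S.

Definition fresh_right (S : {set V}) x y := forall x', (x' <= K)%N -> (x <= x')%N -> pt x' y \notin S.

Lemma wf_scan_up (k : nat) f j x m y (W S : {set V}) :
  (forall x (W S : {set V}), pt x y.+1 \in W -> (x + 1 + y.+1 + j <= K.+1)%N -> (k <= #|W| + j)%N ->
     W \subset S -> fresh_right S x.+1 y.+1 -> fresh_above S x y.+1 ->
     wf G k (box a b) W S (f x)) ->
  (forall i, (i < m)%N -> pt (x + i) y \in W) -> (x + m + y + j.+1 <= K.+1)%N ->
  (k <= #|W| + j.+1)%N -> W \subset S -> fresh_above S x y ->
  wf G k (box a b) W S (scan_up f x m y).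
Proof.
move=> hf; elim: m x S => //= m IH x S hseg hK kW WS fr.
have xK : (x <= K)%N by move: hK; clear; lia.
have yK : (y.+1 <= K)%N by move: hK; clear; lia.
have vS : pt x y.+1 \notin S by apply: fr.
have vW : pt x y.+1 \notin W by apply: contra vS; apply: (subsetP WS).
apply/and5P; split=> //.
- exact: at_box.
- apply/exists_inP; exists (pt x y); first by have := hseg 0%N isT; rewrite addn0.
  by rewrite addnS at_S2 // -addnS; apply: leq_ltn_trans bK; rewrite leq_add2l.
- apply: hf.
  + by rewrite !inE eqxx.
  + by move: hK; clear; lia.
  + by rewrite cardsU1 vW add1n addSnnS.
  + exact: setUS.
  + move=> x' x'K xx'; rewrite !inE negb_or fr ?(ltnW xx') // andbT.
    by apply: pt_neq => //; rewrite (gtn_eqF xx').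
  + move=> x' y' x'K y'K xx' yy'; rewrite !inE negb_or fr ?(ltnW yy') // andbT.
    by apply: pt_neq => //; rewrite (gtn_eqF yy') orbT.
- apply: IH => //.
  + by move=> i im; have := hseg i.+1 im; rewrite addSnnS.
  + by move: hK; clear; lia.
  + exact: subset_trans WS (subsetUr _ _).
  + move=> x' y' x'K y'K xx' yy'; rewrite !inE negb_or fr ?(ltnW xx') // andbT.
    by apply: pt_neq => //; rewrite (gtn_eqF xx').
Qed.

(** The bound on [x + m + y + j] keeps the exploration in the box: a gained site raises [x + m + y]
    by at most one and lowers [j] by one. Moving only right and up keeps the sites ahead fresh. *)
Lemma wf_run_right (k : nat) j x m y (W S : {set V}) : (0 < m)%N ->
  (forall i, (i < m)%N -> pt (x + i) y \in W) -> (x + m + y + j <= K.+1)%N ->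
  (k <= #|W| + j)%N -> W \subset S -> fresh_right S (x + m) y -> fresh_above S x y ->
  wf G k (box a b) W S (run_right j x m y).
Proof.
elim: j x m y W S => [|j IH] x m y W S m0 hseg hK kW WS fr fa /=.
  by rewrite addn0 in kW.
have xK : (x + m <= K)%N by move: hK; clear; lia.
have yK : (y <= K)%N by move: hK m0; clear; lia.
have vS : pt (x + m) y \notin S by apply: fr.
have vW : pt (x + m) y \notin W by apply: contra vS; apply: (subsetP WS).
apply/and5P; split=> //.
- exact: at_box.
- apply/exists_inP; exists (pt (x + m.-1) y); first by apply: hseg; rewrite prednK.
  have e : (a + (x + m) = (a + (x + m.-1)).+1)%N by rewrite -!addnS prednK.
  by rewrite e at_S1 // -e; apply: leq_ltn_trans aK; rewrite leq_add2l.
- apply: IH => //.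
  + move=> i; rewrite ltnS leq_eqVlt => /orP[/eqP->|im]; rewrite !inE ?eqxx //.
    by rewrite hseg ?orbT.
  + by move: hK; clear; lia.
  + by rewrite cardsU1 vW add1n addSnnS.
  + exact: setUS.
  + move=> x' x'K xx'; rewrite addnS in xx'; rewrite !inE negb_or fr ?(ltnW xx') // andbT.
    by apply: pt_neq => //; rewrite (gtn_eqF xx').
  + move=> x' y' x'K y'K xx' yy'; rewrite !inE negb_or fa // andbT.
    by apply: pt_neq => //; rewrite (gtn_eqF yy') orbT.
- apply: (@wf_scan_up _ _ j) => //.
  + move=> x1 W1 S1 h1 h2 h3 h4 h5 h6; apply: IH => //; last by rewrite addn1.
    by move=> [|i] // _; rewrite addn0.
  + exact: subset_trans WS (subsetUr _ _).
  + move=> x' y' x'K y'K xx' yy'; rewrite !inE negb_or fa // andbT.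
    by apply: pt_neq => //; rewrite (gtn_eqF yy') orbT.
Qed.

Lemma wf_start : (0 < K)%N ->
  wf G K (box a b) [set at_ a b] [set at_ a b] (run_right K.-1 0 1 0).
Proof.
have e0 : at_ a b = pt 0 0 by rewrite !addn0.
move=> K0; apply: wf_run_right => //.
- by move=> [|i] // _; rewrite inE !addn0.
- by move: K0; clear; lia.
- by rewrite cards1 add1n prednK.
- move=> x' x'K x0; rewrite inE e0.
  by apply: pt_neq => //; rewrite (gtn_eqF x0).
- move=> x' y' x'K y'K _ y0; rewrite inE e0.
  by apply: pt_neq => //; rewrite (gtn_eqF y0) orbT.
Qed.

End Trees.
End TorusGrowth.

(** * Rate of oriented growth *)

Section GrowthRate.
Variables (R : realFieldType) (n : nat) (p : R) (w : R -> R).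
Hypothesis p01 : 0 <= p <= 1.
Hypothesis w_ge0 : forall s : R, 0 <= s <= 1 -> 0 <= w s.
Hypothesis w_eq : forall s : R, 0 <= s <= 1 -> w s + s ^+ 2 * w s ^+ 2 <= 1.
Hypothesis w_mono : forall s s' : R, 0 <= s' <= s -> s <= 1 ->
  (1 - s) * w s <= (1 - s') * w s'.

(* With s the probability that a test fails, the value of a row of m sites is
   approximately 1 - rho s * s ^ m, an eigenvector for the eigenvalue rate s. *)
Definition rho s : R := 1 - (1 - s) * w s.
Definition rate s : R := (1 - s) * (1 + s + s ^+ 2 * w s).

Let w_le1 s : 0 <= s <= 1 -> w s <= 1.
Proof.
move=> hs; have := w_eq hs; have := w_ge0 hs.
have : 0 <= s ^+ 2 * w s ^+ 2 by rewrite mulr_ge0 ?sqr_ge0.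
lra.
Qed.

Let rate_ge0 s : 0 <= s <= 1 -> 0 <= rate s.
Proof.
move=> hs; have w0 := w_ge0 hs; case/andP: hs => s0 s1.
have h : 0 <= s ^+ 2 * w s by rewrite mulr_ge0 ?sqr_ge0.
by apply: mulr_ge0; lra.
Qed.

(** With [s'] replaced by [s], the terms free of [s ^+ m] cancel by the choice of [rate], and the
    coefficient of [s ^+ m] in the difference is (1 - s)^2 (1 - w - s^2 w^2), nonnegative by [w_eq].
    Lowering [s] to [s'] only helps, since [rho] and the powers are monotone. *)
Lemma rate_step s s' (m : nat) : 0 <= s' <= s -> s <= 1 ->
  rate s * (1 - rho s * s ^+ m) <=
  (1 - s) * (1 - rho s' * s' ^+ m.+1) + s * (1 - s ^+ m) * (1 - rho s' * s' ^+ 1).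
Proof.
move=> /andP[s'0 s's] s1.
have s0 : 0 <= s by apply: le_trans s's.
have hs : 0 <= s <= 1 by rewrite s0.
have hs' : 0 <= s' <= 1 by rewrite s'0 (le_trans s's).
have rho_le : rho s' <= rho s by rewrite lerD2l lerN2 w_mono ?s'0.
have rho0 t : 0 <= t <= 1 -> 0 <= rho t.
  move=> ht; have := w_le1 ht; have := w_ge0 ht; case/andP: ht => t0 t1 h0 h1.
  by rewrite /rho subr_ge0 mulr_ile1 //; lra.
have mono k : rho s' * s' ^+ k <= rho s * s ^+ k.
  by apply: ler_pM; rewrite ?rho0 ?exprn_ge0 // lerXn2r.
have sm : 0 <= s ^+ m <= 1 by rewrite exprn_ge0 //= exprn_ile1.
apply: (@le_trans _ _ ((1 - s) * (1 - rho s * s ^+ m.+1) + s * (1 - s ^+ m) * (1 - rho s * s ^+ 1))).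
  rewrite -subr_ge0.
  have -> : (1 - s) * (1 - rho s * s ^+ m.+1) + s * (1 - s ^+ m) * (1 - rho s * s ^+ 1)
    - rate s * (1 - rho s * s ^+ m) =
    s ^+ m * (1 - s) ^+ 2 * (1 - (w s + s ^+ 2 * w s ^+ 2)).
    by rewrite /rate /rho exprS expr1; ring.
  have /andP[sm0 _] := sm.
  apply: mulr_ge0; last by rewrite subr_ge0 w_eq.
  by apply: mulr_ge0 => //; apply: sqr_ge0.
have /andP[sm0 sm1] := sm.
apply: lerD; apply: ler_wpM2l.
- by rewrite subr_ge0.
- by rewrite lerD2l lerN2.
- by rewrite mulr_ge0 // subr_ge0.
- by rewrite lerD2l lerN2.
Qed.

Let s_ (k : nat) : R := (1 - p) ^+ k.

Let s01 k : 0 <= s_ k <= 1.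
Proof.
have /andP[p0 p1] := p01.
have h0 : 0 <= 1 - p by lra.
by rewrite /s_ exprn_ge0 //= exprn_ile1 //; lra.
Qed.

Lemma tree_prob_scan_up (a b : nat) f (x m y k : nat) (c : R) :
  (forall x', c <= tree_prob p k.+1 (f x')) ->
  (1 - (1 - p) ^+ k ^+ m) * c <= tree_prob p k (@scan_up n a b f x m y).
Proof.
move=> hc; elim: m x => [|m IH] x /=; first by rewrite expr0 subrr mul0r.
have /andP[h0 h1] := s01 k; rewrite /s_ in h0 h1.
apply: (@le_trans _ _ ((1 - (1 - p) ^+ k) * c + (1 - p) ^+ k * ((1 - (1 - p) ^+ k ^+ m) * c))).
  by rewrite exprS; move: ((1 - p) ^+ k) => z; rewrite le_eqVlt; apply/orP; left; apply/eqP; ring.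
by apply: lerD; apply: ler_wpM2l => //; rewrite subr_ge0.
Qed.

(** [rate_step] carries the approximate eigenvector along the tree, one factor [rate] per wanted
    site; at the leaves the eigenvector is at most 1. *)
Lemma tree_prob_run_right (a b j x m y k : nat) :
  (1 - rho ((1 - p) ^+ k) * (1 - p) ^+ k ^+ m) * \prod_(k <= i < k + j) rate ((1 - p) ^+ i)
  <= tree_prob p k (@run_right n a b j x m y).
Proof.
have [p0 p1] := andP p01.
elim: j x m y k => [|j IH] x m y k /=.
  rewrite addn0 big_geq // mulr1 gerBl mulr_ge0 ?exprn_ge0 ?subr_ge0 //.
  have /andP[z0 z1] := s01 k; rewrite /s_ in z0 z1; set z := (1 - p) ^+ k in z0 z1 *.
  by rewrite mulr_ile1 ?w_ge0 ?w_le1 ?z0 //; lra.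
set c := \prod_(k.+1 <= i < k.+1 + j) rate ((1 - p) ^+ i).
have c0 : 0 <= c by apply: prodr_ge0 => i _; apply: rate_ge0; apply: s01.
rewrite big_ltn ?addnS ?ltnS ?leq_addr // -addSn -/c.
have /andP[z0 z1] := s01 k; have /andP[z'0 _] := s01 k.+1.
have zz' : s_ k.+1 <= s_ k.
  by rewrite /s_ exprS; apply: ler_piMl => //; lra.
have hs' : 0 <= s_ k.+1 <= s_ k by rewrite z'0.
have := rate_step m hs' z1; rewrite /s_ => hstep.
set z := (1 - p) ^+ k in hstep *; set z' := (1 - p) ^+ k.+1 in hstep *.
rewrite mulrA [X in X * c]mulrC.
apply: le_trans (ler_wpM2r c0 hstep) _.
rewrite mulrDl -!mulrA; apply: lerD.
  by apply: ler_wpM2l; [rewrite subr_ge0 | apply: IH].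
apply: ler_wpM2l => //; apply: tree_prob_scan_up => x'; exact: IH.
Qed.

End GrowthRate.

(** * Logarithmic inequalities by differentiation *)

Section LogarithmicBounds.
Import classical_sets functions normedtype numFieldNormedType.Exports.
Variable R : realType.
Implicit Types (P Q : {poly R}) (x : R).

(** Mean value theorem. The sign condition is that of the derivative multiplied by [Q1 * Q2], so
    that each application leaves a polynomial inequality. *)
Lemma ln_poly_mono P Q1 Q2 x : 0 <= x ->
  (forall t, 0 <= t <= x -> 0 < Q1.[t]) -> (forall t, 0 <= t <= x -> 0 < Q2.[t]) ->
  (forall t, 0 <= t <= x ->
     0 <= P^`().[t] * (Q1.[t] * Q2.[t]) - Q1^`().[t] * Q2.[t] + Q2^`().[t] * Q1.[t]) ->
  P.[0] - ln Q1.[0] + ln Q2.[0] <= P.[x] - ln Q1.[x] + ln Q2.[x].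
Proof.
move=> x0 Q1_gt0 Q2_gt0 hd.
pose f : R -> R := (horner P - (@ln R \o horner Q1)) + (@ln R \o horner Q2).
pose df (t : R) : R := P^`().[t] - (Q1.[t])^-1 * Q1^`().[t] + (Q2.[t])^-1 * Q2^`().[t].
have fd (t : R) : 0 <= t <= x -> is_derive t 1 f (df t).
  move=> ht; have d1 := is_derive1_ln (Q1_gt0 t ht); have d2 := is_derive1_ln (Q2_gt0 t ht).
  have c1 : is_derive t 1 (@ln R \o horner Q1) ((Q1.[t])^-1 * Q1^`().[t]) by exact: is_derive1_comp.
  have c2 : is_derive t 1 (@ln R \o horner Q2) ((Q2.[t])^-1 * Q2^`().[t]) by exact: is_derive1_comp.
  exact: is_deriveD.
have [||c hc] := @MVT_segment R f df 0 x x0.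
- by move=> t /itvP ht; apply: fd; rewrite !ht.
- by apply: derivable_within_continuous => t' /itvP ht; apply: (@ex_derive _ _ _ _ _ _ _ (fd t' _)); rewrite !ht.
move=> e; rewrite -subr_ge0.
have -> : P.[x] - ln Q1.[x] + ln Q2.[x] - (P.[0] - ln Q1.[0] + ln Q2.[0]) = df c * (x - 0).
  by rewrite -e.
rewrite subr0 mulr_ge0 //.
have hc' : 0 <= c <= x by move: hc => /itvP hc; rewrite !hc.
have := hd c hc'; have := Q1_gt0 c hc'; have := Q2_gt0 c hc'.
rewrite /df; move: (Q1.[c]) (Q2.[c]) (P^`().[c]) (Q1^`().[c]) (Q2^`().[c]) => a b p' a' b' b0 a0 h.
have -> : p' - a^-1 * a' + b^-1 * b' = (p' * (a * b) - a' * b + b' * a) / (a * b).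
  by field; rewrite !gt_eqF.
by rewrite divr_ge0 // mulr_ge0 // ltW.
Qed.

(** The Taylor remainder carries the fixed [1 - y] instead of [1 - x], which keeps the majorant a
    polynomial and [ln_poly_mono] applicable. *)
Lemma ln1m_ge (N : nat) x y : 0 <= x <= y -> y < 1 ->
  - ln (1 - x) <= \sum_(m < N) x ^+ m.+1 / m.+1%:R + x ^+ N.+1 / (1 - y).
Proof.
move=> /andP[x0 xy] y1.
pose P : {poly R} := \sum_(m < N) (m.+1%:R^-1 *: 'X^(m.+1)) + (1 - y)^-1 *: 'X^(N.+1).
have PE t : P.[t] = \sum_(m < N) t ^+ m.+1 / m.+1%:R + t ^+ N.+1 / (1 - y).
  rewrite hornerD horner_sum hornerZ hornerXn [_^-1 * _]mulrC; congr (_ + _).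
  by apply: eq_bigr => m _; rewrite hornerZ hornerXn mulrC.
have dPE t : P^`().[t] = \sum_(m < N) t ^+ m + N.+1%:R * t ^+ N / (1 - y).
  rewrite derivD raddf_sum hornerD horner_sum; congr (_ + _).
    apply: eq_bigr => m _; rewrite /= derivZ derivXn hornerZ hornerMn hornerXn /=.
    by rewrite -[t ^+ m *+ _]mulr_natl mulrA mulVf ?mul1r // pnatr_eq0.
  by rewrite derivZ derivXn hornerZ hornerMn hornerXn /= -[t ^+ N *+ _]mulr_natl mulrC.
have := @ln_poly_mono P 1 (1 - 'X) x x0.
rewrite !PE !hornerE /= !ln1 !subr0 => h.
have Z : \sum_(m < N) 0 ^+ m.+1 / m.+1%:R + 0 ^+ N.+1 / (1 - y) = 0 :> R.
  by rewrite big1 ?add0r ?expr0n ?mul0r // => m _; rewrite expr0n mul0r.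
move: h; rewrite Z add0r ln1 => h; rewrite -subr_ge0 opprK; apply: h.
- by move=> t _; rewrite hornerC.
- by move=> t /andP[_ tx]; rewrite !hornerE; lra.
move=> t /andP[t0 tx].
have d1 : (1 : {poly R})^`() = 0 by rewrite -polyC1 derivC.
rewrite dPE derivB d1 derivX sub0r !hornerE /= mulr1.
have -> : (\sum_(m < N) t ^+ m + N.+1%:R * t ^+ N / (1 - y)) * (1 - t) =
   1 - t ^+ N + N.+1%:R * t ^+ N * ((1 - t) / (1 - y)).
  rewrite mulrDl; congr (_ + _).
    by rewrite -[1 - t ^+ N]opprB subrX1 mulrC -mulNr opprB.
  by rewrite -!mulrA [_^-1 * _]mulrC.
have h1 : 1 <= (1 - t) / (1 - y) by rewrite ler_pdivlMr; lra.
have h2 : 0 <= t ^+ N by rewrite exprn_ge0.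
have h3 : t ^+ N <= N.+1%:R * t ^+ N by rewrite ler_peMl // ler1n.
have h4 : N.+1%:R * t ^+ N <= N.+1%:R * t ^+ N * ((1 - t) / (1 - y)).
  by rewrite ler_peMr // mulr_ge0.
lra.
Qed.

End LogarithmicBounds.

Section GrowthCost.
Variable R : realType.
Implicit Types (s p : R).

(* A polynomial slightly below the solution 2 / (1 + sqrt (1 + 4 s^2)) of
   w + s^2 w^2 = 1. *)
Definition wlow s : R :=
  1 - 1 / 50 / 100 - 127 / 1000 * s - 153 / 250 * s ^+ 2 + 357 / 1000 * s ^+ 3.

(* The derivative of delta majorizes that of
   ln (1 + s + s^2) - ln (1 + s + s^2 wlow s). *)
Definition delta s : R :=
  27 / 100 / 100 * s - 63 / 1000 / 2 * s ^+ 2 + (1 + 7 / 1000) / 3 * s ^+ 3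
  - 611 / 1000 / 4 * s ^+ 4 - 41 / 500 / 5 * s ^+ 5.

(* Feeding these products to lra proves a polynomial inequality on [a, b] from
   the positivity of its Bernstein coefficients. *)
Lemma bernstein_ge0 (a b s : R) d i : a <= s <= b -> 0 <= (s - a) ^+ i * (b - s) ^+ (d - i).
Proof. by move=> /andP[h1 h2]; apply: mulr_ge0; apply: exprn_ge0; rewrite subr_ge0. Qed.

Lemma wlow_ge0 s : 0 <= s <= 1 -> 0 <= wlow s.
Proof.
move=> h; have b k := @bernstein_ge0 _ _ s 3 k h.
have := b 0%N; have := b 1%N; have := b 2%N; have := b 3%N; rewrite /wlow /=.
by clear; lra.
Qed.

Lemma wlow_eq s : 0 <= s <= 1 -> wlow s + s ^+ 2 * wlow s ^+ 2 <= 1.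
Proof.
(* 8 is the degree of [s ^+ 2 * wlow s ^+ 2]. The interval is cut into pieces on which the Bernstein
   products suffice for [lra]. *)
have key (a b : R) : a <= s <= b ->
    (forall k, 0 <= (s - a) ^+ k * (b - s) ^+ (8 - k)) by move=> h k; apply: bernstein_ge0.
move=> /andP[s0 s1]; rewrite /wlow.
have [h1|h1] := leP s (1 / 2).
  have b := @key 0 (1 / 2) ltac:(apply/andP; split; lra).
  have := b 0%N; have := b 1%N; have := b 2%N; have := b 3%N; have := b 4%N.
  have := b 5%N; have := b 6%N; have := b 7%N; have := b 8%N; rewrite /=; clear; lra.
have [h2|h2] := leP s (5 / 8).
  have b := @key (1 / 2) (5 / 8) ltac:(apply/andP; split; lra).
  have := b 0%N; have := b 1%N; have := b 2%N; have := b 3%N; have := b 4%N.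
  have := b 5%N; have := b 6%N; have := b 7%N; have := b 8%N; rewrite /=; clear; lra.
have [h3|h3] := leP s (3 / 4).
  have b := @key (5 / 8) (3 / 4) ltac:(apply/andP; split; lra).
  have := b 0%N; have := b 1%N; have := b 2%N; have := b 3%N; have := b 4%N.
  have := b 5%N; have := b 6%N; have := b 7%N; have := b 8%N; rewrite /=; clear; lra.
have b := @key (3 / 4) 1 ltac:(apply/andP; split; lra).
have := b 0%N; have := b 1%N; have := b 2%N; have := b 3%N; have := b 4%N.
have := b 5%N; have := b 6%N; have := b 7%N; have := b 8%N; rewrite /=; clear; lra.
Qed.

Lemma wlow_mono s s' : 0 <= s' <= s -> s <= 1 -> (1 - s) * wlow s <= (1 - s') * wlow s'.
Proof.
move=> /andP[s'0 s's] s1.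
have w0 : 0 <= wlow s by apply: wlow_ge0; rewrite s1 (le_trans s'0).
apply: ler_pM => //; first by rewrite subr_ge0.
  by rewrite lerD2l lerN2.
rewrite -subr_ge0.
have -> : wlow s' - wlow s = (s - s') *
  (127 / 1000 + 153 / 250 * (s + s') - 357 / 1000 * (s ^+ 2 + s * s' + s' ^+ 2)).
  by rewrite /wlow; field.
apply: mulr_ge0; first by rewrite subr_ge0.
have h1 : s ^+ 2 <= s by rewrite expr2 ler_piMr // (le_trans s'0).
have h2 : s * s' <= s' by rewrite ler_piMl.
have h3 : s' ^+ 2 <= s' by rewrite expr2 ler_piMr // (le_trans s's).
lra.
Qed.

(** The sign condition of [ln_poly_mono] for [delta], 1 + s + s^2 and 1 + s + s^2 [wlow s]; its
    degree is 4 + 2 + 5 = 11. *)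
Lemma delta_deriv_ge0 s : 0 <= s <= 1 ->
  0 <= (27 / 100 / 100 - 63 / 1000 * s + (1 + 7 / 1000) * s ^+ 2
      - 611 / 1000 * s ^+ 3 - 41 / 500 * s ^+ 4)
      * ((1 + s + s ^+ 2) * (1 + s + s ^+ 2 * wlow s))
    - (1 + 2 * s) * (1 + s + s ^+ 2 * wlow s)
    + (1 + 2 * (1 - 1 / 50 / 100) * s - 3 * (127 / 1000) * s ^+ 2
      - 4 * (153 / 250) * s ^+ 3 + 5 * (357 / 1000) * s ^+ 4) * (1 + s + s ^+ 2).
Proof.
have key (a b : R) : a <= s <= b ->
    (forall k, 0 <= (s - a) ^+ k * (b - s) ^+ (11 - k)) by move=> h k; apply: bernstein_ge0.
move=> /andP[s0 s1]; rewrite /wlow.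
have [h1|h1] := leP s (1 / 4).
  have b := @key 0 (1 / 4) ltac:(apply/andP; split; lra).
  have := b 0%N; have := b 1%N; have := b 2%N; have := b 3%N; have := b 4%N; have := b 5%N.
  have := b 6%N; have := b 7%N; have := b 8%N; have := b 9%N; have := b 10%N; have := b 11%N.
  by rewrite /=; clear; lra.
have [h2|h2] := leP s (1 / 2).
  have b := @key (1 / 4) (1 / 2) ltac:(apply/andP; split; lra).
  have := b 0%N; have := b 1%N; have := b 2%N; have := b 3%N; have := b 4%N; have := b 5%N.
  have := b 6%N; have := b 7%N; have := b 8%N; have := b 9%N; have := b 10%N; have := b 11%N.
  by rewrite /=; clear; lra.
have b := @key (1 / 2) 1 ltac:(apply/andP; split; lra).
have := b 0%N; have := b 1%N; have := b 2%N; have := b 3%N; have := b 4%N; have := b 5%N.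
have := b 6%N; have := b 7%N; have := b 8%N; have := b 9%N; have := b 10%N; have := b 11%N.
by rewrite /=; clear; lra.
Qed.

(* rate s = (1 - s^3) (1 + s + s^2 w s) / (1 + s + s^2), where the second
   factor is close to 1. *)
Lemma ln_rate_ge s : 0 <= s < 1 ->
  ln (1 - s ^+ 3) - delta s <= ln (rate wlow s).
Proof.
move=> /andP[s0 s1].
pose P : {poly R} := (27 / 100 / 100) *: 'X + (- (63 / 1000 / 2)) *: 'X^2
  + ((1 + 7 / 1000) / 3) *: 'X^3 + (- (611 / 1000 / 4)) *: 'X^4 + (- (41 / 500 / 5)) *: 'X^5.
pose Q1 : {poly R} := 1%:P + 'X + 'X^2.
pose Q2 : {poly R} := 1%:P + 'X + (1 - 1 / 50 / 100) *: 'X^2 + (- (127 / 1000)) *: 'X^3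
  + (- (153 / 250)) *: 'X^4 + (357 / 1000) *: 'X^5.
have PE t : P.[t] = delta t by rewrite /P !hornerE /delta /=; field.
have Q1E t : Q1.[t] = 1 + t + t ^+ 2 by rewrite /Q1 !hornerE.
have Q2E t : Q2.[t] = 1 + t + t ^+ 2 * wlow t by rewrite /Q2 !hornerE /wlow /=; field.
have dPE t : P^`().[t] = 27 / 100 / 100 - 63 / 1000 * t + (1 + 7 / 1000) * t ^+ 2
    - 611 / 1000 * t ^+ 3 - 41 / 500 * t ^+ 4.
  by rewrite /P !(derivD, derivZ, derivXn, derivX) /= !hornerE /=; field.
have dQ1E t : Q1^`().[t] = 1 + 2 * t.
  by rewrite /Q1 !(derivD, derivC, derivXn, derivX) /= !hornerE /=; ring.
have dQ2E t : Q2^`().[t] = 1 + 2 * (1 - 1 / 50 / 100) * t - 3 * (127 / 1000) * t ^+ 2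
    - 4 * (153 / 250) * t ^+ 3 + 5 * (357 / 1000) * t ^+ 4.
  by rewrite /Q2 !(derivD, derivC, derivZ, derivXn, derivX) /= !hornerE /=; field.
have Q1_gt0 t : 0 <= t -> 0 < Q1.[t].
  by move=> t0; rewrite Q1E; have h2 := sqr_ge0 t; lra.
have Q2_gt0 t : 0 <= t <= s -> 0 < Q2.[t].
  move=> /andP[t0 ts]; rewrite Q2E.
  have : 0 <= t ^+ 2 * wlow t.
    by rewrite mulr_ge0 ?sqr_ge0 // wlow_ge0 // t0 /= ltW // (le_lt_trans ts).
  by lra.
have mono : 0 <= delta s - ln (1 + s + s ^+ 2) + ln (1 + s + s ^+ 2 * wlow s).
  have := @ln_poly_mono R P Q1 Q2 s s0; rewrite !PE !Q1E !Q2E.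
  have -> : delta 0 = 0 by rewrite /delta !expr0n /= !mulr0; ring.
  rewrite expr0n /= mul0r !addr0 ln1 subr0 addr0; apply.
  - by move=> t /andP[t0 _]; apply: Q1_gt0.
  - exact: Q2_gt0.
  move=> t /andP[t0 ts]; rewrite dPE dQ1E dQ2E Q1E Q2E; apply: delta_deriv_ge0.
  by rewrite t0 (le_trans ts) // ltW.
have q0 : 0 < 1 + s + s ^+ 2 by rewrite -Q1E; apply: Q1_gt0.
have M0 : 0 < 1 + s + s ^+ 2 * wlow s by rewrite -Q2E; apply: Q2_gt0; rewrite s0 lexx.
have s10 : 0 < 1 - s by lra.
have -> : 1 - s ^+ 3 = (1 - s) * (1 + s + s ^+ 2) by ring.
rewrite /rate !lnM ?posrE //; lra.
Qed.

End GrowthCost.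

(** Telescoping: 1 / y^2 is at most 1 / (y - 1/2) - 1 / (y + 1/2). Seven exact terms bring the bound
    for pi^2 / 6 = 1.64493... down to 1.6452. *)
Lemma inv_sqr_sum_le (R : realFieldType) (N : nat) : \sum_(m < N + 7) (m.+1%:R ^+ 2)^-1 + ((N + 7)%:R + 1 / 2)^-1
  <= 1 + 645 / 1000 + 2 / 100 / 100 :> R.
Proof.
elim: N => [|N IH].
  have -> : \sum_(m < 0 + 7) (m.+1%:R ^+ 2)^-1 =
      1 + 1 / 4 + 1 / 9 + 1 / 16 + 1 / 25 + 1 / 36 + 1 / 49 :> R.
    by rewrite add0n !big_ord_recr big_ord0 /=; field.
  have -> : ((0 + 7)%:R + 1 / 2)^-1 = 2 / 15 :> R by rewrite add0n; field.
  by clear; lra.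
apply: le_trans IH; rewrite addSn big_ord_recr /= -addrA lerD2l.
set y : R := (N + 7).+1%:R; have -> : (N + 7)%:R = y - 1 :> R by rewrite /y -natr1 addrK.
have y1 : 1 <= y by rewrite ler1n.
move: y y1 => y y1.
have a1 : 0 < y ^+ 2 by apply: exprn_gt0; lra.
have a2 : 0 < y + 1 / 2 by lra.
have a3 : 0 < y - 1 + 1 / 2 by lra.
rewrite -subr_ge0.
have -> : (y - 1 + 1 / 2)^-1 - ((y ^+ 2)^-1 + (y + 1 / 2)^-1) =
   1 / 4 / (y ^+ 2 * ((y - 1 + 1 / 2) * (y + 1 / 2))).
  by field; rewrite ?gt_eqF //; lra.
by rewrite divr_ge0 ?mulr_ge0 // ?ltW //; lra.
Qed.

(** * The product of the rates along a growing cluster *)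

Section GrowthProduct.
Variables (R : realType) (p : R).
Hypothesis p01 : 0 < p < 1.

Let r := 1 - p.
Let r_gt0 : 0 < r. Proof. by have /andP[h1 h2] := p01; rewrite /r; lra. Qed.
Let r_lt1 : r < 1. Proof. by have /andP[h1 h2] := p01; rewrite /r; lra. Qed.
Let p_gt0 : 0 < p. Proof. by have /andP[] := p01. Qed.

Let pow_ge (j : nat) : 1 - j%:R * p <= r ^+ j.
Proof.
elim: j => [|j IH]; first by rewrite mul0r subr0 expr0.
have h : r ^+ j <= 1 by rewrite exprn_ile1 // ltW.
have -> : r ^+ j.+1 = r ^+ j - p * r ^+ j by rewrite exprS /r; ring.
have h' : p * r ^+ j <= p by rewrite ler_piMr // ltW.
by rewrite -natr1; lra.
Qed.

Let pow_le (j : nat) : r ^+ j * (1 + j%:R * p) <= 1.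
Proof.
elim: j => [|j IH]; first by rewrite mul0r addr0 expr0 mulr1.
apply: le_trans IH; rewrite exprSr -mulrA; apply: ler_wpM2l.
  by rewrite exprn_ge0 // ltW.
have h : 0 <= j%:R * (p * p) by rewrite !mulr_ge0 // ltW.
have h' : 0 <= p * p by rewrite mulr_ge0 // ltW.
rewrite -natr1 /r; lra.
Qed.

(** [p * geom J j] is a Riemann sum at the points [r ^+ k] for the integral of s^(j - 1) over
    [0, 1], that is, for 1 / j. *)
Let geom (J j : nat) := \sum_(1 <= k < J.+1) r ^+ k ^+ j.

Let geomE J j : geom J j * (1 - r ^+ j) = r ^+ j - r ^+ j * r ^+ J ^+ j.
Proof.
rewrite /geom; elim: J => [|J IH].
  by rewrite big_geq // mul0r expr0 expr1n mulr1 subrr.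
rewrite big_nat_recr //= mulrDl IH exprSr exprMn.
move: (r ^+ j) (r ^+ J ^+ j) => x y; ring.
Qed.

Let geom_le J j : (0 < j)%N -> geom J j <= (j%:R * p)^-1.
Proof.
move=> j0; have jp : 0 < j%:R * p by rewrite mulr_gt0 // ltr0n.
have d0 : 0 < 1 - r ^+ j by rewrite subr_gt0 exprn_ilt1 // -?lt0n // ltW.
have h0 : 0 <= r ^+ j by rewrite exprn_ge0 // ltW.
rewrite -(ler_pM2r d0) geomE.
apply: (@le_trans _ _ (r ^+ j)).
  by rewrite gerBl mulr_ge0 // !exprn_ge0 // ltW.
rewrite mulrC ler_pdivlMr //.
by have := pow_le j; rewrite mulrDr mulr1; lra.
Qed.

(** Bounding [r ^+ j] below by [1 - j p] loses [j p], and stopping at [J] loses at most [j p] again;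
    division by [j p] turns this into 2. *)
Let geom_ge J j : (0 < j)%N -> r ^+ J <= p -> (j%:R * p)^-1 - 2 <= geom J j.
Proof.
move=> j0 rJ; have jp : 0 < j%:R * p by rewrite mulr_gt0 // ltr0n.
have d0 : 0 < 1 - r ^+ j by rewrite subr_gt0 exprn_ilt1 // -?lt0n // ltW.
have h0 : 0 <= r ^+ j by rewrite exprn_ge0 // ltW.
have h1 : r ^+ j <= 1 by rewrite exprn_ile1 // ltW.
have g0 : 0 <= geom J j by apply: sumr_ge0 => k _; rewrite !exprn_ge0 // ltW.
have hp := pow_ge j.
have j1 : 1 <= j%:R :> R by rewrite ler1n.
have rJj : r ^+ j * r ^+ J ^+ j <= j%:R * p.
  apply: (@le_trans _ _ p); last by rewrite ler_peMl // ltW.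
  apply: le_trans rJ; rewrite -[leRHS]mul1r; apply: ler_pM => //.
    by rewrite !exprn_ge0 // ltW.
  by rewrite -[leRHS]expr1; apply: ler_wiXn2l => //; rewrite ?exprn_ge0 ?exprn_ile1 // ltW.
have e := geomE J j.
have h2 : geom J j * (1 - r ^+ j) <= geom J j * (j%:R * p).
  by apply: ler_wpM2l => //; lra.
rewrite -(ler_pM2r jp) mulrBl mulVf ?gt_eqF //; lra.
Qed.

(** Expanding the logarithm, the term of order j is [geom J (3 j) / j], at most 1 / (3 j^2 p), and
    the sum over j is close to pi^2 / (18 p). *)
Let cubes_le J : \sum_(1 <= k < J.+1) - ln (1 - r ^+ k ^+ 3) <=
  (1 + 645 / 1000 + 2 / 100 / 100) / 3 / p + 1.
Proof.
have [y yE] : exists y, y = r ^+ 3 by exists (r ^+ 3).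
have y1 : y < 1 by rewrite yE exprn_ilt1 // ltW.
have y0 : 0 < y by rewrite yE exprn_gt0.
(* The expansion order depends on [J]: all [J] remainders together must stay below 1, the final
   additive constant. *)
have [N hN] : exists N : nat, J%:R * (y ^+ (N + 7).+1 / (1 - y)) <= 1.
  have c0 : 0 <= J%:R / ((1 - y) * p) :> R by rewrite divr_ge0 // mulr_ge0 ?(ltW p_gt0) // subr_ge0 ltW.
  exists (Num.truncn (J%:R / ((1 - y) * p))).+1; set N := (Num.truncn _).+1.
  have hN : J%:R / ((1 - y) * p) <= N%:R by rewrite ltW // /N truncnS_gt.
  rewrite mulrA ler_pdivrMr; last by lra.
  rewrite mul1r; apply: (@le_trans _ _ (J%:R * r ^+ N)).
    apply: ler_wpM2l => //; rewrite yE -exprM; apply: ler_wiXn2l; rewrite ?ltW //.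
    by rewrite mulnC; lia.
  have := pow_le N; have : 0 <= r ^+ N by rewrite exprn_ge0 // ltW.
  move: hN; rewrite ler_pdivrMr; last by rewrite mulr_gt0 // subr_gt0.
  rewrite mulrA => h1 h2 h3.
  have h4 : J%:R * r ^+ N <= N%:R * (1 - y) * p * r ^+ N by apply: ler_wpM2r; lra.
  have h5 : (1 - y) * (r ^+ N * (1 + N%:R * p)) <= (1 - y) * 1 by apply: ler_wpM2l; lra.
  have h6 : 0 <= (1 - y) * r ^+ N by rewrite mulr_ge0 // subr_ge0 ltW.
  lra.
set M := (N + 7)%N in hN *.
apply: (@le_trans _ _ (\sum_(1 <= k < J.+1)
    (\sum_(m < M) (r ^+ k ^+ 3) ^+ m.+1 / m.+1%:R + y ^+ M.+1 / (1 - y)))).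
  rewrite [leLHS]big_nat_cond [leRHS]big_nat_cond; apply: ler_sum => k /andP[/andP[k1 _] _].
  have hk : 0 <= r ^+ k ^+ 3 <= y.
    have rk0 : 0 <= r ^+ k by rewrite exprn_ge0 // ltW.
    apply/andP; split; first by rewrite exprn_ge0.
    rewrite yE; apply: lerXn2r; rewrite ?nnegrE ?(ltW r_gt0) //.
    by rewrite -[leRHS]expr1; apply: ler_wiXn2l; rewrite ?ltW.
  apply: le_trans (ln1m_ge M hk y1) _; rewrite lerD2l; apply: ler_wpM2r.
    by rewrite invr_ge0; lra.
  by apply: lerXn2r; rewrite ?nnegrE //; have /andP[] := hk; lra.
rewrite big_split /= sumr_const_nat subSS subn0.
apply: lerD; last by rewrite -mulr_natl.
rewrite exchange_big /=.
apply: (@le_trans _ _ (\sum_(m < M) (m.+1%:R ^+ 2)^-1 * (3 * p)^-1)).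
  apply: ler_sum => m _.
  have -> : \sum_(1 <= k < J.+1) (r ^+ k ^+ 3) ^+ m.+1 / m.+1%:R = geom J (3 * m.+1) / m.+1%:R.
    by rewrite /geom mulr_suml; apply: eq_bigr => k _; rewrite -!exprM mulnA.
  apply: le_trans (ler_wpM2r _ (geom_le J _)) _ => //; first by rewrite invr_ge0.
  rewrite le_eqVlt natrM; apply/orP; left; apply/eqP.
  have m0 : m.+1%:R != 0 :> R by rewrite pnatr_eq0.
  have p0 : p != 0 by rewrite gt_eqF.
  by move: (m.+1%:R) m0 => z z0; field; rewrite z0 p0.
rewrite -mulr_suml.
have h : \sum_(m < M) (m.+1%:R ^+ 2)^-1 <= 1 + 645 / 1000 + 2 / 100 / 100 :> R.
  apply: le_trans (inv_sqr_sum_le R N); rewrite lerDl invr_ge0; rewrite addr_ge0 //; lra.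
apply: le_trans (ler_wpM2r _ h) _; first by rewrite invr_ge0 mulr_ge0 // ltW.
by rewrite invfM mulrA.
Qed.

(** The cubes give 1.6452 / 3 = 0.5484, and [delta] gives 0.0574, the integral of [delta s / s];
    together this is below 0.6058. The additive error is 1 from the cubes plus twice the negative
    coefficients of [delta] (0.0315, 0.15275 and 0.0164 in absolute value), which is below 2. *)
Lemma prod_rate_ge (J : nat) : (1 - p) ^+ J <= p ->
  expR (- ((60 + 58 / 100) / 100 / p + 2)) <=
  \prod_(1 <= k < J.+1) rate (@wlow R) ((1 - p) ^+ k).
Proof.
rewrite -/r => rJ.
have s01 k : (0 < k)%N -> 0 <= r ^+ k < 1.
  by move=> k0; rewrite exprn_ge0 ?exprn_ilt1 // -?lt0n // ltW.
have rate_gt0 k : (0 < k)%N -> 0 < rate (@wlow R) (r ^+ k).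
  move=> /s01/andP[h0 h1]; rewrite mulr_gt0 ?subr_gt0 //.
  have : 0 <= (r ^+ k) ^+ 2 * wlow (r ^+ k).
    by rewrite mulr_ge0 ?sqr_ge0 // wlow_ge0 // h0 ltW.
  lra.
have -> : \prod_(1 <= k < J.+1) rate (@wlow R) (r ^+ k) =
    expR (\sum_(1 <= k < J.+1) ln (rate (@wlow R) (r ^+ k))).
  rewrite expR_sum big_nat_cond [RHS]big_nat_cond; apply: eq_bigr => k /andP[/andP[k1 _] _].
  by rewrite lnK // posrE rate_gt0.
rewrite ler_expR lerNl -sumrN.
apply: (@le_trans _ _ (\sum_(1 <= k < J.+1) (- ln (1 - r ^+ k ^+ 3) + delta (r ^+ k)))).
  rewrite big_nat_cond [leRHS]big_nat_cond; apply: ler_sum => k /andP[/andP[k1 _] _].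
  by have := ln_rate_ge (s01 k k1); lra.
rewrite big_split /=.
have -> : \sum_(1 <= k < J.+1) delta (r ^+ k) =
    27 / 100 / 100 * geom J 1 - 63 / 1000 / 2 * geom J 2 + (1 + 7 / 1000) / 3 * geom J 3
    - 611 / 1000 / 4 * geom J 4 - 41 / 500 / 5 * geom J 5.
  by rewrite /geom !mulr_sumr -!sumrB -!big_split /= -!sumrB.
have i j : (0 < j)%N -> (j%:R * p)^-1 = j%:R^-1 * p^-1 by move=> j0; rewrite invfM.
have := cubes_le J.
have := geom_le J (isT : (0 < 1)%N); have := geom_ge (isT : (0 < 2)%N) rJ.
have := geom_le J (isT : (0 < 3)%N); have := geom_ge (isT : (0 < 4)%N) rJ.
have := geom_ge (isT : (0 < 5)%N) rJ.
rewrite !i //; move: (geom J 1) (geom J 2) (geom J 3) (geom J 4) (geom J 5).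
have pi0 : 0 <= p^-1 by rewrite invr_ge0 ltW.
move: (\sum_(_ <= _ < _) _) (p^-1) pi0 => a q q0 g1 g2 g3 g4 g5; lra.
Qed.

End GrowthProduct.

(** * Upper bound *)

Section UpperBound.
Variable R : realType.

Lemma onem_le_expR (p : R) (k : nat) : p <= 1 -> (1 - p) ^+ k <= expR (- (p * k%:R)).
Proof.
move=> p1; rewrite -mulNr expRM_natr; apply: lerXn2r; rewrite ?nnegrE ?expR_ge0 ?subr_ge0 //.
exact: expR_ge1Dx.
Qed.

Lemma expR_ge_cube (x : R) : 0 <= x -> x ^+ 3 / 6 <= expR x.
Proof.
move=> x0; have := expR_ge1Dxn 2 x0; have -> : 3`!%:R = 6 :> R by [].
by move: (_ / 6) => y; lra.
Qed.

Lemma er_prob_solve_grid (n K m : nat) (p q : R) :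
  m = (n.+1 %/ K.+1)%N -> q = p * expR (- ((60 + 58 / 100) / 100 / p + 2)) ->
  0 < p < 1 -> (0 < K)%N -> (K <= n.+2)%N ->
  (1 - p) ^+ K.-1 <= p ->
  1 - (1 - q) ^+ (m * m) - (m * m)%:R * ((n.+2 * n.+2)%:R * (1 - p) ^+ K) <=
  er_prob p (fun Eppl => Solve (torus_edges n.+2) Eppl 1 1 None).
Proof.
move=> mE qE p01 K0 Kn rK; have [p0 p1] := andP p01.
have p01' : 0 <= p <= 1 by rewrite !ltW.
have mn : (m * K.+1 <= n.+1)%N by rewrite mE leq_divM.
(* Corners start at 1, so that row 0 and column 0 lie outside every box; this is why [m] divides
   [n.+1] sites and not [n.+2]. *)
pose co (i : 'I_m) := (i * K.+1).+1.
have coK i : (co i + K < n.+2)%N.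
  rewrite ltnS; apply: leq_trans mn; rewrite /co addSnnS addnC -mulSn.
  by rewrite leq_mul2r ltn_ord.
have co_inj (i j : 'I_m) (x : nat) : (co i <= x <= co i + K)%N -> (co j <= x <= co j + K)%N -> i = j.
  have div (k : 'I_m) : (co k <= x <= co k + K)%N -> (k : nat) = (x.-1 %/ K.+1)%N.
    rewrite /co => /andP[h1 h2]; case: x h1 h2 => // x h1 h2 /=.
    by rewrite -(subnKC (h1 : (k * K.+1 <= x)%N)) divnMDl // divn_small ?addn0 // ltnS leq_subLR.
  by move=> /div hi /div hj; apply: val_inj; rewrite /= hi hj.
have := @Pr_solve_ge R _ (torus_edges n.+2) p K ('I_m * 'I_m)%type
  (fun i => box n K (co i.1) (co i.2)) (fun i => at_ n (co i.1) (co i.2))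
  (fun i => run_right n (co i.1) (co i.2) K.-1 0 1 0) q p01'.
rewrite !card_prod !card_ord er_probE; apply.
- move=> i j ij; apply/pred0P => c /=; rewrite !inE; apply/negP => /andP[].
  move=> /andP[h1 h2] /andP[h3 h4]; case/eqP: ij.
  by rewrite [i]surjective_pairing [j]surjective_pairing (co_inj _ _ _ h1 h3) (co_inj _ _ _ h2 h4).
- by move=> i; have := @at_box n K _ _ 0 0 (coK i.1) (coK i.2) isT isT; rewrite !addn0.
- by move=> i; apply: wf_start.
- move=> i; have := @tree_prob_run_right R n p (@wlow R) p01' (@wlow_ge0 R) (@wlow_eq R)
    (@wlow_mono R) (co i.1) (co i.2) K.-1 0 1 0 1.
  apply: le_trans; rewrite qE add1n !expr1.
  have hs : 0 <= 1 - p <= 1 by apply/andP; split; lra.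
  apply: ler_pM (prod_rate_ge p01 rK); [exact: ltW | exact: expR_ge0 |].
  rewrite /rho; have w0 := wlow_ge0 hs.
  have : 0 <= (1 - (1 - p)) * wlow (1 - p) * (1 - p) by rewrite !mulr_ge0 //; lra.
  by rewrite mulrBl mul1r; lra.
- move=> i; have inj : injective (fun y : 'I_n.+2 => (ord0 : 'I_n.+2, y)) by move=> y y' [].
  apply: leq_trans (_ : #|[set (ord0 : 'I_n.+2, y) | y : 'I_n.+2]| <= _)%N.
    by rewrite card_imset // card_ord.
  by apply/subset_leq_card/subsetP => _ /imsetP[y _ ->]; rewrite !inE.
- move=> i W E gW sW WB; apply: (torus_spread _ _ (coK i.1) (coK i.2) gW sW WB) => //.
Qed.

Lemma er_prob_solve_gt (n : nat) (L p : R) : 1000 <= L -> expR L = n.+2%:R ->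
  p * L = 303 / 1000 ->
  3 * 42 ^+ 2 * 4 * expR 2 * L ^+ 5 * expR (- (5 / 100 / 100 * L)) < 1 ->
  2^-1 < er_prob p (fun Eppl => Solve (torus_edges n.+2) Eppl 1 1 None).
Proof.
move=> L1000 /esym nE pL hL.
have L0 : 0 < L by lra.
have p0 : 0 < p by rewrite -(pmulr_lgt0 _ L0) pL; lra.
have p1 : p <= 1 / 1000 by rewrite -(ler_pM2r L0) pL; lra.
have p01 : 0 < p < 1 by apply/andP; split; lra.
have pV : p^-1 = L / (303 / 1000) by rewrite -pL invfM; field; rewrite !gt_eqF.
(* This size makes (1 - p)^K at most n^(-6), against at most m^2 n^2 <= n^4 choices of box and
   vertex in [tail]. The target size is [k.+1]. *)
pose x := 6 * L / p.
have x0 : 0 <= x by rewrite divr_ge0 ?ltW //; lra.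
have xp : p * x = 6 * L by rewrite /x mulrC divfK // gt_eqF.
have /andP[k1 k2] : (Num.truncn x)%:R <= x < (Num.truncn x).+1%:R by apply: truncn_itv.
set k := Num.truncn x in k1 k2.
have kS : k.+1%:R = k%:R + 1 :> R by rewrite natr1.
have xL : x <= 20 * L ^+ 2.
  by rewrite /x pV; have h := sqr_ge0 L; rewrite expr2 in h *; lra.
have KL : k.+2%:R <= 21 * L ^+ 2.
  rewrite -natr1 kS; have h : 1000 * L <= L ^+ 2 by rewrite expr2; apply: ler_wpM2r; lra.
  by clear -k1 xL h L1000; lra.
have cube := expR_ge_cube (ltW L0).
have nbig : 42 * L ^+ 2 <= n.+2%:R.
  rewrite nE; apply: le_trans cube.
  have : L ^+ 2 * 1000 <= L ^+ 2 * L by apply: ler_wpM2l => //; apply: sqr_ge0.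
  by rewrite exprSr; have := sqr_ge0 L; clear; lra.
have Kn : (k.+1 <= n.+2)%N.
  rewrite -(ler_nat R); apply: le_trans nbig; move: KL; rewrite -natr1.
  by have := sqr_ge0 L; clear; lra.
have rK : (1 - p) ^+ k <= p.
  apply: le_trans (onem_le_expR k _) _; first by clear -p1; lra.
  have h1 : 6 * L - 1 <= p * k%:R.
    have : p * x <= p * k.+1%:R by apply: ler_wpM2l; apply: ltW.
    by rewrite xp kS mulrDr mulr1; clear -p1; lra.
  apply: (@le_trans _ _ (expR (- (6 * L - 1)))); first by rewrite ler_expR lerN2.
  rewrite expRN -[leRHS]invrK lef_pV2 ?posrE ?invr_gt0 ?expR_gt0 // pV.
  by apply: le_trans (expR_ge1Dx _); clear -L0; lra.
have [m mE] : exists m, m = (n.+1 %/ k.+2)%N by exists (n.+1 %/ k.+2)%N.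
have [q qE] : exists q, q = p * expR (- ((60 + 58 / 100) / 100 / p + 2)).
  by exists (p * expR (- ((60 + 58 / 100) / 100 / p + 2))).
apply: lt_le_trans (er_prob_solve_grid mE qE p01 (isT : (0 < k.+1)%N) Kn rK).
have q0 : 0 <= q by rewrite qE mulr_ge0 ?expR_ge0 // ltW.
have m_le : m%:R <= expR L.
  by rewrite -nE ler_nat mE; apply: leq_trans (leq_div _ _) _; apply: leqnSn.
have m_ge : expR L <= 42 * L ^+ 2 * m%:R.
  have h : n.+2%:R <= (m%:R + 1) * k.+2%:R :> R.
    by rewrite natr1 -natrM ler_nat mE ltn_ceil.
  have h2 : (m%:R + 1) * k.+2%:R <= (m%:R + 1) * (21 * L ^+ 2).
    by apply: ler_wpM2l => //; rewrite addr_ge0.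
  by rewrite nE in h nbig; clear -h h2 nbig; lra.
have tail : (m * m)%:R * ((n.+2 * n.+2)%:R * (1 - p) ^+ k.+1) <= 1 / 8.
  have rS : (1 - p) ^+ k.+1 <= expR (- (6 * L)).
    apply: le_trans (onem_le_expR _ _) _; first by clear -p1; lra.
    by rewrite ler_expR lerN2 -xp; apply: ler_wpM2l; apply: ltW.
  have r0 : 0 <= (1 - p) ^+ k.+1 by rewrite exprn_ge0 //; clear -p1; lra.
  apply: (@le_trans _ _ (expR L * expR L * (expR L * expR L * expR (- (6 * L))))).
    rewrite !natrM nE; apply: ler_pM => //; rewrite ?mulr_ge0 ?expR_ge0 //.
      by apply: ler_pM.
    by apply: ler_wpM2l => //; rewrite mulr_ge0 ?expR_ge0.
  rewrite -!expRD; have -> : L + L + (L + L + - (6 * L)) = - (2 * L) by ring.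
  rewrite expRN -[leRHS]invrK lef_pV2 ?posrE ?expR_gt0 ?invr_gt0 //; last by clear; lra.
  by apply: le_trans (expR_ge1Dx _); clear -L1000; lra.
(* From m >= n / (42 L^2), the quantity q m^2 is at least a constant times L^(-5) n^(2 - 0.6058 /
   0.303), and the exponent of n exceeds 0.0005. The value 3 suffices because exp(-3) <= 1 / (1 +
   3), leaving 1 - 1/4 - 1/8 > 1/2. *)
have qm : 3 <= q * (m * m)%:R.
  have h1 : (expR L) ^+ 2 <= 42 ^+ 2 * L ^+ 4 * (m * m)%:R.
    have -> : 42 ^+ 2 * L ^+ 4 * (m * m)%:R = (42 * L ^+ 2 * m%:R) ^+ 2 :> R.
      by rewrite natrM; move: (m%:R) => z; ring.
    by apply: lerXn2r; rewrite ?nnegrE ?expR_ge0 // !mulr_ge0 // ltW.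
  have h2 : expR (5 / 100 / 100 * L - 2 - (L + L)) <=
      expR (- ((60 + 58 / 100) / 100 / p + 2)).
    by rewrite ler_expR -mulrA pV; clear -L0; lra.
  have h3 : 3 * 42 ^+ 2 * 4 * L ^+ 5 <= expR (5 / 100 / 100 * L - 2).
    have e0 : 0 <= expR (5 / 100 / 100 * L - 2) by apply: expR_ge0.
    have := ler_wpM2l e0 (ltW hL); rewrite mulr1; apply: le_trans.
    have e1 : expR (5 / 100 / 100 * L - 2) * expR 2 * expR (- (5 / 100 / 100 * L)) = 1 :> R.
      by rewrite -!expRD subrK subrr expR0.
    have alg (u l a b c : R) : a * b * c = 1 -> a * (u * b * l * c) = u * l.
      by move=> h; rewrite -[RHS]mulr1 -h; ring.
    by rewrite alg.
  have h4 : expR (5 / 100 / 100 * L - 2) <= expR L ^+ 2 * expR (- ((60 + 58 / 100) / 100 / p + 2)).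
    rewrite expr2; apply: le_trans (ler_wpM2l _ h2); last by rewrite mulr_ge0 ?expR_ge0.
    by rewrite -!expRD ler_expR; clear; lra.
  have c0 : 0 < 42 ^+ 2 * L ^+ 4 by rewrite mulr_gt0 // exprn_gt0.
  rewrite -(ler_pM2r c0).
  apply: (@le_trans _ _ (p * (3 * 42 ^+ 2 * 4 * L ^+ 5))).
    have -> : p * (3 * 42 ^+ 2 * 4 * L ^+ 5) = 3 * 42 ^+ 2 * 4 * (p * L) * L ^+ 4 by ring.
    by rewrite pL; have := exprn_gt0 4 L0; clear; lra.
  apply: (@le_trans _ _ (p * (expR L ^+ 2 * expR (- ((60 + 58 / 100) / 100 / p + 2))))).
    by apply: ler_wpM2l; [exact: ltW | exact: le_trans h3 h4].
  have -> : p * (expR L ^+ 2 * expR (- ((60 + 58 / 100) / 100 / p + 2))) = q * expR L ^+ 2.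
    by rewrite qE; ring.
  rewrite -mulrA [(m * m)%:R * _]mulrC.
  exact: ler_wpM2l.
have small : (1 - q) ^+ (m * m) <= 1 / 4.
  have q1 : q <= 1.
    rewrite qE; apply: (@le_trans _ _ (p * 1)); last by clear -p1; lra.
    apply: ler_wpM2l; first exact: ltW.
    rewrite expR_le1 oppr_le0 addr_ge0 //.
    by rewrite divr_ge0 // ?ltW //; clear; lra.
  apply: le_trans (onem_le_expR _ q1) _.
  rewrite expRN -[leRHS]invrK lef_pV2 ?posrE ?expR_gt0 ?invr_gt0 //; last by clear; lra.
  by apply: le_trans (expR_ge1Dx _); clear -qm; lra.
by clear -small tail; lra.
Qed.

Lemma upper_bound : exists N : nat, forall n : nat, (N <= n)%N ->
  let p : R := 303 / 1000 / ln n%:R in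
  0 <= p <= 1 /\ 2^-1 < er_prob p (fun Eppl => Solve (torus_edges n) Eppl 1 1 None).
Proof.
have h1 : 0 < 5 / 100 / 100 :> R by lra.
have [L0 L0_gt0 hL0] := powexp_small (3 * 42 ^+ 2 * 4 * expR 2) 5 h1 (ltr01 : 0 < 1 :> R).
have [N hN] := ln_nat_large (Num.max L0 1000).
exists (maxn N 2) => -[|[|n]]; rewrite geq_max ?andbF // => /andP[Nn _] p.
have := hN n.+2 Nn; rewrite ge_max => /andP[LL0 L1000].
have nE : expR (ln n.+2%:R) = n.+2%:R :> R by rewrite lnK // posrE ltr0n.
have L_gt0 : 0 < ln n.+2%:R :> R by apply: lt_le_trans L0_gt0 LL0.
rewrite /p; split.
  apply/andP; split; first by rewrite divr_ge0 // ?ltW //; lra.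
  by rewrite ler_pdivrMr // mul1r; apply: le_trans L1000; lra.
apply: er_prob_solve_gt nE _ _; rewrite ?divfK ?gt_eqF //.
exact: hL0.
Qed.

End UpperBound.

Theorem theorem6 (R : realType) :
  exists N : nat, forall n : nat, (N <= n)%N ->
    exists2 pc : R, unique (is_critical (torus_edges n) 1 1 None) pc &
      388 / 10000 / ln n%:R < pc < 303 / 1000 / ln n%:R.
Proof.
have [N1 h1] := @lower_bound R; have [N2 h2] := @upper_bound R.
exists (maxn N1 N2) => n; rewrite geq_max => /andP[n1 n2].
have [pl01 low] := h1 n n1; have [pu01 up] := h2 n n2.
set pl := 388 / 10000 / _ in pl01 low *; set pu := 303 / 1000 / _ in pu01 up *.
pose A (E : {set {set 'I_n * 'I_n}}) :=
  `[< Solve (torus_edges n) (E :&: vertex_pairs _) 1 1 None >].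
rewrite !er_probE -/A in low up.
have A_mono (E E' : {set {set 'I_n * 'I_n}}) : E \subset E' -> A E -> A E'.
  by move=> EE' /asboolP h; apply/asboolP; apply: Solve_mono h; apply: setSI.
(* Nontriviality is read off from the two probability bounds instead of the dynamics: by
   monotonicity, [A set0] would force probability 1, and failure of [A setT] probability 0. *)
have A0 : ~~ A set0.
  apply: contraTN low => hA; rewrite -leNgt (@eq_Pr _ _ _ A predT) ?PrT.
    by rewrite invf_le1 ?ler1n.
  by move=> E; apply: A_mono hA; apply: sub0set.
have AT : A setT.
  apply: contraTT up => hA; rewrite -leNgt /Pr big_pred0 ?invr_ge0 //.
  by move=> E; apply/negbTE; apply: contra hA; apply: A_mono; apply: subsetT.
have [pc pc01 pcE] := @exists_critical R _ A A0 AT.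
exists pc.
  split=> [|p' [p'01]]; first by split; rewrite ?er_probE.
  rewrite er_probE => p'E; apply: (@critical_inj R _ A A_mono A0 AT) => //.
  by rewrite pcE -p'E.
have [pc0 pc1] := andP pc01; have [pl0 pl1] := andP pl01; have [pu0 pu1] := andP pu01.
apply/andP; split; rewrite ltNge; apply/negP => h.
  have := @Pr_monotone _ _ pc pl A; rewrite pc0 h pl1 pcE => /(_ isT isT A_mono).
  by rewrite leNgt low.
have := @Pr_monotone _ _ pu pc A; rewrite pu0 h pc1 pcE => /(_ isT isT A_mono).
by rewrite leNgt up.
Qed.
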